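(* Let $D<0$ be an integer with $D\equiv 0$ or $1\pmod 4$, and let $p$ be a prime with $\left(\frac Dp\right)=1$. Assume that $p^2\notin Q_p^*(\mathfrak I_D)$. Then a proper class $\mathfrak A\in\mathfrak G_D$ is completely $p$-primitive if and only if $p^2\in Q_p^*(\mathfrak A^2)$ and the order of $\mathfrak A$ in the group $\mathfrak G_D$ is $4$.
   Context: A binary quadratic form is $f(x,y)=ax^2+bxy+cy^2$ with $a,b,c\in\mathbb Z$, written $f=[a,b,c]$, whose discriminant $b^2-4ac$ is not a square; it is primitive if $\gcd(a,b,c)=1$. $\left(\frac{\cdot}{\cdot}\right)$ is the Kronecker symbol. For $D<0$, $\mathfrak G_D$ denotes the abelian group, under (Gauss) composition, of proper (i.e. $SL_2(\mathbb Z)$-) equivalence classes of primitive positive definite binary quadratic forms of discriminant $D$. Its identity $\mathfrak I_D$ is the class of $x^2-\frac D4y^2$ if $D$ is even, and of $x^2+xy+\frac{1-D}{4}y^2$ if $D$ is odd. For a form $f$, $Q(f)$ is the set of all non-zero integers $N$ such that $f(x,y)=N$ has an integer solution, and $Q_p^*(f)$ is the set of all non-zero integers $N$ such that $f(x,y)=N$ has an integer solution $(x,y)=(m,n)$ with $\gcd(m,n,p)=1$. For a proper class $\mathfrak A$, $Q(\mathfrak A)=Q(f)$ and $Q_p^*(\mathfrak A)=Q_p^*(f)$ for any $f\in\mathfrak A$ (independent of the choice of $f$), and $\mathfrak A$ is completely $p$-primitive if $Q(\mathfrak A)=Q_p^*(\mathfrak A)$. *)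

(* Defs.v *)
(* Mathematical Components world, with classical sets for the classes of
   forms. *)
From mathcomp Require Import all_boot all_order all_algebra.
From mathcomp Require Import boolp classical_sets.
Set Implicit Arguments.
Unset Strict Implicit.
Unset Printing Implicit Defensive.
Import Order.TTheory GRing.Theory Num.Theory.
Local Open Scope classical_set_scope.
Local Open Scope ring_scope.

(* The Kronecker symbol (a / p) for p prime, the only denominators needed:
   the Legendre symbol for odd p, and the residue of a modulo 8 for p = 2. *)
Definition kronecker_prime (a : int) (p : nat) : int :=
  if (p%:Z %| a)%Z then 0
  else if p == 2%N then
    if ((a == 1 %[mod 8])%Z || (a == 7 %[mod 8])%Z) then 1 else -1
  else if [exists x : 'I_p, ((x : nat)%:Z ^+ 2 == a %[mod p%:Z])%Z] then 1
  else -1.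

(* [a, b, c] is a x^2 + b x y + c y^2. That the discriminant is not a square
   is automatic below, where it is always negative. *)
Record bqf := BQF { qa : int; qb : int; qc : int }.

Definition bqf_eval (f : bqf) (x y : int) : int :=
  qa f * x ^+ 2 + qb f * x * y + qc f * y ^+ 2.

Definition disc (f : bqf) : int := qb f ^+ 2 - 4%:Z * qa f * qc f.

Definition primitive (f : bqf) : Prop := gcdz (gcdz (qa f) (qb f)) (qc f) = 1.

Definition posdef (f : bqf) : Prop :=
  forall x y : int, (x, y) != (0, 0) -> 0 < bqf_eval f x y.

Definition forms (D : int) : set bqf :=
  [set f | [/\ primitive f, posdef f & disc f = D]].

Definition proper_equiv (f g : bqf) : Prop :=
  exists s t u v : int, s * v - t * u = 1 /\
    forall x y : int,
      bqf_eval g x y = bqf_eval f (s * x + t * y) (u * x + v * y).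

Definition class_of (f : bqf) : set bqf := [set g | proper_equiv f g].

(* Underlying set of the group G_D. *)
Definition classes (D : int) : set (set bqf) :=
  [set A | exists2 f, forms D f & A = class_of f].

(* Gauss composition: h is a direct composition of f and g. For three
   primitive positive definite forms of one discriminant, the two displayed
   minors are always f(1,0) and g(1,0) up to sign; asking for the plus signs
   is Gauss's condition that the composition be direct in both arguments.
   (The six minors are then automatically coprime.) *)
Definition direct_composition (f g h : bqf) : Prop :=
  exists a1 b1 c1 d1 a2 b2 c2 d2 : int,
    [/\ forall x y z w : int,
          bqf_eval f x y * bqf_eval g z w =
          bqf_eval h (a1 * x * z + b1 * x * w + c1 * y * z + d1 * y * w)
                     (a2 * x * z + b2 * x * w + c2 * y * z + d2 * y * w),
        a1 * b2 - a2 * b1 = bqf_eval f 1 0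
      & a1 * c2 - a2 * c1 = bqf_eval g 1 0].

(* The group law: the composites of all members of A with all members of B
   form a single proper class. *)
Definition class_mul (D : int) (A B : set bqf) : set bqf :=
  [set h | forms D h /\
     exists f g, [/\ A f, B g & direct_composition f g h]].

(* The divisions are exact when D = 0 or 1 modulo 4. *)
Definition principal_form (D : int) : bqf :=
  if (2 %| D)%Z then BQF 1 0 (- (D %/ 4)%Z) else BQF 1 1 ((1 - D) %/ 4)%Z.

Definition class_one (D : int) : set bqf := class_of (principal_form D).

Definition class_exp (D : int) (A : set bqf) (n : nat) : set bqf :=
  iterop n (class_mul D) A (class_one D).

Definition has_order (D : int) (A : set bqf) (n : nat) : Prop :=
  [/\ (0 < n)%N, class_exp D A n = class_one D
    & forall m : nat, (0 < m < n)%N -> class_exp D A m <> class_one D].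

Definition Q_form (f : bqf) : set int :=
  [set N | N != 0 /\ exists m n : int, bqf_eval f m n = N].

Definition Qstar_form (p : nat) (f : bqf) : set int :=
  [set N | N != 0 /\ exists m n : int,
     gcdz (gcdz m n) p%:Z = 1 /\ bqf_eval f m n = N].

(* Members of a proper class all have the same Q_form and Qstar_form. *)
Definition Q (A : set bqf) : set int :=
  [set N | exists2 f, A f & Q_form f N].

Definition Qstar (p : nat) (A : set bqf) : set int :=
  [set N | exists2 f, A f & Qstar_form p f N].

Definition completely_primitive (p : nat) (A : set bqf) : Prop :=
  Q A = Qstar p A.

(* Main.v *)
From Stdlib Require Import Reals Lra Lia.
From Coquelicot Require Import Coquelicot.

(** Let G be the class group of discriminant D, and let r_C(n) be the number of
    representations of n by a form of the class C. As D is a square modulo p,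
    there is a class P of the forms [p, b, c]. Such a form, and more generally
    [p a, b, p c], vanishes modulo p on two lines; sorting the solutions of
    f = n p by these lines gives the Hecke relation
      r_C(n p) + r_C(n / p) = r_(C P)(n) + r_(C P^-1)(n),
    where r_C(n / p) = 0 if p does not divide n ([cnum_split]). Moreover
    r_C(1) > 0 only for C = 1.

    The class C has a p-primitive representation of n p if and only if
    r_C(n p) > r_C(n / p). So p^2 is in Q*_p(C) exactly when C = P^2 or
    C = P^-2 ([Qstar_psq]), and the hypothesis on the principal class says that
    P^2 <> 1. Let C be completely p-primitive; then n p^2 is in Q*_p(C) whenever
    C represents n. Take for n a prime q represented by C: only C and C^-1
    represent q ([cnum_prime]), and the relations at p leave only C^2 = P^2 or
    C^2 = P^-2. Take n = q p with a prime q represented by C P^-1: now P^4 = 1.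
    Hence C^2 = P^2 <> 1 = C^4. Conversely, if C has order 4 and
    C^2 = P^2, then C P^2 and C P^-2 are C^-1, whose representation numbers
    are those of C, and the relations at p show by induction that every
    represented number has a p-primitive representation
    ([hecke_completely_primitive]).

    What this needs is that every class represents primes beyond any bound
    ([class_represents_primes]). For an even character phi of G (a
    [cosine]), put lam_phi(n) = w^-1 sum_C phi(C) r_C(n) for n prime to D, with
    w = r_1(1). By the Hecke relations lam_phi is multiplicative with local
    factors 1 / (1 - t_q X + e_q X^2) ([twist_hecke]). Counting lattice points
    with the weight (y - f(v))^2 on f(v) < y gives
      sum_n r_C(n) (y - n)^2 = kappa y^3 + O(y^2)
    over n < y prime to D, with the same kappa for all classes
    ([class_mean]); hence the sum with lam_phi is O(y^2) unless phi = 1.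

    A cubic Riesz mean S3(x) of the series sum lam_phi(n) / n replaces the
    value at 1 of an L-function, and it stays away from 0 for phi <> 1
    ([S3_nonvanishing]): the Dirichlet convolution of lam_phi with lam_1 has
    nonnegative coefficients, which are at least 1 at squares of squarefree
    numbers, so its smoothed sum up to x is at least of order x^2 x^(1/4), while
    S3 = O(1 / x) would make that sum O(x^2 log x). Newton's identities at all
    primes express S3(x) times the sum of log q tau_phi(q^k) / q^k over
    q^k <= x as a bounded quantity, up to an error controlled by Chebyshev's
    bound; so the latter sum is bounded for phi <> 1, and it is unbounded for
    phi = 1. The indicator of {A, A^-1} is a combination of cosines in which
    the trivial one has positive weight ([even_delta_cosines]), so the primes
    q whose class is A or A^-1 cannot be finite in number
    ([primes_in_classes]). *)

(** * Truncations and continuity *)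

Section RealIntegrals.
Local Open Scope R_scope.

(* integrals live in a normed module that is only convertible to R *)
Ltac eqR := match goal with |- @eq _ ?a ?b => change (@eq R a b) end.

Definition rpos (z : R) := Rmax 0 z.

Lemma rpos_ge0 z : 0 <= rpos z.
Proof. apply Rmax_l. Qed.

Lemma rpos_pos z : 0 <= z -> rpos z = z.
Proof. intros h; apply Rmax_right; exact h. Qed.

Lemma rpos_neg z : z <= 0 -> rpos z = 0.
Proof. intros h; apply Rmax_left; exact h. Qed.

Lemma rpos_scale c z : 0 <= c -> rpos (c * z) = c * rpos z.
Proof.
intros hc; destruct (Rle_dec 0 z) as [h|h].
- rewrite !rpos_pos; nra.
- rewrite (rpos_neg z), rpos_neg; nra.
Qed.

Lemma continuous_rpos z : continuous rpos z.
Proof.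
apply continuous_ext with (fun z => (z + Rabs z) / 2).
- intros y; unfold rpos, Rmax; destruct (Rle_dec 0 y) as [h|h].
  + rewrite Rabs_pos_eq; lra.
  + rewrite Rabs_left; lra.
- apply (continuous_mult (fun z => z + Rabs z) (fun _ => / 2)).
  + apply (continuous_plus (fun z => z) Rabs).
    * apply continuous_id.
    * apply continuous_Rabs.
  + apply continuous_const.
Qed.

Lemma continuous_rpos_comp (f : R -> R) z : continuous f z ->
  continuous (fun y => rpos (f y)) z.
Proof. intros h; apply continuous_comp; [exact h|apply continuous_rpos]. Qed.

Lemma continuous_mulR (f g : R -> R) z : continuous f z -> continuous g z ->
  continuous (fun y => f y * g y) z.
Proof. intros hf hg; exact (continuous_mult f g z hf hg). Qed.

Lemma continuous_powR (f : R -> R) n z : continuous f z ->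
  continuous (fun y => f y ^ n) z.
Proof.
intros hf; induction n as [|n IH]; simpl.
- apply continuous_const.
- apply continuous_mulR; assumption.
Qed.

Lemma continuous_invR (f : R -> R) z : continuous f z -> f z <> 0 ->
  continuous (fun y => / f y) z.
Proof. intros hf h; exact (continuous_Rinv_comp f z hf h). Qed.

Lemma continuous_subR (f : R -> R) c z : continuous f z ->
  continuous (fun y => f y - c) z.
Proof.
intros hf; apply (continuous_minus f (fun _ => c)); [exact hf|].
apply continuous_const.
Qed.

(** * Integrals with a quadratic kernel *)

(** Negative powers and logarithms occur below, so continuity is asked only on
    the positive axis. *)
Definition contp (f : R -> R) := forall y, 0 < y -> continuous f y.

Lemma contp_ex f a b : contp f -> 0 < a -> a <= b -> ex_RInt f a b.
Proof.
intros h ha hab; apply (ex_RInt_continuous (V := R_CompleteNormedModule)).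
intros z hz; apply h; rewrite Rmin_left in hz; lra.
Qed.

Lemma contp_mul f g : contp f -> contp g -> contp (fun y => f y * g y).
Proof. intros hf hg y hy; apply continuous_mulR; auto. Qed.

Lemma contp_pow f n : contp f -> contp (fun y => f y ^ n).
Proof. intros hf y hy; apply continuous_powR; auto. Qed.

Lemma contp_inv : contp (fun y => / y).
Proof. intros y hy; apply (continuous_invR (fun y => y)); [apply continuous_id|lra]. Qed.

Lemma contp_const c : contp (fun _ => c).
Proof. intros y hy; apply continuous_const. Qed.

Lemma contp_kernel n : contp (fun y => rpos (y - n) ^ 2).
Proof.
apply contp_pow; intros y hy; apply continuous_rpos_comp.
apply continuous_subR, continuous_id.
Qed.

Lemma contp_dual x n : contp (fun y => rpos (x / y - n) ^ 2).
Proof.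
apply contp_pow; intros y hy; apply continuous_rpos_comp.
apply continuous_subR; apply continuous_mulR; [apply continuous_const|].
apply contp_inv; exact hy.
Qed.

Lemma RInt_zero f a b : a <= b -> (forall y, a <= y <= b -> f y = 0) ->
  RInt f a b = 0.
Proof.
intros hab h; rewrite (RInt_ext f (fun _ => 0)).
- rewrite RInt_const; unfold scal; simpl; unfold mult; simpl; ring.
- intros y hy; rewrite Rmin_left, Rmax_right in hy; [apply h; lra|lra|lra].
Qed.

Lemma RInt_split f a b c : contp f -> 0 < a -> a <= b -> b <= c ->
  RInt f a c = RInt f a b + RInt f b c.
Proof.
intros h ha hab hbc; symmetry; apply (RInt_Chasles f a b c);
  apply contp_ex; auto; lra.
Qed.

Lemma RInt_kernel n x w : 1 <= n -> n <= x -> contp w ->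
  RInt (fun y => rpos (y - n) ^ 2 * w y) 1 x =
  RInt (fun y => (y - n) ^ 2 * w y) n x.
Proof.
intros hn hx hw.
rewrite (RInt_split _ 1 n x); try lra.
- rewrite (RInt_zero _ 1 n); [|lra|].
  + rewrite Rplus_0_l; apply RInt_ext; intros y hy.
    rewrite Rmin_left in hy; [|lra]; rewrite rpos_pos; lra.
  + intros y hy; rewrite rpos_neg; [ring|lra].
- apply contp_mul; [apply contp_kernel|exact hw].
Qed.

Lemma RInt_kernel0 n x w : x <= n -> 1 <= x ->
  RInt (fun y => rpos (y - n) ^ 2 * w y) 1 x = 0.
Proof.
intros hn hx; apply RInt_zero; [exact hx|].
intros y hy; rewrite rpos_neg; [ring|lra].
Qed.

Lemma RInt_deriv (F f : R -> R) a b : 0 < a -> a <= b ->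
  (forall y, 0 < y -> is_derive F y (f y)) -> contp f ->
  RInt f a b = F b - F a.
Proof.
intros ha hab hF hf.
apply (is_RInt_unique (V := R_CompleteNormedModule)).
apply (is_RInt_derive (V := R_CompleteNormedModule)).
- intros y hy; apply hF; rewrite Rmin_left in hy; lra.
- intros y hy; apply hf; rewrite Rmin_left in hy; lra.
Qed.

(** Weighting the quadratic kernel by y^-4 gives a cubic Riesz mean. *)
Lemma RInt_kernel_cubic n x : 1 <= n -> 1 <= x ->
  RInt (fun y => rpos (y - n) ^ 2 * (/ y) ^ 4) 1 x =
  rpos (1 - n / x) ^ 3 / (3 * n).
Proof.
intros hn hx; destruct (Rle_dec x n) as [h|h].
- rewrite RInt_kernel0; [|exact h|exact hx].
  rewrite rpos_neg; [eqR; unfold Rdiv; ring|].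
  apply Rmult_le_reg_r with x; [lra|]; field_simplify; lra.
- rewrite RInt_kernel; [|exact hn|lra|apply contp_pow, contp_inv].
  rewrite (RInt_deriv (fun y => (1 - n / y) ^ 3 / (3 * n))); try lra.
  + rewrite rpos_pos; [eqR; field; lra|].
    apply Rmult_le_reg_r with x; [lra|]; field_simplify; lra.
  + intros y hy; auto_derive; [lra|field; lra].
  + apply contp_mul; [|apply contp_pow, contp_inv].
    apply contp_pow; intros y hy; apply continuous_subR, continuous_id.
Qed.

(** Minus half the third derivative of (ln y / y) (1 - y / x)^3. *)
Definition log_weight x y :=
  3 * ln y * (/ y) ^ 4 - 11 / 2 * (/ y) ^ 4 + 3 / x * (/ y) ^ 3 +
  3 / (2 * x ^ 2) * (/ y) ^ 2 + / x ^ 3 * / y.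

Lemma contp_ln : contp ln.
Proof. intros y hy; apply (ex_derive_continuous ln); exists (/ y). apply is_derive_ln; exact hy. Qed.

Lemma contp_add f g : contp f -> contp g -> contp (fun y => f y + g y).
Proof. intros hf hg y hy; apply (continuous_plus f g); auto. Qed.

Lemma contp_log_weight x : contp (log_weight x).
Proof.
assert (hi : forall n, contp (fun y => (/ y) ^ n)).
{ intros n; apply contp_pow, contp_inv. }
unfold log_weight, Rminus; repeat apply contp_add.
- apply contp_mul; [apply contp_mul; [apply contp_const|apply contp_ln]|auto].
- intros y hy; apply (continuous_opp (fun y => 11 / 2 * (/ y) ^ 4)).
  apply continuous_mulR; [apply continuous_const|apply hi; exact hy].
- apply contp_mul; [apply contp_const|auto].
- apply contp_mul; [apply contp_const|auto].
- apply contp_mul; [apply contp_const|apply contp_inv].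
Qed.

Lemma RInt_kernel_log n x : 1 <= n -> 1 <= x ->
  RInt (fun y => rpos (y - n) ^ 2 * log_weight x y) 1 x =
  ln n / n * rpos (1 - n / x) ^ 3.
Proof.
intros hn hx; destruct (Rle_dec x n) as [h|h].
- rewrite RInt_kernel0; [|exact h|exact hx].
  rewrite rpos_neg; [eqR; ring|].
  apply Rmult_le_reg_r with x; [lra|]; field_simplify; lra.
- rewrite RInt_kernel; [|exact hn|lra|apply contp_log_weight].
  (* repeated integration by parts, g = ln y * p *)
  pose (p := fun y => / y - 3 / x + 3 * y / x ^ 2 - y ^ 2 / x ^ 3).
  pose (p' := fun y => - (/ y) ^ 2 + 3 / x ^ 2 - 2 * y / x ^ 3).
  pose (p'' := fun y => 2 * (/ y) ^ 3 - 2 / x ^ 3).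
  rewrite (RInt_deriv (fun y => - / 2 * (y - n) ^ 2 *
     (- p y * (/ y) ^ 2 + 2 * p' y * / y + ln y * p'' y) +
     (y - n) * (p y * / y + ln y * p' y) - ln y * p y)); try lra.
  + rewrite rpos_pos.
    * unfold p, p', p''; eqR; field; lra.
    * apply Rmult_le_reg_r with x; [lra|]; field_simplify; lra.
  + intros y hy; unfold p, p', p'', log_weight; auto_derive.
    * repeat split; lra.
    * field; lra.
  + apply contp_mul; [|apply contp_log_weight].
    apply contp_pow; intros y hy; apply continuous_subR, continuous_id.
Qed.

Lemma log_weight_bound x y : 1 <= y <= x ->
  Rabs (log_weight x y) <= (3 * ln y + 11) * (/ y) ^ 4.
Proof.
intros [h1 h2]; unfold log_weight.
assert (hl : 0 <= ln y) by (rewrite <- ln_1; apply ln_le; lra).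
assert (hx : 0 < / x) by (apply Rinv_0_lt_compat; lra).
assert (hxy : / x <= / y) by (apply Rinv_le_contravar; lra).
unfold Rdiv; rewrite Rinv_mult, !pow_inv, <- !pow_inv.
set (a := / x) in *; set (b := / y) in *.
assert (ab1 : 0 <= 3 * a * b ^ 3 <= 3 * b ^ 4).
{ split; [|replace (b ^ 4) with (b * b ^ 3) by ring].
  - apply Rmult_le_pos; [lra|apply pow_le; lra].
  - assert (0 <= b ^ 3) by (apply pow_le; lra). nra. }
assert (a2 : 0 <= a ^ 2 <= b ^ 2) by (split; [apply pow_le; lra|apply pow_incr; lra]).
assert (a3 : 0 <= a ^ 3 <= b ^ 3) by (split; [apply pow_le; lra|apply pow_incr; lra]).
assert (ab2 : 0 <= a ^ 2 * b ^ 2 <= b ^ 4).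
{ replace (b ^ 4) with (b ^ 2 * b ^ 2) by ring; nra. }
assert (ab3 : 0 <= a ^ 3 * b <= b ^ 4).
{ replace (b ^ 4) with (b ^ 3 * b) by ring; nra. }
assert (b4 : 0 <= b ^ 4) by (apply pow_le; lra).
assert (lb : 0 <= ln y * b ^ 4) by (apply Rmult_le_pos; lra).
apply Rabs_le; split; nra.
Qed.

(** * Elementary integrals *)

Lemma RInt_inv_sq a b : 0 < a -> a <= b ->
  RInt (fun y => (/ y) ^ 2) a b = / a - / b.
Proof.
intros ha hab; rewrite (RInt_deriv (fun y => - / y)); try lra.
- intros y hy; auto_derive; [lra|field; lra].
- apply contp_pow, contp_inv.
Qed.

Lemma RInt_inv a b : 0 < a -> a <= b -> RInt (fun y => / y) a b = ln b - ln a.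
Proof.
intros ha hab; rewrite (RInt_deriv ln); try lra.
- intros y hy; apply is_derive_ln; exact hy.
- apply contp_inv.
Qed.

Lemma RInt_log_inv_sq x : 1 <= x ->
  RInt (fun y => (3 * ln y + 11) * (/ y) ^ 2) 1 x <= 14.
Proof.
intros hx; rewrite (RInt_deriv (fun y => - (3 * ln y + 14) * / y)); try lra.
- rewrite ln_1; assert (0 <= (3 * ln x + 14) * / x); [|lra].
  apply Rmult_le_pos; [|left; apply Rinv_0_lt_compat; lra].
  assert (0 <= ln x) by (rewrite <- ln_1; apply ln_le; lra); lra.
- intros y hy; auto_derive; [lra|field; lra].
- apply contp_mul; [|apply contp_pow, contp_inv].
  apply contp_add; [apply contp_mul; [apply contp_const|apply contp_ln]|].
  apply contp_const.
Qed.

Lemma RInt_abs_le f g a b : contp f -> contp g -> 0 < a -> a <= b ->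
  (forall y, a <= y <= b -> Rabs (f y) <= g y) -> Rabs (RInt f a b) <= RInt g a b.
Proof.
intros hf hg ha hab h; apply Rabs_le; split.
- assert (E : - RInt g a b = RInt (fun y => - g y) a b).
  { symmetry; apply (RInt_opp (V := R_CompleteNormedModule)), contp_ex; auto. }
  rewrite E; apply RInt_le; auto.
  + apply contp_ex; auto; intros y hy; apply (continuous_opp g); auto.
  + apply contp_ex; auto.
  + intros y hy; assert (H := h y); assert (H2 := Rle_abs (- f y)).
    rewrite Rabs_Ropp in H2; lra.
- apply RInt_le; auto; try (apply contp_ex; auto).
  intros y hy; assert (H := h y); assert (H2 := Rle_abs (f y)); lra.
Qed.

(** * The multiplicative convolution of two quadratic kernels *)

Definition conv_kernel x m n :=
  RInt (fun y => rpos (y - m) ^ 2 * rpos (x / y - n) ^ 2 * / y) 1 x.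

Lemma contp_conv x m n :
  contp (fun y => rpos (y - m) ^ 2 * rpos (x / y - n) ^ 2 * / y).
Proof.
apply contp_mul; [apply contp_mul|].
- apply contp_kernel.
- apply contp_dual.
- apply contp_inv.
Qed.

(** The measure dy / y is invariant under dilation, so the convolution only
    depends on the product of m and n. *)
Lemma conv_kernel_mul x m n : 1 <= x -> 1 <= m -> 1 <= n ->
  conv_kernel x m n = conv_kernel x (m * n) 1.
Proof.
intros hx hm hn; unfold conv_kernel.
set (h := fun y => rpos (y - m * n) ^ 2 * rpos (x / y - 1) ^ 2 * / y).
set (g := fun y => rpos (y - m) ^ 2 * rpos (x / y - n) ^ 2 * / y).
assert (hc : contp h) by apply contp_conv.
assert (gc : contp g) by apply contp_conv.
assert (nx : x <= n * x) by nra.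
assert (mn : n <= m * n) by nra.
assert (E1 : RInt h 1 (n * x) = RInt h 1 x).
{ rewrite (RInt_split h 1 x (n * x)); try lra; [|exact hc].
  rewrite (RInt_zero h x (n * x)); [eqR; ring|lra|].
  intros y hy; unfold h; rewrite (rpos_neg (x / y - 1)); [eqR; ring|].
  apply Rmult_le_reg_r with y; [lra|]; field_simplify; lra. }
assert (E2 : RInt h 1 (n * x) = RInt h n (n * x)).
{ rewrite (RInt_split h 1 n (n * x)); try nra; [|exact hc].
  rewrite (RInt_zero h 1 n); [eqR; ring|lra|].
  intros y hy; unfold h; rewrite (rpos_neg (y - m * n)); [eqR; ring|lra]. }
rewrite <- E1, E2.
assert (E3 := RInt_comp_lin (V := R_CompleteNormedModule) h n 0 1 x).
rewrite !Rplus_0_r, Rmult_1_r in E3; rewrite <- E3.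
- apply RInt_ext; intros y hy; rewrite Rmin_left in hy; [|lra].
  unfold scal; simpl; unfold mult; simpl; unfold h, g.
  rewrite Rplus_0_r.
  replace (n * y - m * n) with (n * (y - m)) by ring.
  replace (x / y - n) with (n * (x / (n * y) - 1)) by (field; lra).
  rewrite !rpos_scale; try lra; field; lra.
- apply contp_ex; auto; nra.
Qed.

Lemma conv_kernel_ge0 x m n : 1 <= x -> 0 <= conv_kernel x m n.
Proof.
intros hx; unfold conv_kernel; apply RInt_ge_0; [exact hx| |].
- apply contp_ex; [apply contp_conv|lra|exact hx].
- intros y hy; apply Rmult_le_pos; [apply Rmult_le_pos; apply pow2_ge_0|].
  left; apply Rinv_0_lt_compat; lra.
Qed.

Lemma conv_kernel_eq0 x m n : 1 <= x -> x <= m -> conv_kernel x m n = 0.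
Proof.
intros hx hm; unfold conv_kernel; apply RInt_zero; [exact hx|].
intros y hy; rewrite (rpos_neg (y - m)); [eqR; ring|lra].
Qed.

(** On [2 j, 4 j] the two factors are at least j^2 and (x / 8 j)^2. *)
Lemma conv_kernel_ge x j : 1 <= j -> 8 * j <= x ->
  x ^ 2 / 128 <= conv_kernel x j 1.
Proof.
intros hj hx; unfold conv_kernel.
set (h := fun y => rpos (y - j) ^ 2 * rpos (x / y - 1) ^ 2 * / y).
assert (hc : contp h) by apply contp_conv.
assert (h0 : forall a b, 1 <= a -> a <= b -> 0 <= RInt h a b).
{ intros a b ha hab; apply RInt_ge_0; [exact hab| |].
  - apply contp_ex; auto; lra.
  - intros y hy; apply Rmult_le_pos; [apply Rmult_le_pos; apply pow2_ge_0|].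
    left; apply Rinv_0_lt_compat; lra. }
rewrite (RInt_split h 1 (2 * j) x); try lra; [|exact hc].
rewrite (RInt_split h (2 * j) (4 * j) x); try lra; [|exact hc].
assert (H1 := h0 1 (2 * j)); assert (H2 := h0 (4 * j) x).
assert (H : RInt (fun _ => x ^ 2 / (256 * j)) (2 * j) (4 * j) <=
            RInt h (2 * j) (4 * j)).
{ apply RInt_le; try lra.
  - apply contp_ex; [apply contp_const|lra|lra].
  - apply contp_ex; auto; lra.
  - intros y hy; unfold h.
    assert (a1 : j <= rpos (y - j)) by (rewrite rpos_pos; lra).
    assert (a2 : x / (8 * j) <= rpos (x / y - 1)).
    { apply Rle_trans with (x / y - 1); [|apply Rmax_r].
      apply Rle_trans with (x / (4 * j) - 1).
      - apply Rmult_le_reg_r with (8 * j); [lra|]; field_simplify; lra.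
      - assert (/ (4 * j) <= / y) by (apply Rinv_le_contravar; lra).
        unfold Rdiv; nra. }
    assert (a3 : / (4 * j) <= / y) by (apply Rinv_le_contravar; lra).
    assert (b1 : j ^ 2 <= rpos (y - j) ^ 2) by (apply pow_incr; lra).
    assert (x8 : 0 <= x / (8 * j)).
    { apply Rmult_le_pos; [lra|left; apply Rinv_0_lt_compat; lra]. }
    assert (b2 : (x / (8 * j)) ^ 2 <= rpos (x / y - 1) ^ 2) by (apply pow_incr; lra).
    assert (i4 : 0 < / (4 * j)) by (apply Rinv_0_lt_compat; lra).
    replace (x ^ 2 / (256 * j)) with (j ^ 2 * (x / (8 * j)) ^ 2 * / (4 * j))
      by (field; lra).
    apply Rmult_le_compat; try lra.
    + apply Rmult_le_pos; apply pow2_ge_0.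
    + apply Rmult_le_compat; try assumption; apply pow2_ge_0. }
rewrite RInt_const in H; unfold scal in H; simpl in H; unfold mult in H.
simpl in H.
replace ((4 * j - 2 * j) * (x * (x * 1) / (256 * j))) with (x ^ 2 / 128) in H
  by (field; lra).
assert (1 <= 2 * j) by lra; assert (2 * j <= 4 * j) by lra.
assert (1 <= 4 * j) by lra; assert (4 * j <= x) by lra.
specialize (H1 ltac:(lra) ltac:(lra)); specialize (H2 ltac:(lra) ltac:(lra)).
lra.
Qed.

(** * The kernels of the smoothed sums *)

Definition kern (n y : R) := rpos (y - n) ^ 2.
Definition cub (n x : R) := rpos (1 - n / x) ^ 3.
Definition inv1 (y : R) := / y.
Definition inv2 (y : R) := (/ y) ^ 2.
Definition inv4 (y : R) := (/ y) ^ 4.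

Lemma RInt_kern_inv4 n x : 1 <= n -> 1 <= x ->
  RInt (fun y => kern n y * inv4 y) 1 x = cub n x / (3 * n).
Proof. exact (RInt_kernel_cubic n x). Qed.

Lemma RInt_kern_log n x : 1 <= n -> 1 <= x ->
  RInt (fun y => kern n y * log_weight x y) 1 x = ln n / n * cub n x.
Proof. exact (RInt_kernel_log n x). Qed.

Lemma contp_kern n : contp (kern n).
Proof. exact (contp_kernel n). Qed.

Lemma contp_kern_dual x n : contp (fun y => kern n (x / y)).
Proof. exact (contp_dual x n). Qed.

Lemma contp_inv1 : contp inv1.
Proof. exact contp_inv. Qed.

Lemma contp_inv2 : contp inv2.
Proof. exact (contp_pow _ 2 contp_inv). Qed.

Lemma contp_inv4 : contp inv4.
Proof. exact (contp_pow _ 4 contp_inv). Qed.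

Lemma log_weight_bound_sq C x y : 0 <= C -> 1 <= y <= x ->
  Rabs (C * y ^ 2 * log_weight x y) <= C * ((3 * ln y + 11) * inv2 y).
Proof.
intros hC h; rewrite !Rabs_mult, (Rabs_pos_eq C), (Rabs_pos_eq (y ^ 2)); auto;
  [|apply pow2_ge_0].
assert (H := log_weight_bound x y h).
replace (C * ((3 * ln y + 11) * inv2 y)) with
  (C * y ^ 2 * ((3 * ln y + 11) * (/ y) ^ 4)) by (unfold inv2; field; lra).
apply Rmult_le_compat_l; [|exact H].
apply Rmult_le_pos; [exact hC|apply pow2_ge_0].
Qed.

(** * The midpoint rule for radial profiles *)

Definition contR (f : R -> R) := forall x, continuous f x.

Lemma contR_ex f a b : contR f -> ex_RInt f a b.
Proof. intros cf; apply (@ex_RInt_continuous R_CompleteNormedModule); auto. Qed.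

(** The linear Taylor term integrates to zero over a symmetric cell. *)
Lemma midpoint_cell (phi : R -> R) (u h d K : R) : contR phi -> 0 <= h ->
  (forall s, -h <= s <= h -> Rabs (phi (u + s) - phi u - d * s) <= K * s ^ 2) ->
  0 <= K ->
  Rabs (RInt phi (u - h) (u + h) - 2 * h * phi u) <= 2 * K * h ^ 3.
Proof.
intros cphi h0 hK K0.
assert (cl : contR (fun t => phi u + d * (t - u))).
{ intros t; apply (@ex_derive_continuous R_AbsRing R_NormedModule); auto_derive; auto. }
assert (il : RInt (fun t => phi u + d * (t - u)) (u - h) (u + h) = 2 * h * phi u).
{ apply is_RInt_unique.
  replace (2 * h * phi u) with
    (minus ((phi u * (u + h) + d * (u + h - u) ^ 2 / 2)) (phi u * (u - h) + d * (u - h - u) ^ 2 / 2)).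
  - apply (is_RInt_derive (fun t => phi u * t + d * (t - u) ^ 2 / 2)).
    + intros t _; auto_derive; auto; field.
    + intros t _; apply cl.
  - unfold minus, plus, opp; simpl; field. }
rewrite <- il.
assert (E : RInt (fun t => minus (phi t) (phi u + d * (t - u))) (u - h) (u + h) =
  RInt phi (u - h) (u + h) - RInt (fun t => phi u + d * (t - u)) (u - h) (u + h)).
{ exact (@RInt_minus R_CompleteNormedModule _ _ _ _ (contR_ex _ _ _ cphi) (contR_ex _ _ _ cl)). }
rewrite <- E.
replace (2 * K * h ^ 3) with ((u + h - (u - h)) * (K * h ^ 2)) by ring.
apply abs_RInt_le_const; [lra| |].
- apply (@ex_RInt_minus R_NormedModule); now apply contR_ex.
- intros t ht.
  assert (hs : -h <= t - u <= h) by lra.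
  specialize (hK _ hs); replace (u + (t - u)) with t in hK by ring.
  replace (minus (phi t) (phi u + d * (t - u))) with (phi t - phi u - d * (t - u)).
  2:{ unfold minus, plus, opp; simpl; ring. }
  apply Rle_trans with (1 := hK).
  apply Rmult_le_compat_l; [exact K0|nra].
Qed.

Lemma RInt_join f a b c : contR f -> RInt f a b + RInt f b c = RInt f a c.
Proof.
intros cf; exact (@RInt_Chasles R_CompleteNormedModule f a b c (contR_ex _ _ _ cf) (contR_ex _ _ _ cf)).
Qed.

(** Functions of z = q^2 - delta t^2 for which the midpoint rule in t has a good
    error. H is homogeneous of degree m + 4 in the square root of z; the offset
    keeps the exponents of q in the bounds of the two derivatives natural
    numbers. *)
Record profile (H H' : R -> R) (m : nat) (A B : R) : Prop := Profile {
  profile_cont : contR H;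
  profile_supp : forall z, z <= 0 -> H z = 0;
  profile_pos : forall z, 0 < z -> 0 < H z;
  profile_hom : forall l z, 0 < l -> H (l ^ 2 * z) = l ^ (m + 4) * H z;
  profile_A : 0 <= A;
  profile_B : 0 <= B;
  profile_taylor : forall q z z', 0 <= q -> z <= q ^ 2 -> z' <= q ^ 2 ->
    Rabs (H z' - H z - H' z * (z' - z)) <= A * q ^ m * (z' - z) ^ 2;
  profile_slope : forall q z, 0 <= q -> z <= q ^ 2 -> Rabs (H' z) <= B * q ^ (m + 2)
}.

Definition mass (H : R -> R) := RInt (fun x => H (1 - x ^ 2)) (-1) 1.

Section Profile.
Variables (H H' : R -> R) (m : nat) (A B : R).
Hypothesis PH : profile H H' m A B.

Lemma contR_profile S delta : contR (fun t => H (S - delta * t ^ 2)).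
Proof.
intros t; apply (continuous_comp (fun t => S - delta * t ^ 2) H).
- apply (@ex_derive_continuous R_AbsRing R_NormedModule); auto_derive; auto.
- apply (profile_cont _ _ _ _ _ PH).
Qed.

Lemma mass_pos : 0 < mass H.
Proof.
apply RInt_gt_0; [lra| |].
- intros x hx; apply (profile_pos _ _ _ _ _ PH); nra.
- intros x _; apply (continuous_ext (fun t => H (1 - 1 * t ^ 2))).
  + intros t; f_equal; ring.
  + apply contR_profile.
Qed.

Lemma RInt_null f a b : (forall x, Rmin a b < x < Rmax a b -> f x = 0) -> RInt f a b = 0.
Proof.
intros h; rewrite (RInt_ext f (fun _ => 0)); [|exact h].
rewrite RInt_const; unfold scal; simpl; unfold mult; simpl; ring.
Qed.

(** The substitution t = (q / sqrt delta) x reduces to q = delta = 1. *)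
Lemma profile_integral (q delta U V : R) : 0 <= q -> 0 < delta ->
  q <= sqrt delta * V -> sqrt delta * U <= - q ->
  RInt (fun t => H (q ^ 2 - delta * t ^ 2)) U V = mass H * q ^ (m + 5) / sqrt delta.
Proof.
intros q0 d0 hV hU; set (r := sqrt delta) in *.
assert (r0 : 0 < r) by (apply sqrt_lt_R0; exact d0).
assert (rr : delta = r ^ 2) by (unfold r; rewrite pow2_sqrt; lra).
destruct (Req_dec q 0) as [qz|qn].
{ rewrite RInt_null.
  2:{ intros x _; apply (profile_supp _ _ _ _ _ PH); rewrite qz; nra. }
  rewrite qz, pow_i by lia; eqR; unfold Rdiv; ring. }
assert (qp : 0 < q) by lra.
assert (cg : contR (fun x => H (1 - x ^ 2))).
{ intros x; apply (continuous_ext (fun t => H (1 - 1 * t ^ 2))).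
  - intros t; f_equal; ring.
  - apply contR_profile. }
transitivity (RInt (fun t => (q ^ (m + 5) / r) * (r / q * H (1 - (r / q * t + 0) ^ 2))) U V).
{ apply RInt_ext; intros t _; rewrite rr.
  replace (q ^ 2 - r ^ 2 * t ^ 2) with (q ^ 2 * (1 - (r / q * t + 0) ^ 2)) by (field; lra).
  rewrite (profile_hom _ _ _ _ _ PH) by exact qp.
  replace (m + 5)%nat with (S (m + 4)) by lia; simpl (q ^ S _).
  eqR; field; lra. }
assert (cl : contR (fun t => r / q * H (1 - (r / q * t + 0) ^ 2))).
{ intros t; apply continuous_mulR; [apply continuous_const|].
  apply (continuous_comp (fun t => r / q * t + 0) (fun x => H (1 - x ^ 2))).
  - apply (@ex_derive_continuous R_AbsRing R_NormedModule); auto_derive; auto.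
  - apply cg. }
transitivity (q ^ (m + 5) / r * RInt (fun t => r / q * H (1 - (r / q * t + 0) ^ 2)) U V).
{ exact (@RInt_scal R_CompleteNormedModule _ _ _ _ (contR_ex _ U V cl)). }
assert (E : RInt (fun t => r / q * H (1 - (r / q * t + 0) ^ 2)) U V =
   RInt (fun x => H (1 - x ^ 2)) (r / q * U + 0) (r / q * V + 0)).
{ exact (@RInt_comp_lin R_CompleteNormedModule (fun x => H (1 - x ^ 2)) (r / q) 0 U V (contR_ex _ _ _ cg)). }
rewrite E.
assert (u1 : r / q * U + 0 <= -1).
{ replace (r / q * U + 0) with (r * U / q) by (field; lra).
  apply Rmult_le_reg_r with q; [lra|]; replace (r * U / q * q) with (r * U) by (field; lra); lra. }
assert (v1 : 1 <= r / q * V + 0).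
{ replace (r / q * V + 0) with (r * V / q) by (field; lra).
  apply Rmult_le_reg_r with q; [lra|]; replace (r * V / q * q) with (r * V) by (field; lra); lra. }
revert u1 v1; generalize (r / q * U + 0) (r / q * V + 0); intros u v u1 v1.
rewrite <- (RInt_join _ u (-1) v cg), <- (RInt_join _ (-1) 1 v cg).
rewrite (RInt_null _ u), (RInt_null _ 1); unfold mass.
- eqR; field; lra.
- intros x; rewrite Rmin_left, Rmax_right by lra; intros hx.
  apply (profile_supp _ _ _ _ _ PH); nra.
- intros x; rewrite Rmin_left, Rmax_right by lra; intros hx.
  apply (profile_supp _ _ _ _ _ PH); nra.
Qed.

(** With z = q^2 - delta t^2, the Taylor bound for H in z turns into one in t. *)
Lemma profile_cell (q delta u h U : R) : 0 <= q -> 0 <= delta -> 0 <= h ->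
  Rabs u <= U ->
  Rabs (RInt (fun t => H (q ^ 2 - delta * t ^ 2)) (u - h) (u + h) -
    2 * h * H (q ^ 2 - delta * u ^ 2)) <=
  2 * (B * q ^ (m + 2) * delta + A * q ^ m * delta ^ 2 * (2 * U + h) ^ 2) * h ^ 3.
Proof.
intros q0 d0 h0 uU.
assert (A0 := profile_A _ _ _ _ _ PH); assert (B0 := profile_B _ _ _ _ _ PH).
assert (qm := pow_le q m q0); assert (qm2 := pow_le q (m + 2) q0).
assert (Aq : 0 <= A * q ^ m) by nra.
assert (Bq : 0 <= B * q ^ (m + 2)) by nra.
apply (midpoint_cell (fun t => H (q ^ 2 - delta * t ^ 2)) u h
  (- (2 * delta * u * H' (q ^ 2 - delta * u ^ 2)))).
- apply contR_profile.
- exact h0.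
- intros s hs; set (z := q ^ 2 - delta * u ^ 2).
  set (z' := q ^ 2 - delta * (u + s) ^ 2).
  assert (zq : z <= q ^ 2) by (assert (p := Rmult_le_pos _ _ d0 (pow2_ge_0 u)); unfold z; lra).
  assert (zq' : z' <= q ^ 2)
    by (assert (p := Rmult_le_pos _ _ d0 (pow2_ge_0 (u + s))); unfold z'; lra).
  assert (T := profile_taylor _ _ _ _ _ PH q z z' q0 zq zq').
  assert (T' := profile_slope _ _ _ _ _ PH q z q0 zq).
  replace (H z' - H z - - (2 * delta * u * H' z) * s) with
    ((H z' - H z - H' z * (z' - z)) + H' z * (- delta * s ^ 2)).
  2:{ unfold z, z'; ring. }
  apply Rle_trans with (1 := Rabs_triang _ _).
  rewrite Rabs_mult.
  assert (a2 : Rabs (- delta * s ^ 2) = delta * s ^ 2).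
  { replace (- delta * s ^ 2) with (- (delta * s ^ 2)) by ring.
    rewrite Rabs_Ropp, Rabs_pos_eq; [reflexivity|nra]. }
  rewrite a2.
  assert (w : (z' - z) ^ 2 <= delta ^ 2 * (2 * U + h) ^ 2 * s ^ 2).
  { replace (z' - z) with (- (delta * (2 * u + s)) * s) by (unfold z, z'; ring).
    assert (hu : -U <= u <= U) by (revert uU; unfold Rabs; destruct (Rcase_abs u); lra).
    assert (sq : (2 * u + s) ^ 2 <= (2 * U + h) ^ 2) by nra.
    replace ((- (delta * (2 * u + s)) * s) ^ 2) with ((delta ^ 2 * s ^ 2) * (2 * u + s) ^ 2) by ring.
    replace (delta ^ 2 * (2 * U + h) ^ 2 * s ^ 2) with ((delta ^ 2 * s ^ 2) * (2 * U + h) ^ 2) by ring.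
    apply Rmult_le_compat_l; [nra|exact sq]. }
  assert (w1 := Rmult_le_compat_l _ _ _ Aq w).
  assert (w2 : Rabs (H' z) * (delta * s ^ 2) <= B * q ^ (m + 2) * (delta * s ^ 2)).
  { apply Rmult_le_compat_r; [nra|exact T']. }
  lra.
- assert (0 <= B * q ^ (m + 2) * delta) by (apply Rmult_le_pos; assumption).
  assert (0 <= A * q ^ m * delta ^ 2 * (2 * U + h) ^ 2).
  { apply Rmult_le_pos; [apply Rmult_le_pos; [assumption|]|]; apply pow2_ge_0. }
  lra.
Qed.
End Profile.

Definition sqr_pos (z : R) := rpos z ^ 2.

(** Up to a constant, the integral of sqr_pos (z - t^2) over t: a plane sum of
    squares becomes a sum of fifth powers of roots on the lines. *)
Definition root5_pos (z : R) := sqrt (rpos z) ^ 5.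

Lemma profile_sqr : profile sqr_pos (fun z => 2 * rpos z) 0 1 2.
Proof.
unfold sqr_pos; split.
- intros x; apply continuous_powR; apply continuous_rpos.
- intros z hz; rewrite rpos_neg by exact hz; ring.
- intros z hz; rewrite rpos_pos by lra; nra.
- intros l z hl; rewrite rpos_scale by nra; simpl; ring.
- lra.
- lra.
- intros q z z' _ _ _; simpl (q ^ 0); rewrite Rmult_1_r, Rmult_1_l.
  assert (h := pow2_ge_0 (z' - z)).
  destruct (Rle_dec 0 z') as [a|a], (Rle_dec 0 z) as [b|b].
  + rewrite !rpos_pos by assumption.
    replace (z' ^ 2 - z ^ 2 - 2 * z * (z' - z)) with ((z' - z) ^ 2) by ring.
    rewrite Rabs_pos_eq; lra.
  + rewrite (rpos_pos z' a), (rpos_neg z) by lra.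
    assert (0 <= z' * - z) by (apply Rmult_le_pos; lra).
    rewrite Rabs_pos_eq; nra.
  + rewrite (rpos_neg z'), (rpos_pos z b) by lra.
    assert (0 <= - z' * z) by (apply Rmult_le_pos; lra).
    rewrite Rabs_pos_eq; nra.
  + rewrite !rpos_neg by lra.
    replace (0 ^ 2 - 0 ^ 2 - 2 * 0 * (z' - z)) with 0 by ring.
    rewrite Rabs_R0; exact h.
- intros q z q0 hz; simpl (0 + 2)%nat.
  assert (0 <= rpos z <= q ^ 2).
  { split; [apply rpos_ge0|]; apply Rmax_lub; [nra|exact hz]. }
  rewrite Rabs_pos_eq; nra.
Qed.

Lemma profile_root5 : profile root5_pos (fun z => 5 / 2 * sqrt (rpos z) ^ 3) 1 6 (5 / 2).
Proof.
unfold root5_pos; split.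
- intros x; apply continuous_powR; apply (continuous_comp rpos sqrt).
  + apply continuous_rpos.
  + apply continuous_sqrt.
- intros z hz; rewrite rpos_neg, sqrt_0 by exact hz; ring.
- intros z hz; rewrite rpos_pos by lra; apply pow_lt, sqrt_lt_R0; exact hz.
- intros l z hl; rewrite rpos_scale by nra; rewrite sqrt_mult by (try apply rpos_ge0; nra).
  rewrite sqrt_pow2 by lra; simpl; ring.
- lra.
- lra.
- intros q z z' q0 hz hz'; rewrite pow_1.
  assert (root : forall y, y <= q ^ 2 -> exists p, 0 <= p <= q /\ sqrt (rpos y) = p /\
     ((0 <= y /\ y = p ^ 2) \/ (y <= 0 /\ p = 0))).
  { intros y hy; exists (sqrt (rpos y)); split; [split|split]; auto.
    - apply sqrt_pos.
    - rewrite <- (sqrt_pow2 q q0); apply sqrt_le_1_alt; apply Rmax_lub; [nra|exact hy].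
    - destruct (Rle_dec 0 y) as [h|h].
      + left; split; auto; rewrite pow2_sqrt, rpos_pos; auto; apply rpos_ge0.
      + right; split; [lra|]; rewrite rpos_neg, sqrt_0; lra. }
  destruct (root z hz) as [p [p0 [-> hp]]]; destruct (root z' hz') as [p' [p0' [-> hp']]].
  destruct hp as [[z0 ->]|[z0 ->]]; destruct hp' as [[z0' ->]|[z0' ->]].
  + assert (E : p' ^ 5 - p ^ 5 - 5 / 2 * p ^ 3 * (p' ^ 2 - p ^ 2) =
      (p' - p) ^ 2 * (p' ^ 3 + 2 * p' ^ 2 * p + 3 * p' * p ^ 2 + 3 / 2 * p ^ 3)) by field.
    assert (pp : 0 <= p' ^ 3 + 2 * p' ^ 2 * p + 3 * p' * p ^ 2 + 3 / 2 * p ^ 3).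
    { assert (0 <= p ^ 3) by (apply pow_le; lra). assert (0 <= p' ^ 3) by (apply pow_le; lra).
      assert (0 <= p' ^ 2 * p) by (apply Rmult_le_pos; [apply pow2_ge_0|lra]).
      assert (0 <= p' * p ^ 2) by (apply Rmult_le_pos; [lra|apply pow2_ge_0]). lra. }
    assert (pq : p' ^ 3 + 2 * p' ^ 2 * p + 3 * p' * p ^ 2 + 3 / 2 * p ^ 3 <= 6 * q * (p' + p) ^ 2).
    { apply Rle_trans with (3 * (p + p') * (p' + p) ^ 2).
      - assert (0 <= p ^ 3) by (apply pow_le; lra). assert (0 <= p' ^ 3) by (apply pow_le; lra).
        assert (0 <= p' ^ 2 * p) by (apply Rmult_le_pos; [apply pow2_ge_0|lra]).
        assert (0 <= p' * p ^ 2) by (apply Rmult_le_pos; [lra|apply pow2_ge_0]). nra.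
      - apply Rmult_le_compat_r; [apply pow2_ge_0|lra]. }
    rewrite E, Rabs_pos_eq.
    2:{ apply Rmult_le_pos; [apply pow2_ge_0|exact pp]. }
    apply Rle_trans with ((p' - p) ^ 2 * (6 * q * (p' + p) ^ 2)).
    * apply Rmult_le_compat_l; [apply pow2_ge_0|exact pq].
    * right; ring.
  + assert (w : p ^ 2 <= p ^ 2 - z') by lra.
    assert (w0 : 0 <= p ^ 2) by apply pow2_ge_0.
    replace (0 ^ 5 - p ^ 5 - 5 / 2 * p ^ 3 * (z' - p ^ 2)) with
      (p ^ 3 * (5 / 2 * (p ^ 2 - z') - p ^ 2)) by field.
    replace (6 * q * (z' - p ^ 2) ^ 2) with (6 * q * ((p ^ 2 - z') * (p ^ 2 - z'))) by ring.
    revert w; generalize (p ^ 2 - z'); intros y w.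
    rewrite Rabs_pos_eq.
    2:{ apply Rmult_le_pos; [apply pow_le|]; lra. }
    apply Rle_trans with (p ^ 3 * (5 / 2 * y)).
    * apply Rmult_le_compat_l; [apply pow_le|]; lra.
    * replace (p ^ 3 * (5 / 2 * y)) with (p * (5 / 2 * (p ^ 2 * y))) by ring.
      replace (6 * q * (y * y)) with (q * (6 * (y * y))) by ring.
      apply Rmult_le_compat; try lra; nra.
  + replace (p' ^ 5 - 0 ^ 5 - 5 / 2 * 0 ^ 3 * (p' ^ 2 - z)) with (p' ^ 5) by ring.
    rewrite Rabs_pos_eq by (apply pow_le; lra).
    assert (w0 : 0 <= p' ^ 2) by apply pow2_ge_0.
    replace (p' ^ 5) with (p' * (p' ^ 2 * p' ^ 2)) by ring.
    replace (6 * q * (p' ^ 2 - z) ^ 2) with (q * (6 * ((p' ^ 2 - z) * (p' ^ 2 - z)))) by ring.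
    apply Rmult_le_compat; try lra; nra.
  + replace (0 ^ 5 - 0 ^ 5 - 5 / 2 * 0 ^ 3 * (z' - z)) with 0 by ring; rewrite Rabs_R0.
    apply Rmult_le_pos; [lra|apply pow2_ge_0].
- intros q z q0 hz; simpl (1 + 2)%nat.
  assert (h : 0 <= sqrt (rpos z) <= q).
  { split; [apply sqrt_pos|]; rewrite <- (sqrt_pow2 q q0); apply sqrt_le_1_alt.
    apply Rmax_lub; [nra|exact hz]. }
  assert (h3 := pow_incr _ _ 3 h).
  rewrite Rabs_pos_eq; [lra|].
  apply Rmult_le_pos; [lra|apply pow_le; lra].
Qed.

End RealIntegrals.

From HB Require Import structures.
From mathcomp Require Import all_boot all_order all_algebra all_fingroup cyclic.
From mathcomp Require Import mxrepresentation pgroup complex.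
From mathcomp Require Import boolp Rstruct.
From mathcomp Require Import zify ring lra.
Set Implicit Arguments.
Unset Strict Implicit.
Unset Printing Implicit Defensive.
Import Order.TTheory GRing.Theory Num.Theory.
Local Open Scope ring_scope.

(** * Real characters of finite abelian groups *)

(** The regular representation is faithful and a sum of simple modules, which
    are lines; so some line is moved by a given element g != 1. *)
Lemma separating_character (F : closedFieldType) (gT : finGroupType) (g : gT) :
  [pchar F] =i pred0 -> abelian [set: gT] -> g != 1%g ->
  exists chi : gT -> F,
    [/\ forall x y, chi (x * y)%g = chi x * chi y, chi 1%g = 1 & chi g != 1].
Proof.
move=> ch0 ab g1; apply: contrapT => nochi.
have H chi : (forall x y : gT, chi (x * y)%g = chi x * chi y) ->
    chi 1%g = 1 :> F -> chi g = 1.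
  by move=> h1 h2; apply/eqP/negPn/negP => h3; apply: nochi; exists chi.
move/negP: g1; apply.
pose G := [set: gT]%G; pose aG := regular_repr F G.
have modV : mxmodule aG 1%:M by rewrite mxmodule1.
have split : group_splitting_field F G := @group_closure_closed_field F gT G.
have F'G : ([pchar F]^'.-group G)%g.
  by apply/pgroupP => q _ _; rewrite !inE; have := ch0 q; rewrite !inE => ->.
have mas := mx_Maschke_pchar aG F'G.
apply: (mx_reducible_semisimple modV mas) => -[I U W simU eqW _].
have := fintype.subsetP (regular_mx_faithful F G) g; rewrite !inE mul1mx; apply.
rewrite -subr_eq0 -[_ - _]mul1mx; apply/eqP/sub_kermxP.
rewrite -eqW; apply/sumsmx_subP => i _; apply/sub_kermxP.
have simUi := simU i; have [modU nzU _] := simUi.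
have rk1 := mxsimple_abelian_linear split ab simUi.
set v := nz_row (U i).
have vU : (v <= U i)%MS by exact: nz_row_sub.
have v0 : v != 0 by rewrite nz_row_eq0.
have Uv : (U i <= v)%MS.
  by have [_ <-] := mxrank_leqif_sup vU; rewrite rk1 rank_rV v0.
have ex x : exists a, v *m aG x = a *: v.
  apply/sub_rVP; apply: submx_trans Uv.
  apply: submx_trans (submxMr _ vU) _.
  by apply: (mxmoduleP modU); rewrite inE.
have [chi chiP] := choice ex.
have inj a b : a *: v = b *: v -> a = b.
  by move=> /eqP; rewrite -subr_eq0 -scalerBl scaler_eq0 subr_eq0 (negPf v0) orbF => /eqP.
have chig : chi g = 1.
  apply: H.
    move=> x y; apply: inj; rewrite -chiP repr_mxM ?inE // mulmxA chiP.
    by rewrite -scalemxAl chiP scalerA.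
  by apply: inj; rewrite -chiP repr_mx1 mulmx1 scale1r.
have /submxP[M ->] := Uv.
by rewrite mulmxBr mulmx1 -mulmxA chiP chig scale1r subrr.
Qed.

Section Cosine.
Variables (R : rcfType) (gT : finGroupType).
Hypothesis ab : abelian [set: gT].

(** Real parts of characters, through d'Alembert's functional equation. *)
Definition cosine (phi : gT -> R) := phi 1%g = 1 /\
  forall x y, phi (x * y)%g + phi (x * y^-1)%g = 2 * phi x * phi y.

(** Averaging over the translations by y and y^-1 multiplies the sum by phi y
    and does not change it. *)
Lemma cosine_sum phi : cosine phi ->
  (forall x, phi x = 1) \/ \sum_x phi x = 0.
Proof.
move=> [phi1 phiM].
have [all1|/existsNP[y /eqP y1]] := pselect (forall x, phi x = 1); first by left.
right; set S := \sum_x _.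
have E : S + S = 2 * phi y * S.
  have E1 : S = \sum_x phi (x * y)%g by rewrite /S (reindex_inj (mulIg y)).
  have E2 : S = \sum_x phi (x * y^-1)%g by rewrite /S (reindex_inj (mulIg y^-1%g)).
  transitivity (\sum_x phi (x * y)%g + \sum_x phi (x * y^-1)%g).
    by rewrite -E1 -E2.
  by rewrite -big_split /= mulr_sumr; apply: eq_bigr => x _; rewrite phiM; ring.
have : 2 * (1 - phi y) * S = 0 by rewrite -[RHS](subrr (2 * phi y * S)) -{1}E; ring.
move=> /eqP; rewrite !mulf_eq0 pnatr_eq0 /= subr_eq0 eq_sym (negPf y1) /=.
by move/eqP.
Qed.

(** At the maximum m of |phi|, the doubling formula gives 2 m^2 <= m + 1. *)
Lemma cosine_bound phi x : cosine phi -> `|phi x| <= 1.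
Proof.
move=> [phi1 phiM].
have [m [mx mmax]] : exists m, (exists y, `|phi y| = m) /\ forall y, `|phi y| <= m.
  exists (`|phi [arg max_(y > 1%g) `|phi y|]%O|); split; first by eexists.
  by move=> y; case: Order.TotalTheory.arg_maxP => // z _ /(_ y isT).
have [y ym] := mx.
have m0 : 0 <= m by rewrite -ym.
have : 2 * m ^+ 2 <= m + 1.
  rewrite -ym real_normK ?num_real //.
  have := phiM y y; rewrite mulgV phi1 => E.
  have -> : 2 * phi y ^+ 2 = phi (y * y)%g + 1 by rewrite E; ring.
  by rewrite lerD2r ym (le_trans (ler_norm _)).
move=> h; apply: le_trans (mmax x) _; nra.
Qed.

Definition hom (chi : gT -> R[i]) :=
  (forall x y, chi (x * y)%g = chi x * chi y) /\ chi 1%g = 1.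

(** The values are roots of unity. *)
Lemma hom_conj chi z : hom chi -> chi z^-1%g = conjc (chi z).
Proof.
move=> [chiM chi1]; have unit : chi z * (chi z)^* = 1.
  have zn : chi z ^+ #[z]%g = 1.
    have powE k : chi (z ^+ k)%g = chi z ^+ k.
      by elim: k => [|k IH]; rewrite ?expg0 ?expr0 // expgS exprS chiM IH.
    by rewrite -powE expg_order.
  have n1 : `|chi z| = 1.
    apply/eqP; rewrite -(@pexpr_eq1 _ _ #[z]%g) ?normr_ge0 ?order_gt0 //.
    by rewrite -normrX zn normr1.
  by rewrite -normCK n1 expr1n.
have c0 : chi z != 0.
  apply/eqP => c0; have := unit; rewrite c0 mul0r => /eqP.
  by rewrite eq_sym oner_eq0.
by apply: (mulfI c0); rewrite -chiM mulgV chi1 -unit.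
Qed.

Lemma hom_cosine chi : hom chi -> cosine (fun x => complex.Re (chi x)).
Proof.
move=> homchi; have [chiM chi1] := homchi; split; first by rewrite chi1.
move=> x y; rewrite !chiM (hom_conj y homchi).
by case: (chi x) => a b; case: (chi y) => c d /=; ring.
Qed.

(** Every even function is a combination of cosines.  The characters span an
    algebra which separates points, so the product over z != A of
    (chi_z - chi_z(z)) / (chi_z(A) - chi_z(z)), with chi_z separating z from
    A, expresses the indicator of A through them; then take real parts. *)
Lemma even_delta_cosines (A : gT) :
  exists s : seq (R * (gT -> R)),
    (forall t, List.In t s -> cosine t.2) /\ forall x : gT,
      (x == A)%:R + (x == A^-1%g)%:R = \sum_(t <- s) t.1 * t.2 x.
Proof.
pose span (f : gT -> R[i]) := exists s : seq (R[i] * (gT -> R[i])),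
  [/\ forall t, List.In t s -> hom t.2 & forall x, f x = \sum_(t <- s) t.1 * t.2 x].
have span1 : span (fun=> 1).
  exists [:: (1, fun=> 1)]; split; last by move=> x; rewrite big_seq1 mulr1.
  by move=> t [<-|//]; split=> [x y|//] /=; rewrite mulr1.
have spanM f c d chi : hom chi -> span f -> span (fun x => f x * (c * chi x + d)).
  move=> [hM h1] [s [sP fE]].
  exists ([seq (c * t.1, fun x => t.2 x * chi x) | t <- s] ++
          [seq (d * t.1, t.2) | t <- s]); split.
    move=> t /List.in_app_iff[] /List.in_map_iff[u [<- us]] /=; last exact: sP.
    have [uM u1] := sP _ us; split; last by rewrite u1 h1 mulr1.
    by move=> x y; rewrite uM hM; ring.
  move=> x; rewrite big_cat !big_map /= fE mulr_suml -big_split /=.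
  by apply: eq_bigr => t _; ring.
have sep z : exists chi, hom chi /\ (z != A -> chi z != chi A).
  have [zA|zA] := eqVneq z A.
    by exists (fun=> 1); split=> //; split=> // x y; rewrite mulr1.
  have zA1 : (z * A^-1)%g != 1%g by rewrite -eq_mulgV1.
  have [|chi [hM h1 hne]] := separating_character (F := R[i]) _ ab zA1.
    exact: Num.Theory.pchar_num.
  exists chi; split=> // _; apply: contra hne => /eqP E.
  by rewrite hM E -hM mulgV h1.
have [chi chiP] := choice sep.
have delta (r : seq gT) : span (fun x => \prod_(z <- r | z != A)
    ((chi z A - chi z z)^-1 * chi z x + - ((chi z A - chi z z)^-1 * chi z z))).
  elim: r => [|z r IH].
    by have [s [sP E]] := span1; exists s; split=> // x; rewrite big_nil -E.
  have [zA|zA] := eqVneq z A.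
    by have [s [sP E]] := IH; exists s; split=> // x; rewrite big_cons zA eqxx -E.
  have := spanM _ (chi z A - chi z z)^-1 (- ((chi z A - chi z z)^-1 * chi z z))
     _ (chiP z).1 IH.
  move=> [s [sP E]]; exists s; split=> // x.
  by rewrite big_cons zA mulrC -E.
have [s [sP E]] := delta (enum gT).
have dE x : (x == A)%:R = \sum_(t <- s) t.1 * t.2 x.
  rewrite -E big_enum_cond /=; have [->|xA] := eqVneq x A.
    rewrite big1 // => z zA; rewrite -mulrBr mulVf // subr_eq0 eq_sym.
    exact: (chiP z).2.
  by rewrite (bigD1 x) //= subrr mul0r.
exists [seq (2 * complex.Re t.1, fun x => complex.Re (t.2 x)) | t <- s]; split.
  move=> t /List.in_map_iff[u [<- us]] /=; exact: hom_cosine (sP _ us).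
move=> x; rewrite big_map /=.
have ReE z : (z == A)%:R = \sum_(t <- s) complex.Re (t.1 * t.2 z).
  rewrite -(raddf_sum (@complex.Re R)) -dE.
  by case: (z == A).
have -> : (x == A^-1%g) = (x^-1%g == A) by rewrite (can2_eq invgK invgK).
rewrite !ReE -big_split /=; elim: s sP {E dE ReE} => [|t s IH] sP.
  by rewrite !big_nil.
rewrite !big_cons IH => [|u us]; last by apply: sP; right.
congr (_ + _); rewrite (hom_conj x (sP t (or_introl erefl))).
by case: (t.1) => a b; case: (t.2 x) => c d /=; ring.
Qed.
End Cosine.

Local Notation R := Rdefinitions.R.

(** * Smoothed sums and their integrals *)

(** The closure properties of contp in the syntax of ring operations. *)
Lemma contp_mulr (f g : R -> R) : contp f -> contp g -> contp (fun y => f y * g y).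
Proof. exact: contp_mul. Qed.

Lemma contp_addr (f g : R -> R) : contp f -> contp g -> contp (fun y => f y + g y).
Proof. exact: contp_add. Qed.

Lemma contp_constr (c : R) : contp (fun=> c).
Proof. exact: contp_const. Qed.

Definition ksum (a : nat -> R) (N : nat) (y : R) : R :=
  \sum_(n < N) a n * kern n%:R y.

Lemma contp_ksum a N : contp (ksum a N).
Proof.
elim: N => [|N IH].
  by rewrite (_ : ksum a 0 = fun=> 0); [exact: contp_const|apply/funext => y; rewrite /ksum big_ord0].
rewrite (_ : ksum a N.+1 = fun y => ksum a N y + a N * kern N%:R y).
  apply: contp_addr => //; apply: contp_mulr; [exact: contp_const|exact: contp_kern].
by apply/funext => y; rewrite /ksum big_ord_recr.
Qed.

Lemma contp_ksum_dual a N (x : R) : contp (fun y => ksum a N (Rdiv x y)).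
Proof.
elim: N => [|N IH].
  rewrite (_ : (fun y => _) = fun=> 0); first exact: contp_const.
  by apply/funext => y; rewrite /ksum big_ord0.
rewrite (_ : (fun y => _) = fun y => ksum a N (Rdiv x y) + a N * kern N%:R (Rdiv x y)).
  apply: contp_addr => //; apply: contp_mulr; first exact: contp_const.
  exact: contp_kern_dual.
by apply/funext => y; rewrite /ksum big_ord_recr.
Qed.

Definition Int (f : R -> R) (a b : R) : R := RInt f a b.

Lemma IntD (f g : R -> R) (a b : R) : contp f -> contp g -> 0 < a -> a <= b ->
  Int (fun y => f y + g y) a b = Int f a b + Int g a b.
Proof.
move=> cf cg /RltP a0 /RleP ab; rewrite /Int.
apply: (RInt_plus (V := R_CompleteNormedModule)); exact: contp_ex.
Qed.

Lemma IntZ (c : R) (f : R -> R) (a b : R) : contp f -> 0 < a -> a <= b ->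
  Int (fun y => c * f y) a b = c * Int f a b.
Proof.
move=> cf /RltP a0 /RleP ab; rewrite /Int.
apply: (RInt_scal (V := R_CompleteNormedModule)); exact: contp_ex.
Qed.

Lemma Int_abs (f g : R -> R) (a b : R) : contp f -> contp g -> 0 < a -> a <= b ->
  (forall y, a <= y <= b -> `|f y| <= g y) -> `|Int f a b| <= Int g a b.
Proof.
move=> cf cg /RltP a0 /RleP ab h; apply/RleP; rewrite -RabsE.
apply: RInt_abs_le => // y [/RleP h1 /RleP h2].
by have := h y; rewrite h1 h2 => /(_ isT) /RleP; rewrite -RabsE.
Qed.

Lemma Int_split (f : R -> R) (a b c : R) : contp f -> 0 < a -> a <= b -> b <= c ->
  Int f a c = Int f a b + Int f b c.
Proof. by move=> cf /RltP a0 /RleP ab /RleP bc; exact: RInt_split. Qed.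

Lemma eq_Int (f g : R -> R) (a b : R) : f =1 g -> Int f a b = Int g a b.
Proof. by move=> /funext ->. Qed.

Lemma Int_ksum a N (w : R -> R) (u v : R) : contp w -> 0 < u -> u <= v ->
  Int (fun y => ksum a N y * w y) u v =
  \sum_(n < N) a n * Int (fun y => kern n%:R y * w y) u v.
Proof.
move=> cw u0 uv; elim: N => [|N IH].
  rewrite big_ord0 (eq_Int (g := fun y => 0 * w y)).
    by rewrite IntZ // mul0r.
  by move=> y; rewrite /ksum big_ord0.
rewrite big_ord_recr /= -IH -IntZ //; last first.
  by apply: contp_mulr => //; exact: contp_kern.
rewrite -IntD //; first last.
- apply: contp_mulr; first exact: contp_constr.
  by apply: contp_mulr => //; exact: contp_kern.
- by apply: contp_mulr => //; exact: contp_ksum.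
by apply: eq_Int => y; rewrite /ksum big_ord_recr /= mulrDl mulrA.
Qed.

Lemma kernE (n y : R) : kern n y = rpos (y - n)%R ^+ 2.
Proof. by rewrite /kern RpowE. Qed.

Lemma cubE (n x : R) : x != 0 -> cub n x = rpos (1 - n / x)%R ^+ 3.
Proof. by move=> x0; rewrite /cub RpowE RdivE. Qed.

Lemma inv1E (y : R) : inv1 y = y^-1.
Proof. by rewrite /inv1 RinvE. Qed.

Lemma inv2E (y : R) : inv2 y = y^-1 ^+ 2.
Proof. by rewrite /inv2 RpowE RinvE. Qed.

Lemma inv4E (y : R) : inv4 y = y^-1 ^+ 4.
Proof. by rewrite /inv4 RpowE RinvE. Qed.

Lemma IZRE (p : positive) : IZR (Z.pos p) = (nat_of_pos p)%:R.
Proof. by rewrite IZRposE INRE. Qed.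

Lemma rposP (z : R) : rpos z = Num.max 0 z.
Proof. by rewrite /rpos RmaxE. Qed.

Lemma rpos_nneg (z : R) : 0 <= rpos z.
Proof. by rewrite rposP le_max lexx. Qed.

Lemma rpos_id (z : R) : 0 <= z -> rpos z = z.
Proof. by move=> z0; rewrite rposP max_r. Qed.

Lemma rpos_0 (z : R) : z <= 0 -> rpos z = 0.
Proof. by move=> z0; rewrite rposP max_l. Qed.

Lemma le_rpos (y z : R) : y <= z -> rpos y <= rpos z.
Proof. by move=> yz; rewrite !rposP ge_max !le_max lexx yz orbT. Qed.

Lemma rposZ (c z : R) : 0 <= c -> rpos (c * z)%R = c * rpos z.
Proof. by move=> /RleP c0; exact: rpos_scale. Qed.

Lemma Int_kern_inv4 (n x : R) : 1 <= n -> 1 <= x ->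
  Int (fun y => kern n y * inv4 y) 1 x = cub n x / (3 * n).
Proof. by move=> /RleP n1 /RleP x1; rewrite /Int RInt_kern_inv4 // RdivE IZRE. Qed.

Lemma Int_kern_log (n x : R) : 1 <= n -> 1 <= x ->
  Int (fun y => kern n y * log_weight x y) 1 x = ln n / n * cub n x.
Proof. by move=> /RleP n1 /RleP x1; rewrite /Int RInt_kern_log // RdivE. Qed.

Lemma Int_inv2_le (u v : R) : 0 < u -> u <= v -> Int inv2 u v <= u^-1.
Proof.
move=> u0 uv; have v0 := lt_le_trans u0 uv.
move/RltP: u0 => u0; move/RleP: uv => uv; rewrite /Int RInt_inv_sq //.
by rewrite lerBlDr lerDl; rewrite RinvE invr_ge0 ltW.
Qed.

(** * Riesz means of sequences with small quadratic means *)

Definition small_mean (a : nat -> R) (C : R) :=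
  forall (N : nat) (y : R), 1 <= y -> y <= N%:R -> `|ksum a N y| <= C * y ^+ 2.

(** Cubic Riesz mean of the series of a n / n, which replaces the value at 1 of
    its Dirichlet series. *)
Definition S3 (a : nat -> R) (N : nat) (x : R) : R :=
  \sum_(n < N) a n / n%:R * cub n%:R x.

(** The Riesz mean that replaces minus the derivative of the Dirichlet series
    at 1. *)
Definition T3 (a : nat -> R) (N : nat) (x : R) : R :=
  \sum_(n < N) a n * ln n%:R / n%:R * cub n%:R x.

Section Riesz.
Variables (a : nat -> R) (C : R) (N : nat).
Hypothesis a0 : a 0 = 0.
Hypothesis C0 : 0 <= C.
Hypothesis aC : small_mean a C.

Lemma S3_Int (x : R) : 1 <= x ->
  S3 a N x = 3 * Int (fun y => ksum a N y * inv4 y) 1 x.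
Proof.
move=> x1; rewrite Int_ksum //; last exact: contp_inv4.
rewrite mulr_sumr; apply: eq_bigr => -[[|n] nN] _ /=.
  by rewrite a0 !mul0r mulr0.
rewrite Int_kern_inv4 //; last by rewrite ler1n.
have n0 : n.+1%:R != 0 :> R by rewrite pnatr_eq0.
by move: n.+1%:R n0 => t t0; field.
Qed.

(** Against a smoothed sum that is O(y^2), the weight y^-4 is integrable with
    tail O(1 / x). *)
Lemma S3_lip (x x' : R) : 1 <= x -> x <= x' -> x' <= N%:R ->
  `|S3 a N x' - S3 a N x| <= 3 * C / x.
Proof.
move=> x1 xx xN; have x0 : 0 < x by exact: lt_le_trans x1.
have cw : contp (fun y => ksum a N y * inv4 y).
  by apply: contp_mulr; [exact: contp_ksum|exact: contp_inv4].
rewrite !S3_Int //; last exact: le_trans xx.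
rewrite (Int_split cw _ x1 xx) // mulrDr addrAC subrr add0r normrM gtr0_norm //.
rewrite -mulrA ler_pM2l //.
apply: (@le_trans _ _ (Int (fun y => C * inv2 y) x x')).
  apply: Int_abs => //.
    by apply: contp_mulr; [exact: contp_constr|exact: contp_inv2].
  move=> y /andP[xy yx]; have y0 : 0 < y by exact: lt_le_trans xy.
  have p4 : 0 <= y^-1 ^+ 4 by rewrite exprn_ge0 // invr_ge0 ltW.
  rewrite normrM inv4E inv2E (ger0_norm p4).
  have h := aC (le_trans x1 xy) (le_trans yx xN).
  apply: (le_trans (ler_wpM2r p4 h)); rewrite le_eqVlt; apply/orP; left.
  by apply/eqP; move: (lt0r_neq0 y0) => yne; field.
rewrite IntZ //; last exact: contp_inv2.
by rewrite ler_wpM2l // Int_inv2_le.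
Qed.

(** Against a smoothed sum that is O(y^2), the logarithmic weight is absolutely
    integrable. *)
Lemma T3_bound (x : R) : 1 <= x -> x <= N%:R -> `|T3 a N x| <= 14 * C.
Proof.
move=> x1 xN.
have -> : T3 a N x = Int (fun y => ksum a N y * log_weight x y) 1 x.
  rewrite Int_ksum //; last exact: contp_log_weight.
  apply: eq_bigr => -[[|n] nN] _ /=; first by rewrite a0 !mul0r.
  by rewrite Int_kern_log ?ler1n // !mulrA.
have cg : contp (fun y => C * ((3 * ln y + 11) * inv2 y)).
  apply: contp_mulr; first exact: contp_constr.
  apply: contp_mulr; last exact: contp_inv2.
  apply: contp_addr; last exact: contp_constr.
  by apply: contp_mulr; [exact: contp_constr|exact: contp_ln].
apply: (@le_trans _ _ (Int (fun y => C * ((3 * ln y + 11) * inv2 y)) 1 x)).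
  apply: Int_abs => //.
    by apply: contp_mulr; [exact: contp_ksum|exact: contp_log_weight].
  move=> y /andP[y1 yx].
  have h := aC y1 (le_trans yx xN).
  rewrite normrM; apply: (@le_trans _ _ (C * y ^+ 2 * `|log_weight x y|)).
    by rewrite ler_wpM2r.
  have := @log_weight_bound_sq C x y; move/RleP: C0 => C0'.
  move/RleP: y1 => y1; move/RleP: yx => yx /(_ C0' (conj y1 yx)) /RleP.
  rewrite !RabsE !RmultE RpowE !RplusE !IZRE normrM ger0_norm //.
  by rewrite mulr_ge0 // sqr_ge0.
have cg' : contp (fun y => (3 * ln y + 11) * inv2 y).
  apply: contp_mulr; last exact: contp_inv2.
  apply: contp_addr; last exact: contp_constr.
  by apply: contp_mulr; [exact: contp_constr|exact: contp_ln].
rewrite IntZ // mulrC ler_wpM2r //.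
move/RleP: (x1) => x1'; have /RleP := RInt_log_inv_sq x x1'.
rewrite -/(Int _ 1 x); set f := (fun y : R => _).
rewrite (@eq_Int f (fun y => (3 * ln y + 11) * inv2 y)) ?IZRE // => y.
by rewrite /f !IZRE /inv2.
Qed.

End Riesz.

Lemma contp_sum N (c : nat -> R) (F : nat -> R -> R) : (forall n, contp (F n)) ->
  contp (fun y => \sum_(n < N) c n * F n y).
Proof.
move=> cF; elim: N => [|N IH].
  rewrite (_ : (fun y => _) = fun=> 0); first exact: contp_const.
  by apply/funext => y; rewrite big_ord0.
rewrite (_ : (fun y => _) = fun y => \sum_(n < N) c n * F n y + c N * F N y).
  by apply: contp_addr => //; apply: contp_mulr => //; exact: contp_constr.
by apply/funext => y; rewrite big_ord_recr.
Qed.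

Lemma Int_sum N (c : nat -> R) (F : nat -> R -> R) (u v : R) :
  (forall n, contp (F n)) -> 0 < u -> u <= v ->
  Int (fun y => \sum_(n < N) c n * F n y) u v = \sum_(n < N) c n * Int (F n) u v.
Proof.
move=> cF u0 uv; elim: N => [|N IH].
  rewrite big_ord0 (eq_Int (g := fun y => 0 * F 0%N y)).
    by rewrite IntZ // mul0r.
  by move=> y; rewrite big_ord0 mul0r.
rewrite big_ord_recr /= -IH -IntZ // -IntD //.
- by apply: eq_Int => y; rewrite big_ord_recr.
- exact: contp_sum.
- by apply: contp_mulr => //; exact: contp_constr.
Qed.

(** Coefficients of the product of two Dirichlet series, truncated. *)
Definition dconv (N : nat) (a b : nat -> R) (j : nat) : R :=
  \sum_(m < N) \sum_(n < N) (m * n == j)%N%:R * (a m * b n).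

Section Convolution.
Variables (a b : nat -> R) (N : nat) (x : R).
Hypothesis a0 : a 0 = 0.
Hypothesis b0 : b 0 = 0.
Hypothesis x1 : 1 <= x.
Hypothesis xN : x <= N%:R.

Definition conv_int : R :=
  Int (fun y => ksum a N y * (ksum b N (Rdiv x y) * inv1 y)) 1 x.

Lemma contp_conv_dual : contp (fun y => ksum b N (Rdiv x y) * inv1 y).
Proof. by apply: contp_mulr; [exact: contp_ksum_dual|exact: contp_inv1]. Qed.

(** The kernel of the pair (m, n) depends on m n alone. *)
Lemma conv_int_sum : conv_int =
  \sum_(j < N) dconv N a b j * conv_kernel x j%:R 1.
Proof.
have K0 j : (N <= j)%N -> conv_kernel x j%:R 1 = 0.
  move=> Nj; apply: conv_kernel_eq0; apply/RleP => //.
  by apply: le_trans xN _; rewrite ler_nat.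
transitivity (\sum_(m < N) \sum_(n < N) a m * b n * conv_kernel x (m * n)%N%:R 1).
  rewrite /conv_int Int_ksum //; last exact: contp_conv_dual.
  apply: eq_bigr => m _.
  rewrite (eq_Int (g := fun y => \sum_(n < N) b n *
     (kern m%:R y * (kern n%:R (Rdiv x y) * inv1 y)))); last first.
    move=> y; rewrite /ksum mulr_suml mulr_sumr; apply: eq_bigr => n _.
    by rewrite [in RHS]mulrCA !mulrA.
  rewrite (@Int_sum N b (fun n y => kern m%:R y * (kern n%:R (Rdiv x y) * inv1 y))) //.
    rewrite mulr_sumr; apply: eq_bigr => n _; rewrite mulrA.
    case: (val m) => [|m']; first by rewrite a0 !mul0r.
    case: (val n) => [|n']; first by rewrite b0 mulr0 !mul0r.
    congr (_ * _); rewrite natrM.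
    have m1 : Rle 1 (m'.+1%:R : R) by apply/RleP; rewrite ler1n.
    have n1 : Rle 1 (n'.+1%:R : R) by apply/RleP; rewrite ler1n.
    have x1' : Rle 1 x by apply/RleP.
    have := conv_kernel_mul x _ _ x1' m1 n1; rewrite RmultE => <-.
    rewrite /conv_kernel -/(Int _ 1 x); apply: eq_Int => y.
    by rewrite /kern /inv1 !RmultE mulrA.
  move=> n; apply: contp_mulr; first exact: contp_kern.
  by apply: contp_mulr; [exact: contp_kern_dual|exact: contp_inv1].
rewrite /dconv; transitivity (\sum_(m < N) \sum_(n < N) \sum_(j < N)
    ((m * n == j)%N%:R * (a m * b n) * conv_kernel x j%:R 1)).
  apply: eq_bigr => m _; apply: eq_bigr => n _.
  have [lt|ge] := ltnP (m * n) N.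
    rewrite (bigD1 (Ordinal lt)) //= eqxx mul1r big1 ?addr0 // => j jne.
    case: eqP => E; last by rewrite !mul0r.
    by case/negP: jne; apply/eqP/val_inj.
  rewrite K0 // mulr0 big1 // => j _.
  case: eqP => E; last by rewrite !mul0r.
  by have := ltn_ord j; rewrite -E ltnNge ge.
rewrite exchange_big /=.
under eq_bigr => n _ do rewrite exchange_big /=.
rewrite exchange_big /=; apply: eq_bigr => j _.
rewrite mulr_suml exchange_big /=; apply: eq_bigr => m _.
by rewrite mulr_suml; apply: eq_bigr => n _.
Qed.

Variables (C C' kap : R).
Hypothesis C0 : 0 <= C.
Hypothesis C0' : 0 <= C'.
Hypothesis kap0 : 0 <= kap.
Hypothesis aC : small_mean a C.
Hypothesis bC : forall (M : nat) (y : R), 1 <= y -> y <= M%:R ->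
  `|ksum b M y - kap * y ^+ 3| <= C' * y ^+ 2.

(** The main term of b turns the convolution into the Riesz mean of a, and the
    error terms contribute the logarithm. *)
Lemma conv_int_bound :
  `|conv_int| <= kap * x ^+ 3 * (`|S3 a N x| / 3) + C * C' * x ^+ 2 * ln x.
Proof.
have x0 : 0 < x by exact: lt_le_trans x1.
pose E y := ksum b N (Rdiv x y) * inv1 y - kap * x ^+ 3 * inv4 y.
have cE : contp E.
  rewrite (_ : E = fun y => ksum b N (Rdiv x y) * inv1 y +
    (- (kap * x ^+ 3)) * inv4 y).
    apply: contp_addr; first exact: contp_conv_dual.
    by apply: contp_mulr; [exact: contp_constr|exact: contp_inv4].
  by apply/funext => y; rewrite /E mulNr.
have cA : contp (fun y => ksum a N y * inv4 y).
  by apply: contp_mulr; [exact: contp_ksum|exact: contp_inv4].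
have cAE : contp (fun y => ksum a N y * E y).
  by apply: contp_mulr => //; exact: contp_ksum.
have -> : conv_int = kap * x ^+ 3 * Int (fun y => ksum a N y * inv4 y) 1 x +
    Int (fun y => ksum a N y * E y) 1 x.
  rewrite -IntZ // -IntD //; first by apply: eq_Int => y; rewrite /E; ring.
  by apply: contp_mulr => //; exact: contp_constr.
apply: le_trans (ler_normD _ _) _; apply: lerD.
  have -> : `|S3 a N x| / 3 = `|Int (fun y => ksum a N y * inv4 y) 1 x|.
    by rewrite (S3_Int N a0 x1) normrM gtr0_norm // mulrAC divff ?mul1r ?pnatr_eq0.
  rewrite normrM ger0_norm //.
  by rewrite mulr_ge0 // exprn_ge0 // ltW.
have cg : contp (fun y => C * C' * x ^+ 2 * inv1 y).
  by apply: contp_mulr; [exact: contp_constr|exact: contp_inv1].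
apply: (@le_trans _ _ (Int (fun y => C * C' * x ^+ 2 * inv1 y) 1 x)).
  apply: Int_abs => // y /andP[y1 yx].
  have y0 : 0 < y by exact: lt_le_trans y1.
  have h1 := aC y1 (le_trans yx xN).
  have xy1 : 1 <= x / y by rewrite ler_pdivlMr // mul1r.
  have xyN : x / y <= N%:R.
    by apply: le_trans xN; rewrite ler_pdivrMr // ler_peMr // ltW.
  have h2 := bC xy1 xyN.
  have yne := lt0r_neq0 y0.
  have -> : E y = (ksum b N (x / y) - kap * (x / y) ^+ 3) * y^-1.
    by rewrite /E RdivE inv1E inv4E; field.
  rewrite inv1E 2!normrM [`|y^-1|]gtr0_norm ?invr_gt0 //.
  have -> : C * C' * x ^+ 2 * y^-1 = (C * y ^+ 2) * ((C' * (x / y) ^+ 2) * y^-1).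
    by field.
  apply: ler_pM => //; first by rewrite mulr_ge0 // invr_ge0 ltW.
  by rewrite ler_wpM2r // invr_ge0 ltW.
rewrite IntZ //; last exact: contp_inv1.
move/RleP: (x1) => x1'; rewrite /Int RInt_inv //; last by apply: Rlt_0_1.
by rewrite ln_1 RminusE subr0.
Qed.

(** By positivity of the coefficients only the j <= x / 8 are kept. *)
Lemma conv_int_lower : (forall j, (0 < j < N)%N -> 0 <= dconv N a b j) ->
  x ^+ 2 / 128 * (\sum_(j < N | (0 < j)%N && (8 * j%:R <= x)) dconv N a b j) <=
  conv_int.
Proof.
move=> c0; rewrite conv_int_sum.
rewrite [leRHS](bigID (fun j : 'I_N => (0 < j)%N && (8 * j%:R <= x))) /=.
rewrite mulr_sumr -[leLHS]addr0; apply: lerD.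
  apply: ler_sum => j /andP[j0 jx]; rewrite mulrC ler_wpM2l ?c0 ?j0 ?ltn_ord //.
  have j1 : Rle 1 ((j : nat)%:R : R) by apply/RleP; rewrite ler1n.
  have h : Rle (Rmult (IZR 8) ((j : nat)%:R)) x by apply/RleP; rewrite RmultE IZRE.
  have /RleP := conv_kernel_ge x _ j1 h.
  by rewrite RdivE RpowE IZRE.
apply: sumr_ge0 => j _; have [j0|j0] := posnP j.
  rewrite /dconv big1 ?mul0r // => m _; rewrite big1 // => n _.
  case: eqP => E; last by rewrite mul0r.
  move/eqP: E; rewrite j0 muln_eq0 => /orP[]/eqP->.
    by rewrite a0 !mul0r mulr0.
  by rewrite b0 !mulr0.
rewrite mulr_ge0 ?c0 ?j0 ?ltn_ord //.
by apply/RleP; apply: conv_kernel_ge0; apply/RleP.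
Qed.

End Convolution.

(** * Multiplicative sequences with quadratic Euler factors *)

Fixpoint power_sums (t e : R) (k : nat) : R * R :=
  if k is k'.+1 then
    let: (u, v) := power_sums t e k' in (v, t * v - e * u)
  else (2, t).

(** The k-th power sum of the roots of X^2 - t X + e. *)
Definition power_sum t e k := (power_sums t e k).1.

Lemma power_sum0 t e : power_sum t e 0 = 2. Proof. by []. Qed.

Lemma power_sum1 t e : power_sum t e 1 = t. Proof. by []. Qed.

Lemma power_sumSS t e k :
  power_sum t e k.+2 = t * power_sum t e k.+1 - e * power_sum t e k.
Proof. by rewrite /power_sum /=; case: (power_sums t e k). Qed.

Section Newton.
Variables (t e : R) (u : nat -> R).
Hypothesis u1 : u 1%N = t * u 0%N.
Hypothesis uSS : forall k, u k.+2 = t * u k.+1 - e * u k.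

Lemma power_sum_rec k :
  power_sum t e k.+2 * u 0%N = t * u k.+1 - 2 * e * u k.
Proof.
suff [] : power_sum t e k.+2 * u 0%N = t * u k.+1 - 2 * e * u k /\
  power_sum t e k.+3 * u 0%N = t * u k.+2 - 2 * e * u k.+1 by [].
elim: k => [|k [IH1 IH2]].
  rewrite !power_sumSS power_sum0 power_sum1 uSS u1; split; ring.
split=> //; rewrite power_sumSS mulrBl -!mulrA IH1 IH2 !uSS; ring.
Qed.

(** Newton's identities for the complete symmetric functions. *)
Lemma newton k : k%:R * u k = \sum_(j < k) power_sum t e j.+1 * u (k - j.+1)%N.
Proof.
suff [] : k%:R * u k = \sum_(j < k) power_sum t e j.+1 * u (k - j.+1)%N /\
  k.+1%:R * u k.+1 = \sum_(j < k.+1) power_sum t e j.+1 * u (k.+1 - j.+1)%N by [].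
elim: k => [|k [IH1 IH2]].
  by rewrite big_ord0 big_ord1 mul0r mul1r power_sum1 subnn u1.
split=> //; rewrite !big_ord_recr /= subnn subSnn.
have -> : \sum_(i < k) power_sum t e i.+1 * u (k.+2 - i.+1)%N =
    t * (\sum_(i < k) power_sum t e i.+1 * u (k.+1 - i.+1)%N) -
    e * (k%:R * u k).
  rewrite IH1 !mulr_sumr -sumrB; apply: eq_bigr => i _.
  have ik := ltn_ord i; rewrite !subSS.
  have -> : (k.+1 - i = (k - i.+1).+2)%N by lia.
  have -> : (k - i = (k - i.+1).+1)%N by lia.
  by rewrite uSS; ring.
have E : \sum_(i < k) power_sum t e i.+1 * u (k.+1 - i.+1)%N =
    k.+1%:R * u k.+1 - power_sum t e k.+1 * u 0%N.
  by rewrite IH2 big_ord_recr /= subnn addrK.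
rewrite E power_sum_rec uSS u1 -[k.+2]addn2 -[k.+1]addn1 !natrD; ring.
Qed.
End Newton.

(** Sequences with Euler product over the primes q not dividing M, the factor
    at q being the inverse of 1 - t_q X + e_q X^2. *)
Record hecke_seq (M : nat) (t e lam : nat -> R) : Prop := HeckeSeq {
  hecke0 : lam 0%N = 0;
  hecke1 : lam 1%N = 1;
  hecke_ncop : forall n, ~~ coprime n M -> lam n = 0;
  heckeM : forall q n, prime q -> coprime q M -> (0 < n)%N ->
    lam (n * q)%N = t q * lam n - e q * (if (q %| n)%N then lam (n %/ q)%N else 0)
}.

(** Newton's identities at q are used both as sums over k and as double sums
    over prime powers and cofactors. *)
Lemma divisor_powers (N q n : nat) (F : nat -> nat -> R) : prime q -> (0 < n < N)%N ->
  \sum_(k < N) \sum_(m < N) (q ^ k.+1 * m == n)%N%:R * F k m =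
  \sum_(k < logn q n) F k (n %/ q ^ k.+1)%N.
Proof.
move=> pq /andP[n0 nN].
have vN : (logn q n <= N)%N.
  have := ltn_logl q n0; move=> h; exact: ltnW (ltn_trans h nN).
rewrite (bigID (fun k : 'I_N => (k < logn q n)%N)) /= [X in _ + X]big1; last first.
  move=> k kv; rewrite big1 // => m _; case: eqP => E; last by rewrite mul0r.
  case/negP: kv; rewrite -(pfactor_dvdn k.+1 pq n0) -E; exact: dvdn_mulr.
rewrite addr0 (big_ord_widen N (fun k => F k (n %/ q ^ k.+1)%N) vN).
apply: eq_bigr => k kv; have dv : (q ^ k.+1 %| n)%N by rewrite pfactor_dvdn.
have lt : (n %/ q ^ k.+1 < N)%N by apply: leq_ltn_trans nN; exact: leq_div.
have qk0 : (0 < q ^ k.+1)%N by rewrite expn_gt0 prime_gt0.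
rewrite (bigD1 (Ordinal lt)) //= mulnC divnK // eqxx mul1r big1 ?addr0 // => m mne.
case: eqP => E; last by rewrite mul0r.
by case/negP: mne; apply/eqP/val_inj; rewrite /= -E mulKn.
Qed.

Section Hecke.
Variables (M : nat) (t e lam : nat -> R).
Hypothesis H : hecke_seq M t e lam.

Definition tau q k := power_sum (t q) (e q) k.

(** The q-part of the logarithmic derivative of the Euler product. *)
Lemma hecke_newton q n : prime q -> coprime q M -> (0 < n)%N ->
  (logn q n)%:R * lam n = \sum_(k < logn q n) tau q k.+1 * lam (n %/ q ^ k.+1)%N.
Proof.
move=> pq qM n0; have q0 := prime_gt0 pq.
have [n' qn' nE] := pfactor_coprime pq n0.
have n'0 : (0 < n')%N by move: n0; rewrite nE muln_gt0 => /andP[].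
set v := logn q n in nE *.
pose u k := lam (n' * q ^ k)%N.
have u1 : u 1%N = t q * u 0%N.
  rewrite /u expn1 expn0 muln1 (heckeM H) //.
  by move: qn'; rewrite prime_coprime // => /negPf ->; rewrite mulr0 subr0.
have uSS k : u k.+2 = t q * u k.+1 - e q * u k.
  rewrite /u expnSr mulnA (heckeM H) //; last by rewrite muln_gt0 n'0 expn_gt0 q0.
  have -> : (q %| n' * q ^ k.+1)%N by rewrite expnS dvdn_mull // dvdn_mulr.
  by rewrite expnSr mulnA mulnK.
have := newton u1 uSS v; rewrite {1}/u -nE => ->.
apply: eq_bigr => k _; congr (_ * lam _).
have kv := ltn_ord k; apply/eqP; rewrite eqn_div ?expn_gt0 ?q0 //.
  by rewrite {1}nE -mulnA -expnD subnK.
by rewrite nE dvdn_mull // dvdn_exp2l.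
Qed.

End Hecke.

Lemma hecke_newton_sum M t e lam N q n : hecke_seq M t e lam -> prime q ->
  coprime q M -> (0 < n < N)%N ->
  (logn q n)%:R * lam n = \sum_(k < N) \sum_(m < N)
    (q ^ k.+1 * m == n)%N%:R * (tau t e q k.+1 * lam m).
Proof.
move=> H pq qM nN; have /andP[n0 _] := nN.
rewrite (divisor_powers (fun k m => tau t e q k.+1 * lam m) pq nN).
exact: (hecke_newton H).
Qed.

(** * Dirichlet convolutions of such sequences *)

Lemma sum_indicator N v (A : nat -> bool) (x : R) : (A v -> (v < N)%N) ->
  \sum_(j < N) (A j)%:R * ((v == j)%N%:R * x) = (A v)%:R * x.
Proof.
move=> h; case Av : (A v); last first.
  rewrite mul0r big1 // => j _; case: (eqVneq v j) => [<-|_].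
    by rewrite Av mul0r.
  by rewrite mul0r mulr0.
rewrite (bigD1 (Ordinal (h Av))) //= Av eqxx !mul1r big1 ?addr0 // => j jne.
case: (eqVneq v j) => E; last by rewrite mul0r mulr0.
by case/negP: jne; apply/eqP/val_inj.
Qed.

Section Product.
Variables (M N : nat) (t e t' e' a b : nat -> R).
Hypothesis Ha : hecke_seq M t e a.
Hypothesis Hb : hecke_seq M t' e' b.

Let c := dconv N a b.
Let p q k : R := tau t e q k + tau t' e' q k.

Lemma dconv_swap j : dconv N a b j = dconv N b a j.
Proof.
rewrite /dconv exchange_big /=; apply: eq_bigr => m _; apply: eq_bigr => n _.
by rewrite mulnC [a _ * _]mulrC.
Qed.

(** One half of Newton's identity for the convolution: the multiplicity of q
    in the first factor. *)
Lemma dconv_newton_half q n : prime q -> coprime q M -> (0 < n < N)%N ->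
  \sum_(m < N) \sum_(l < N) (m * l == n)%N%:R * ((logn q m)%:R * a m * b l) =
  \sum_(k < N) \sum_(j < N) (q ^ k.+1 * j == n)%N%:R * (tau t e q k.+1 * dconv N a b j).
Proof.
move=> pq qM /andP[n0 nN].
transitivity (\sum_(k < N) \sum_(m' < N) \sum_(l < N)
   ((q ^ k.+1 * m' * l == n)%N%:R * (tau t e q k.+1 * a m' * b l))).
  transitivity (\sum_(m < N) \sum_(l < N) \sum_(k < N) \sum_(m' < N)
     ((m * l == n)%N%:R * ((q ^ k.+1 * m' == m)%N%:R * (tau t e q k.+1 * a m' * b l)))).
    apply: eq_bigr => m _; apply: eq_bigr => l _.
    case: eqP => E; last first.
      rewrite mul0r big1 // => k _; rewrite big1 // => m' _; by rewrite mul0r.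
    have m0 : (0 < m < N)%N by rewrite ltn_ord andbT; move: n0; rewrite -E muln_gt0 => /andP[].
    rewrite mul1r (hecke_newton_sum Ha pq qM m0) mulr_suml; apply: eq_bigr => k _.
    by rewrite mulr_suml; apply: eq_bigr => m' _; rewrite mul1r !mulrA.
  under eq_bigr => m _ do rewrite exchange_big /=.
  rewrite exchange_big /=; apply: eq_bigr => k _.
  under eq_bigr => m _ do rewrite exchange_big /=.
  rewrite exchange_big /=; apply: eq_bigr => m' _.
  rewrite exchange_big /=; apply: eq_bigr => l _.
  have [l0|l0] := posnP l.
    rewrite l0 (hecke0 Hb) mulr0 mulr0 big1 // => m _; by rewrite !mulr0.
  apply: (@sum_indicator N (q ^ k.+1 * m') (fun m => (m * l == n)%N)) => /eqP E.
  by apply: leq_ltn_trans nN; rewrite -E leq_pmulr.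
apply: eq_bigr => k _.
transitivity (\sum_(m' < N) \sum_(l < N) \sum_(j < N)
    ((q ^ k.+1 * j == n)%N%:R * ((m' * l == j)%N%:R * (tau t e q k.+1 * a m' * b l)))).
  apply: eq_bigr => m' _; apply: eq_bigr => l _.
  rewrite (@sum_indicator N (m' * l) (fun j => (q ^ k.+1 * j == n)%N)).
    by rewrite mulnA.
  move=> /eqP E; apply: leq_ltn_trans nN; rewrite -E leq_pmull //.
  by rewrite expn_gt0 prime_gt0.
under eq_bigr => m' _ do rewrite exchange_big /=.
rewrite exchange_big /=; apply: eq_bigr => j _.
rewrite /dconv !mulr_sumr; apply: eq_bigr => m' _.
by rewrite !mulr_sumr; apply: eq_bigr => l _; rewrite !mulrA [_ * tau _ _ _ _]mulrAC.
Qed.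
End Product.

Section Product.
Variables (M N : nat) (t e t' e' a b : nat -> R).
Hypothesis Ha : hecke_seq M t e a.
Hypothesis Hb : hecke_seq M t' e' b.

Let c := dconv N a b.
Let p q k : R := tau t e q k + tau t' e' q k.

(** The logarithmic derivative of a product is the sum of the two, so the power
    sums add. *)
Lemma dconv_newton q n : prime q -> coprime q M -> (0 < n < N)%N ->
  (logn q n)%:R * c n = \sum_(k < logn q n) p q k.+1 * c (n %/ q ^ k.+1)%N.
Proof.
move=> pq qM nN; have /andP[n0 _] := nN.
rewrite -(divisor_powers (fun k m => p q k.+1 * c m) pq nN).
transitivity (\sum_(k < N) \sum_(j < N) (q ^ k.+1 * j == n)%N%:R *
    (tau t e q k.+1 * dconv N a b j) +
  \sum_(k < N) \sum_(j < N) (q ^ k.+1 * j == n)%N%:R *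
    (tau t' e' q k.+1 * dconv N b a j)); last first.
  rewrite -big_split; apply: eq_bigr => k _; rewrite -big_split.
  by apply: eq_bigr => j _; rewrite /= /c /p (dconv_swap N b a) -mulrDr -mulrDl.
rewrite -(dconv_newton_half Ha Hb) // -(dconv_newton_half Hb Ha) //.
rewrite [X in _ + X]exchange_big -big_split /c /dconv mulr_sumr.
apply: eq_bigr => m _; rewrite -big_split mulr_sumr; apply: eq_bigr => l _ /=.
rewrite [(l * m)%N]mulnC; case: eqP => E; last by rewrite !mul0r mulr0 addr0.
have m0 : (0 < m)%N by move: n0; rewrite -E muln_gt0 => /andP[].
have l0 : (0 < l)%N by move: n0; rewrite -E muln_gt0 => /andP[].
by rewrite -E lognM // natrD; ring.
Qed.

Lemma dconv_ncop n : ~~ coprime n M -> c n = 0.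
Proof.
move=> nM; rewrite /c /dconv big1 // => m _; rewrite big1 // => l _.
case: eqP => E; last by rewrite mul0r.
move: nM; rewrite -E coprimeMl negb_and => /orP[h|h].
  by rewrite (hecke_ncop Ha h) mul0r mulr0.
by rewrite (hecke_ncop Hb h) !mulr0.
Qed.

Lemma dconv1 : (1 < N)%N -> c 1%N = 1.
Proof.
move=> N1; rewrite /c /dconv (bigD1 (Ordinal N1)) //= (bigD1 (Ordinal N1)) //=.
rewrite (hecke1 Ha) (hecke1 Hb) !mulr1 big1; last first.
  move=> l lne; case: eqP => E; last by rewrite mul0r.
  by case/negP: lne; apply/eqP/val_inj => /=; lia.
rewrite big1 ?addr0 // => m mne; rewrite big1 // => l _.
case: eqP => E; last by rewrite mul0r.
by case/negP: mne; apply/eqP/val_inj => /=; move/eqP: E; rewrite muln_eq1 => /andP[/eqP].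
Qed.

Hypothesis p_ge0 : forall q k, prime q -> coprime q M -> 0 <= p q k.
Hypothesis p_two : forall q, prime q -> coprime q M -> 2 <= p q 1 ^+ 2 + p q 2.

(** Newton's identity at a prime factor of n expresses c n through values at
    smaller arguments, with nonnegative coefficients. *)
Lemma dconv_ge0 n : (0 < n < N)%N -> 0 <= c n.
Proof.
have [k] := ubnP n; elim: k n => // k IH n nk nN; have /andP[n0 nN'] := nN.
have [nM|nM] := boolP (coprime n M); last by rewrite dconv_ncop.
have [n1|n1] := leqP n 1.
  have nE : n = 1%N by lia.
  by rewrite nE dconv1 // -nE.
have pq := pdiv_prime n1; set q := pdiv n in pq.
have qn : (q %| n)%N := pdiv_dvd n.
have qM : coprime q M := coprime_dvdl qn nM.
have v0 : (0 < logn q n)%N by rewrite logn_gt0 mem_primes pq n0.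
have v0' : 0 < (logn q n)%:R :> R by rewrite ltr0n.
rewrite -(pmulr_rge0 _ v0') (dconv_newton pq qM nN).
apply: sumr_ge0 => j _; apply: mulr_ge0; first exact: p_ge0.
have dv : (q ^ j.+1 %| n)%N by rewrite pfactor_dvdn.
have h0 : (0 < n %/ q ^ j.+1)%N.
  by rewrite divn_gt0 ?expn_gt0 ?prime_gt0 // dvdn_leq.
have lt : (n %/ q ^ j.+1 < n)%N.
  rewrite ltn_Pdiv //; apply: leq_trans (prime_gt1 pq) _.
  by rewrite -{1}(expn1 q) leq_exp2l // prime_gt1.
apply: IH; first by apply: leq_trans lt _; rewrite -ltnS.
by rewrite h0 (ltn_trans lt).
Qed.

(** Newton's identity gives c(n q) = p_1 c(n) and
    2 c(n q^2) = (p_1^2 + p_2) c(n). *)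
Lemma dconv_sq q n : prime q -> coprime q M -> (0 < n)%N -> ~~ (q %| n)%N ->
  (n * q ^ 2 < N)%N -> c n <= c (n * q ^ 2)%N.
Proof.
move=> pq qM n0 qn nN; have q0 := prime_gt0 pq; have q1 := prime_gt1 pq.
have vn : logn q n = 0%N by rewrite lognE pq n0 (negPf qn).
have nqN : (n * q < N)%N.
  apply: leq_ltn_trans nN; rewrite leq_mul2l -{1}(expn1 q) leq_exp2l //.
  by rewrite orbT.
have nq0 : (0 < n * q)%N by rewrite muln_gt0 n0.
have nq20 : (0 < n * q ^ 2)%N by rewrite muln_gt0 n0 expn_gt0 q0.
have c0 : 0 <= c n.
  by apply: dconv_ge0; rewrite n0 (leq_ltn_trans _ nqN) // leq_pmulr.
have h1 := @dconv_newton q (n * q) pq qM _.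
have h2 := @dconv_newton q (n * q ^ 2) pq qM _.
rewrite lognM // (logn_prime q pq) eqxx vn /= big_ord1 expn1 mulnK // mul1r in h1.
rewrite lognM ?expn_gt0 ?q0 // lognX (logn_prime q pq) eqxx vn /= in h2.
rewrite !big_ord_recr big_ord0 /= add0r expn1 mulnK ?expn_gt0 ?q0 // in h2.
have E : (n * q ^ 2 %/ q = n * q)%N by rewrite -mulnn mulnA mulnK.
rewrite E in h2; have {}h1 := h1 _; have {}h2 := h2 _.
have {}h1 : c (n * q)%N = p q 1 * c n by apply: h1; rewrite nq0.
have {}h2 : 2 * c (n * q ^ 2)%N = p q 1 * c (n * q)%N + p q 2 * c n.
  by apply: h2; rewrite nq20.
rewrite h1 in h2; have h3 := p_two pq qM.
have : 2 * c n <= 2 * c (n * q ^ 2)%N.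
  rewrite h2; have -> : p q 1 * (p q 1 * c n) + p q 2 * c n =
    (p q 1 ^+ 2 + p q 2) * c n by ring.
  exact: ler_wpM2r.
by rewrite ler_pM2l.
Qed.

Lemma dconv_squarefree s : (0 < s)%N -> coprime s M ->
  (forall q, prime q -> (logn q s <= 1)%N) -> (s ^ 2 < N)%N -> 1 <= c (s ^ 2)%N.
Proof.
have [k] := ubnP s; elim: k s => // k IH s sk s0 sM sf sN.
have [s1|s1] := leqP s 1.
  have sE : s = 1%N by lia.
  by rewrite sE dconv1 // -[1%N]/(1 ^ 2)%N -{1}sE.
have pq := pdiv_prime s1; set q := pdiv s in pq.
have q0 := prime_gt0 pq.
have qs : (q %| s)%N := pdiv_dvd s.
have qM : coprime q M := coprime_dvdl qs sM.
have /dvdnP[s' sE] := qs.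
have s'0 : (0 < s')%N by move: s0; rewrite sE muln_gt0 => /andP[].
have qs' : ~~ (q %| s')%N.
  have := sf q pq; rewrite sE lognM // (logn_prime q pq) eqxx addn1 ltnS leqn0.
  by rewrite lognE pq s'0 /=; case: (q %| s')%N.
rewrite sE expnMn; apply: (@le_trans _ _ (c (s' ^ 2)%N)); last first.
  apply: dconv_sq => //; first by rewrite expn_gt0 s'0.
    by rewrite Euclid_dvdX // (negPf qs').
  by rewrite -expnMn -sE.
have lt : (s' < s)%N by rewrite sE ltn_Pmulr // prime_gt1.
apply: IH => //.
- by apply: leq_trans lt _; rewrite -ltnS.
- by apply: coprime_dvdl sM; rewrite sE dvdn_mulr.
- move=> l pl; apply: leq_trans (sf l pl); apply: dvdn_leq_log => //.
  by rewrite sE dvdn_mulr.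
- by apply: ltn_trans sN; rewrite ltn_exp2r.
Qed.

End Product.

(** * Counting squarefree numbers *)

Lemma squarefree_part n : (0 < n)%N -> exists s r,
  [/\ n = (s * r ^ 2)%N & forall q, prime q -> (logn q s <= 1)%N].
Proof.
have [k] := ubnP n; elim: k n => // k IH n nk n0.
have [sf|nsf] := pselect (forall q, prime q -> (logn q n <= 1)%N).
  by exists n, 1%N; split=> //; rewrite muln1.
have [q pq vq] : exists2 q, prime q & (1 < logn q n)%N.
  apply: contrapT => h; apply: nsf => q pq; rewrite leqNgt; apply/negP => vq.
  by apply: h; exists q.
have /dvdnP[n' nE] : (q ^ 2 %| n)%N by rewrite pfactor_dvdn.
have n'0 : (0 < n')%N by move: n0; rewrite nE muln_gt0 => /andP[].
have lt : (n' < n)%N.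
  by rewrite nE ltn_Pmulr // (ltn_exp2l 0) // prime_gt1.
have [|s [r [E sf]]] := IH n' _ n'0; first by apply: leq_trans lt _; rewrite -ltnS.
by exists s, (r * q)%N; split=> //; rewrite nE E expnMn mulnA.
Qed.

Definition sqfree_cop (M s : nat) : Prop :=
  [/\ (0 < s)%N, coprime s M & forall q, prime q -> (logn q s <= 1)%N].

(** Of the integers 1 + M k with k < Y^2, each is s r^2 with s squarefree and
    r <= M Y. *)
Lemma count_squarefree (M Y : nat) : (0 < M)%N -> (0 < Y)%N ->
  (Y <= #|[set s : 'I_(M * Y ^ 2).+1 | `[< sqfree_cop M s >]]| * M.*2)%N.
Proof.
move=> M0 Y0; set Z := (M * Y ^ 2)%N; set S := [set s | _].
pose nk (k : 'I_(Y ^ 2)) := (1 + M * k)%N.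
have nkZ k : (nk k <= Z)%N.
  apply: (@leq_trans (M * k.+1)); first by rewrite /nk mulnS leq_add2r.
  by rewrite leq_mul2l ltn_ord orbT.
have ex k : exists sr : 'I_Z.+1 * 'I_(M * Y).+1,
    sqfree_cop M sr.1 /\ nk k = (sr.1 * sr.2 ^ 2)%N.
  have [s [r [E sf]]] := @squarefree_part (nk k) isT.
  have r0 : (0 < r)%N by case: r E => // ; rewrite muln0.
  have s0 : (0 < s)%N by case: s E sf.
  have sZ : (s < Z.+1)%N.
    by rewrite ltnS; apply: leq_trans (nkZ k); rewrite E leq_pmulr // expn_gt0 r0.
  have rY : (r < (M * Y).+1)%N.
    rewrite ltnS -(leq_exp2r _ _ (isT : 0 < 2)%N).
    apply: (@leq_trans Z); first by apply: leq_trans (nkZ k); rewrite E leq_pmull.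
    by rewrite /Z expnMn leq_mul2r -[X in (X <= _)%N](expn1 M) leq_pexp2l // orbT.
  exists (Ordinal sZ, Ordinal rY); split=> //=; split=> //.
  have : coprime (nk k) M by rewrite coprime_sym /coprime /nk addnC mulnC gcdnMDl gcdn1.
  by rewrite E coprimeMl => /andP[].
have [f fP] := choice ex.
have inj : injective f.
  move=> k l E; apply: val_inj; have [_ h1] := fP k; have [_ h2] := fP l.
  have : nk k = nk l by rewrite h1 h2 E.
  by rewrite /nk => /eqP; rewrite eqn_add2l eqn_mul2l gtn_eqF //= => /eqP.
have : (#|[set f k | k : 'I_(Y ^ 2)]| <= #|setX S [set: 'I_(M * Y).+1]|)%N.
  apply: subset_leq_card; apply/subsetP => x /imsetP[k _ ->].
  by rewrite !inE andbT; apply/asboolP; have [] := fP k.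
rewrite card_imset // card_ord cardsX cardsT card_ord => h.
have : (Y * Y <= #|S| * M.*2 * Y)%N.
  rewrite mulnn; apply: leq_trans h _; rewrite -mulnA leq_mul2l; apply/orP; right.
  by rewrite -muln2; nia.
by rewrite leq_pmul2r.
Qed.

(** * Logarithms *)

Lemma ln_le_sub1 (x : R) : 0 < x -> ln x <= x - 1.
Proof.
move=> /RltP x0; have := exp_ineq1_le (ln x).
by rewrite exp_ln // => /RleP; rewrite RplusE lerBrDl.
Qed.

Lemma ln_le_id (x : R) : 0 < x -> ln x <= x.
Proof. by move=> /ln_le_sub1 h; apply: le_trans h _; rewrite gerBl. Qed.

Lemma ln_mul (x y : R) : 0 < x -> 0 < y -> ln (x * y) = ln x + ln y.
Proof. by move=> /RltP x0 /RltP y0; exact: ln_mult. Qed.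

Lemma ln_expn (x : R) n : 0 < x -> ln (x ^+ n) = n%:R * ln x.
Proof.
move=> x0; elim: n => [|n IH]; first by rewrite expr0 mul0r ln_1.
by rewrite exprS ln_mul ?exprn_gt0 // IH -natr1 mulrDl mul1r addrC.
Qed.

Lemma le_ln (x y : R) : 0 < x -> x <= y -> ln x <= ln y.
Proof. by move=> /RltP x0 /RleP xy; apply/RleP; exact: ln_le. Qed.

Lemma ln_ge0 (x : R) : 1 <= x -> 0 <= ln x.
Proof. by move=> x1; have l1 : ln 1 = 0 := ln_1; rewrite -l1; exact: le_ln. Qed.

Lemma big_nat_above (x : R) : exists n : nat, x < n%:R.
Proof.
exists (Num.bound `|x|); apply: le_lt_trans (ler_norm _) _.
by apply: archi_boundP.
Qed.

(** * Nonvanishing *)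

Lemma cub0 (n x : R) : 0 < x -> x <= n -> cub n x = 0.
Proof.
move=> x0 xn; rewrite cubE ?lt0r_neq0 // rpos_0 ?expr0n //.
by rewrite subr_le0 ler_pdivlMr // mul1r.
Qed.

Lemma S3_extend a N N' (x : R) : 0 < x -> x <= N%:R -> (N <= N')%N ->
  S3 a N' x = S3 a N x.
Proof.
move=> x0 xN NN; rewrite /S3 -!(big_mkord xpredT (fun n => a n / n%:R * cub n%:R x)).
rewrite (big_cat_nat _ (n := N)) //= [X in _ + X]big1_seq ?addr0 // => n.
rewrite mem_index_iota => /andP[_ /andP[Nn _]].
by rewrite cub0 ?mulr0 // (le_trans xN) // ler_nat.
Qed.

Section Nonvanishing.
Variables (M : nat) (t e t' e' a b : nat -> R) (C C' kap : R).
Hypothesis M0 : (0 < M)%N.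
Hypothesis Ha : hecke_seq M t e a.
Hypothesis Hb : hecke_seq M t' e' b.
Hypothesis p_ge0 : forall q k, prime q -> coprime q M ->
  0 <= tau t e q k + tau t' e' q k.
Hypothesis p_two : forall q, prime q -> coprime q M ->
  2 <= (tau t e q 1 + tau t' e' q 1) ^+ 2 + (tau t e q 2 + tau t' e' q 2).
Hypothesis C0 : 0 <= C.
Hypothesis C0' : 0 <= C'.
Hypothesis kap0 : 0 <= kap.
Hypothesis aC : small_mean a C.
Hypothesis bC : forall (N : nat) (y : R), 1 <= y -> y <= N%:R ->
  `|ksum b N y - kap * y ^+ 3| <= C' * y ^+ 2.

(** Only the squares of squarefree numbers are kept, each with weight 1. *)
Lemma card_sq_le_dconv (Z N : nat) : (8 * Z ^ 2 = N)%N -> (0 < Z)%N ->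
  (#|[set s : 'I_Z.+1 | `[< sqfree_cop M s >]]|)%:R <=
  \sum_(j < N | (0 < j)%N && (8 * j%:R <= N%:R :> R)) dconv N a b j.
Proof.
move=> ZN Z0; set S := [set s | _].
have sqN (s : 'I_Z.+1) : (s ^ 2 < N)%N.
  have sZ : (s <= Z)%N by rewrite -ltnS.
  rewrite -ZN; apply: (@leq_ltn_trans (Z ^ 2)); first by rewrite leq_exp2r.
  by rewrite ltn_Pmull // expn_gt0 Z0.
pose f s := Ordinal (sqN s).
have inj : injective f.
  move=> s s' /(congr1 val) /= /eqP; rewrite eqn_exp2r // => /eqP E.
  exact: val_inj.
have c0 (j : 'I_N) : (0 < j)%N -> 0 <= dconv N a b j.
  by move=> j0; apply: (dconv_ge0 Ha Hb) => //; rewrite j0 ltn_ord.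
apply: (@le_trans _ _ (\sum_(j in f @: S) dconv N a b j)).
  rewrite big_imset /=; last by move=> s s' _ _; exact: inj.
  rewrite -sumr_const; apply: ler_sum => s; rewrite inE => /asboolP[s0 sM sf].
  exact: (dconv_squarefree Ha Hb).
rewrite [leRHS](bigID (mem (f @: S))) /= -[leLHS]addr0; apply: lerD; last first.
  by apply: sumr_ge0 => j /andP[/andP[j0 _] _]; exact: c0.
rewrite le_eqVlt; apply/orP; left; apply/eqP; apply: eq_bigl => j.
case: (boolP (j \in f @: S)) => jS; rewrite ?andbT ?andbF //.
have /imsetP[s] := jS; rewrite inE => /asboolP[s0 _ _] ->.
rewrite /= expn_gt0 s0 /= -natrM ler_nat -ZN leq_mul2l /= leq_exp2r //.
by rewrite -[(s <= Z)%N]ltnS ltn_ord.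
Qed.

(** By S3_lip it is enough to find one x0 with |S3 x0| > 3 C / x0. Otherwise the
    convolution integral of a with b would be O(x^2 log x), although squares of
    squarefree numbers contribute at least a multiple of x^2 x^(1/4) to it. *)
Lemma S3_nonvanishing : exists x0 del : R, [/\ 1 <= x0, 0 < del &
  forall N (x : R), x0 <= x -> x <= N%:R -> del <= `|S3 a N x|].
Proof.
have a00 := hecke0 Ha; have b00 := hecke0 Hb.
have [[x0 [N0 [x01 xN0 big]]]|small] := pselect (exists (x0 : R) N0,
    [/\ 1 <= x0, x0 <= N0%:R & 3 * C / x0 < `|S3 a N0 x0|]).
  have x00 : 0 < x0 by exact: lt_le_trans x01.
  exists x0, (`|S3 a N0 x0| - 3 * C / x0); split=> //; first by rewrite subr_gt0.
  move=> N x x0x xN.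
  have E : S3 a N x0 = S3 a N0 x0.
    have [h|h] := leqP N0 N; first exact: S3_extend.
    by apply/esym; apply: S3_extend (ltnW h) => //; exact: le_trans xN.
  have h := S3_lip a00 C0 aC x01 x0x xN; rewrite E in h.
  have := lerB_dist (S3 a N0 x0) (S3 a N x).
  by rewrite distrC => h'; lra.
exfalso.
have bound (W : nat) : (0 < W)%N -> W%:R ^+ 2 <=
    256 * M%:R * (kap * C + C * C' * (ln (8 * M%:R ^+ 2)%R + 8 * W%:R)) :> R.
  move=> W0; pose Y := (W ^ 2)%N; pose Z := (M * Y ^ 2)%N; pose N := (8 * Z ^ 2)%N.
  have Y0 : (0 < Y)%N by rewrite expn_gt0 W0.
  have Z0 : (0 < Z)%N by rewrite muln_gt0 M0 expn_gt0 Y0.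
  have N1 : 1 <= N%:R :> R by rewrite ler1n muln_gt0 expn_gt0 Z0.
  have N0 : 0 < N%:R :> R by exact: lt_le_trans N1.
  have W0' : 0 < W%:R :> R by rewrite ltr0n.
  have M0' : 0 < M%:R :> R by rewrite ltr0n.
  have h1 := card_sq_le_dconv (erefl N) Z0.
  have h2 := count_squarefree M0 Y0.
  have dpos j : (0 < j < N)%N -> 0 <= dconv N a b j.
    by move=> hj; apply: (dconv_ge0 Ha Hb).
  have h3 := conv_int_lower a00 b00 N1 (lexx _) dpos.
  have h4 := conv_int_bound a00 N1 (lexx _) kap0 aC bC.
  have S3small : `|S3 a N N%:R| <= 3 * C / N%:R.
    rewrite leNgt; apply/negP => h; apply: small.
    by exists N%:R, N; split.
  have lnN : ln N%:R = ln (8 * M%:R ^+ 2)%R + 8 * ln W%:R :> R.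
    have -> : N%:R = (8 * M%:R ^+ 2) * W%:R ^+ 8 :> R.
      by rewrite /N /Z /Y !(natrM, natrX); ring.
    have p1 : 0 < 8 * M%:R ^+ 2 :> R by rewrite mulr_gt0 // exprn_gt0.
    rewrite (ln_mul p1) ?exprn_gt0 // ln_expn //.
  have h5 : N%:R ^+ 2 / 128 * (#|[set s : 'I_Z.+1 | `[< sqfree_cop M s >]]|)%:R <=
      N%:R ^+ 2 * (kap * C + C * C' * ln N%:R) :> R.
    apply: (@le_trans _ _ (conv_int a b N N%:R)).
      apply: le_trans h3; rewrite ler_pM2l // divr_gt0 // exprn_gt0 //.
    apply: le_trans (ler_norm _) _; apply: le_trans h4 _.
    have -> : N%:R ^+ 2 * (kap * C + C * C' * ln N%:R) =
      kap * N%:R ^+ 3 * (3 * C / N%:R / 3) + C * C' * N%:R ^+ 2 * ln N%:R :> R.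
      by move: (N%:R) (lt0r_neq0 N0) (ln _) => n n0 l; field.
    rewrite lerD2r; apply: ler_wpM2l; first by rewrite mulr_ge0 // exprn_ge0 // ltW.
    by rewrite ler_pM2r ?invr_gt0.
  have {}h5 : (#|[set s : 'I_Z.+1 | `[< sqfree_cop M s >]]|)%:R <=
      128 * (kap * C + C * C' * ln N%:R) :> R.
    have n2 : 0 < N%:R ^+ 2 / 128 :> R by rewrite divr_gt0 // exprn_gt0.
    rewrite -(ler_pM2l n2); apply: le_trans h5 _.
    rewrite le_eqVlt; apply/orP; left; apply/eqP.
    by move: (N%:R) (ln _) => n l; field.
  have h6 : W%:R ^+ 2 <= (#|[set s : 'I_Z.+1 | `[< sqfree_cop M s >]]|)%:R * (2 * M%:R) :> R.
    by rewrite -natrX -!natrM ler_nat mul2n.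
  apply: le_trans h6 _.
  apply: (@le_trans _ _ (128 * (kap * C + C * C' * ln N%:R) * (2 * M%:R))).
    by rewrite ler_wpM2r // mulr_ge0 // ltW.
  have -> : 256 * M%:R * (kap * C + C * C' * (ln (8 * M%:R ^+ 2)%R + 8 * W%:R)) =
    128 * (kap * C + C * C' * (ln (8 * M%:R ^+ 2)%R + 8 * W%:R)) * (2 * M%:R) :> R.
    by ring.
  rewrite ler_wpM2r ?mulr_ge0 ?(ltW M0') // ler_pM2l // lerD2l.
  rewrite ler_wpM2l ?mulr_ge0 // lnN lerD2l ler_pM2l //.
  exact: ln_le_id.
set A := 256 * M%:R * (kap * C + C * C' * ln (8 * M%:R ^+ 2)%R).
set B := 256 * M%:R * (C * C' * 8).
have [W hW] := big_nat_above (`|A| + `|B| + 1)%R.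
have A0 := normr_ge0 A; have B0 := normr_ge0 B.
have W1 : 1 <= W%:R :> R by apply: ltW; apply: le_lt_trans hW; rewrite lerDr addr_ge0.
have W0 : (0 < W)%N by rewrite -(ltr0n R); exact: lt_le_trans W1.
have := bound W W0.
have -> : 256 * M%:R * (kap * C + C * C' * (ln (8 * M%:R ^+ 2)%R + 8 * W%:R)) =
  A + B * W%:R :> R by rewrite /A /B; ring.
have h7 := ler_norm A; have h8 := ler_norm B.
move: (W%:R) (`|A|) (`|B|) hW W1 A0 B0 h7 h8 => w nA nB hW W1 A0 B0 h7 h8.
apply/negP; rewrite -ltNge.
apply: (@le_lt_trans _ _ (nA * w + nB * w)).
  apply: lerD; last by rewrite ler_wpM2r // (le_trans _ W1).
  by apply: (le_trans h7); rewrite ler_peMr.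
rewrite -mulrDl expr2 ltr_pM2r; lra.
Qed.

End Nonvanishing.

(** * Chebyshev's bound *)

Lemma ln_nat_ge0 n : 0 <= ln n%:R :> R.
Proof.
case: n => [|n]; last by apply: ln_ge0; rewrite ler1n.
have -> : ln 0%:R = 0 :> R; last by [].
by rewrite /ln; case: Rlt_dec => // h; exfalso; move/RltP: h; rewrite ltxx.
Qed.

(** For n < N all prime factors of n occur in the sum. *)
Lemma ln_factor N n : (0 < n)%N ->
  \sum_(q < N | prime q) (logn q n)%:R * ln q%:R <= ln n%:R :> R /\
  ((n < N)%N -> \sum_(q < N | prime q) (logn q n)%:R * ln q%:R = ln n%:R :> R).
Proof.
elim/ltn_ind: n => n IH n0; have [n1|n1] := leqP n 1.
  have -> : n = 1%N by lia.
  have l1 : ln 1%:R = 0 :> R := ln_1.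
  have E : \sum_(q < N | prime q) (logn q 1)%:R * ln q%:R = 0 :> R.
    by rewrite big1 // => q _; rewrite logn1 mul0r.
  by rewrite E l1.
have pp := pdiv_prime n1; set p := pdiv n in pp.
have p0 := prime_gt0 pp.
have nE : n = (p * (n %/ p))%N by rewrite mulnC divnK // pdiv_dvd.
set n' := (n %/ p)%N in nE; have n'0 : (0 < n')%N by rewrite divn_gt0 // pdiv_leq.
have n'n : (n' < n)%N by rewrite ltn_Pdiv // prime_gt1.
have [IH1 IH2] := IH _ n'n n'0.
have E : \sum_(q < N | prime q) (logn q n)%:R * ln q%:R =
   \sum_(q < N | prime q) (val q == p)%:R * ln q%:R +
   \sum_(q < N | prime q) (logn q n')%:R * ln q%:R :> R.
  rewrite -big_split /=; apply: eq_bigr => q pq.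
  by rewrite nE lognM // natrD logn_prime // eq_sym mulrDl.
have lE : ln n%:R = ln p%:R + ln n'%:R :> R.
  by rewrite {1}nE natrM ln_mul ?ltr0n.
rewrite E lE.
have [pN|pN] := ltnP p N.
  have -> : \sum_(q < N | prime q) (val q == p)%:R * ln q%:R = ln p%:R :> R.
    rewrite (bigD1 (Ordinal pN)) //= eqxx mul1r big1 ?addr0 // => q /andP[_ qp].
    case: eqP => e; last by rewrite mul0r.
    by case/negP: qp; apply/eqP/val_inj.
  split; first by rewrite lerD2l.
  by move=> nN; rewrite IH2 //; exact: ltn_trans nN.
have -> : \sum_(q < N | prime q) (val q == p)%:R * ln q%:R = 0 :> R.
  rewrite big1 // => q _; case: eqP => e; last by rewrite mul0r.
  by have := ltn_ord q; rewrite e ltnNge pN.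
split; first by rewrite lerD // ln_nat_ge0.
by move=> nN; have := pdiv_leq n0; rewrite -/p => /(leq_ltn_trans) /(_ nN); rewrite ltnNge pN.
Qed.

Lemma logn_fact_widen p n L : prime p -> (n <= L)%N ->
  logn p n`! = (\sum_(k < L) n %/ p ^ k.+1)%N.
Proof.
move=> pp nL; rewrite logn_fact // big_add1 /= big_mkord.
rewrite (big_ord_widen L (fun k => n %/ p ^ k.+1)%N nL) big_mkcond /=.
apply: eq_bigr => k _; case: ltnP => // nk; rewrite divn_small //.
by apply: leq_ltn_trans nk _; apply: ltn_trans (ltn_expl _ (prime_gt1 pp)); rewrite ltnS.
Qed.

Definition psi (N n : nat) : R :=
  \sum_(q < N | prime q) \sum_(k < N) (q ^ k.+1 <= n)%N%:R * ln q%:R.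

(** In Legendre's formula, floor (2 m / d) - 2 floor (m / d) is nonnegative, and
    it is 1 for m < d <= 2 m. *)
Lemma central_bin_logn p m N : prime p ->
  (\sum_(k < N) (m < p ^ k.+1 <= m.*2)%N <= logn p 'C(m.*2, m))%N.
Proof.
move=> pp; pose L := maxn N m.*2.
have NL : (N <= L)%N by rewrite leq_maxl.
have mL : (m.*2 <= L)%N by rewrite leq_maxr.
have mL' : (m <= L)%N by apply: leq_trans mL; rewrite -addnn leq_addr.
have E : ('C(m.*2, m) * (m`! * m`!) = (m.*2)`!)%N.
  have := @bin_fact m.*2 m; rewrite -addnn addnK => -> //; exact: leq_addr.
have C0 : (0 < 'C(m.*2, m))%N by rewrite bin_gt0 -addnn leq_addr.
have := congr1 (logn p) E; rewrite !lognM ?muln_gt0 ?fact_gt0 //.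
rewrite !(@logn_fact_widen p _ L) // => {}E.
have h : (\sum_(k < L) ((m < p ^ k.+1 <= m.*2)%N + (m %/ p ^ k.+1 + m %/ p ^ k.+1)) <=
    \sum_(k < L) m.*2 %/ p ^ k.+1)%N.
  apply: leq_sum => k _; have d0 : (0 < p ^ k.+1)%N by rewrite expn_gt0 prime_gt0.
  move: (p ^ k.+1)%N d0 => d d0.
  have h2 : (m %/ d + m %/ d <= m.*2 %/ d)%N.
    by rewrite leq_divRL // addnn -doubleMl leq_double leq_trunc_div.
  case: andP => //= -[md dm]; rewrite divn_small // addn0 divn_gt0 //.
rewrite !big_split /= -E in h.
have {}h : (\sum_(k < L) (m < p ^ k.+1 <= m.*2)%N <= logn p 'C(m.*2, m))%N.
  by rewrite -(leq_add2r (\sum_(k < L) m %/ p ^ k.+1 + \sum_(k < L) m %/ p ^ k.+1)).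
apply: leq_trans h.
rewrite (big_ord_widen L (fun k => ((m < p ^ k.+1 <= m.*2)%N : nat)) NL) big_mkcond /=.
by apply: leq_sum => k _; case: ifP.
Qed.

Lemma psi_double N m : psi N m.*2 <= psi N m + m.*2%:R.
Proof.
have C0 : (0 < 'C(m.*2, m))%N by rewrite bin_gt0 -addnn leq_addr.
have l2 : ln 2%:R <= 1 :> R by have := @ln_le_sub1 2%:R (ltr0Sn _ _); lra.
have lC : ln ('C(m.*2, m))%:R <= m.*2%:R :> R.
  apply: (@le_trans _ _ (ln (2 ^ m.*2)%:R)).
    apply: le_ln; rewrite ?ltr0n // ler_nat (@expnDn 1 1 m.*2).
    have mm : (m < m.*2.+1)%N by rewrite ltnS -addnn leq_addr.
    rewrite (bigD1 (Ordinal mm)) //= !exp1n !muln1; exact: leq_addr.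
  rewrite natrX ln_expn //; apply: le_trans (ler_wpM2l (ler0n _ _) l2) _.
  by rewrite mulr1.
apply: le_trans (lerD (lexx _) lC).
have [h _] := @ln_factor N _ C0.
apply: le_trans (lerD (lexx _) h).
rewrite /psi -big_split /=; apply: ler_sum => q pq.
rewrite -!mulr_suml -mulrDl ler_wpM2r ?ln_nat_ge0 //.
have h2 : (\sum_(k < N) (m < q ^ k.+1 <= m.*2)%N)%:R <= (logn q 'C(m.*2, m))%:R :> R.
  by rewrite ler_nat central_bin_logn.
apply: le_trans (lerD (lexx _) h2).
rewrite natr_sum -big_split /=; apply: ler_sum => k _.
by rewrite -natrD ler_nat ltnNge; case: (_ <= m.*2)%N => //; case: (_ <= m)%N.
Qed.

Lemma psi_le N n n' : (n <= n')%N -> psi N n <= psi N n'.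
Proof.
move=> nn; apply: ler_sum => q _; apply: ler_sum => k _.
rewrite ler_wpM2r ?ln_nat_ge0 // ler_nat.
by case h: (_ <= n)%N => //; rewrite (leq_trans h nn).
Qed.

Lemma psi_small N n : (n <= 1)%N -> psi N n = 0.
Proof.
move=> n1; rewrite /psi big1 // => q pq; rewrite big1 // => k _.
rewrite leqNgt (leq_ltn_trans n1) ?mul0r //.
by rewrite -{1}(expn0 q) ltn_exp2l // prime_gt1.
Qed.

(** Each prime power in (m, 2m] contributes to the binomial coefficient
    C(2m, m), which is at most 4^m. *)
Lemma chebyshev N n : psi N n <= 4 * n%:R.
Proof.
elim/ltn_ind: n => n IH; have [n1|n1] := leqP n 1.
  by rewrite psi_small // mulr_ge0.
pose m := uphalf n.
have nm : (n <= m.*2)%N by rewrite /m uphalfE; have := odd_double_half n.+1; lia.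
have mn : (m.*2 <= n.+1)%N by rewrite /m uphalfE; have := odd_double_half n.+1; lia.
have [n2|n3] : n = 2%N \/ (2 < n)%N by lia.
  have := psi_double N 1; rewrite (@psi_small N 1) // n2 -[1.*2]/2%N; lra.
have lt : (m < n)%N by lia.
have h1 := IH m lt; have h2 := psi_double N m; have h3 := psi_le N nm.
have h4 : m.*2%:R = 2 * m%:R :> R by rewrite -mul2n natrM.
have h5 : 2 * m%:R <= n%:R + 1 :> R by rewrite -h4 natr1 ler_nat.
have h6 : 3 <= n%:R :> R by rewrite (ler_nat _ 3).
lra.
Qed.

(** * Convergence of the sum over higher prime powers *)

(** The right-hand sides telescope. *)
Lemma ln_sum_step n : (1 < n)%N ->
  ln n%:R / (n%:R * (n%:R - 1)) <= (ln n.-1%:R + 2) / n.-1%:R - (ln n%:R + 2) / n%:R :> R.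
Proof.
case: n => [//|[//|n]] _ /=.
have -> : n.+2%:R = n.+1%:R + 1 :> R by rewrite natr1.
have : 1 <= n.+1%:R :> R by rewrite ler1n.
move: (n.+1%:R) => x x1; have x0 : 0 < x by exact: lt_le_trans x1.
have h : ln (x + 1)%R <= ln x + 1 / x.
  have -> : x + 1 = x * (1 + 1 / x) by move: (lt0r_neq0 x0) => xn; field.
  have p : 0 < 1 + 1 / x by rewrite addr_gt0 // divr_gt0.
  rewrite ln_mul // lerD2l; apply: le_trans (ln_le_sub1 p) _.
  by rewrite addrC addKr.
have xp : 0 < x + 1 by rewrite addr_gt0.
have -> : (ln x + 2) / x - (ln (x + 1)%R + 2) / (x + 1) =
   (ln x * (x + 1) + 2 - ln (x + 1)%R * x) / ((x + 1) * x).
  by move: (ln x) (ln _) (lt0r_neq0 x0) (lt0r_neq0 xp) => a b xn xn'; field; rewrite xn.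
rewrite addrK ler_pM2r ?invr_gt0 ?mulr_gt0 //.
have hx : ln (x + 1)%R * x <= ln x * x + 1.
  have := ler_wpM2r (ltW x0) h; rewrite mulrDl divfK ?lt0r_neq0 //.
have h3 : 1 / x <= 1 by rewrite ler_pdivrMr // mul1r.
move: (ln x) (ln _) h hx => a b h hx; lra.
Qed.

Lemma ln_sum_bound N :
  \sum_(q < N | prime q) ln q%:R / (q%:R * (q%:R - 1)) <= 2 :> R.
Proof.
have h : forall n, \sum_(q < n.+2 | prime q) ln q%:R / (q%:R * (q%:R - 1)) <=
    2 - (ln n.+1%:R + 2) / n.+1%:R :> R.
  elim=> [|n IH].
    have l1 : ln 1%:R = 0 :> R := ln_1.
    rewrite big1 ?l1 => [|[[|[|//]] ?] //]; lra.
  rewrite big_mkcond big_ord_recr /= -big_mkcond /=.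
  have := @ln_sum_step n.+2 isT => /= h.
  have h0 : 0 <= ln n.+2%:R / (n.+2%:R * (n.+2%:R - 1)) :> R.
    rewrite divr_ge0 ?ln_nat_ge0 // mulr_ge0 // subr_ge0 ler1n //.
  apply: (@le_trans _ _ (\sum_(i < n.+2 | prime i) ln i%:R / (i%:R * (i%:R - 1)) +
    ln n.+2%:R / (n.+2%:R * (n.+2%:R - 1)))).
    by rewrite lerD2l; case: ifP.
  apply: le_trans (lerD IH h) _.
  by rewrite addrA subrK.
case: N => [|[|n]].
- by rewrite big_ord0.
- by rewrite big1 // => -[[|//] ?].
apply: le_trans (h n) _; by rewrite ?gerBl divr_ge0 // addr_ge0 // ln_nat_ge0.
Qed.

Lemma geometric_tail (q N : nat) : (1 < q)%N ->
  \sum_(k < N) (q%:R ^+ k.+2)^-1 <= (q%:R * (q%:R - 1))^-1 :> R.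
Proof.
move=> q1; have x1 : 1 < q%:R :> R by rewrite ltr1n.
move: (q%:R) x1 => x x1; have x0 : 0 < x by lra.
have xm : 0 < x - 1 by lra.
have -> : \sum_(k < N) (x ^+ k.+2)^-1 = (x * (x - 1))^-1 * (1 - (x ^+ N)^-1).
  elim: N => [|N IH]; first by rewrite big_ord0 expr0 invr1 subrr mulr0.
  rewrite big_ord_recr /= IH !exprS.
  have xn : x ^+ N != 0 by rewrite expf_neq0 // lt0r_neq0.
  move: (x ^+ N) xn (lt0r_neq0 x0) (lt0r_neq0 xm) => y *; field.
  by do ?[apply/andP; split].
by rewrite ler_piMr ?invr_ge0 ?mulr_ge0 ?(ltW x0) ?(ltW xm) // gerBl invr_ge0 exprn_ge0 // ltW.
Qed.

(** * Mertens' theorem for sequences with Euler products *)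

Lemma sum_pick N (v : nat) (F : nat -> R) :
  \sum_(n < N) (v == n)%N%:R * F n = if (v < N)%N then F v else 0.
Proof.
case: ltnP => vN.
  rewrite (bigD1 (Ordinal vN)) //= eqxx mul1r big1 ?addr0 // => n nv.
  case: eqP => E; last by rewrite mul0r.
  by case/negP: nv; apply/eqP/val_inj.
rewrite big1 // => n _; case: eqP => E; last by rewrite mul0r.
by have := ltn_ord n; rewrite -E ltnNge vN.
Qed.

Lemma cub_dilate (c m x : R) : c != 0 -> x != 0 -> cub (c * m)%R x = cub m (x / c)%R.
Proof.
move=> c0 x0; rewrite !cubE ?mulf_neq0 ?invr_neq0 //.
have E : c * m / x = m / (x / c) by field; rewrite x0 c0.
by rewrite E.
Qed.

Lemma le_cub (n x y : R) : 0 <= n -> 0 < x -> x <= y -> cub n x <= cub n y.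
Proof.
move=> n0 x0 xy; have y0 := lt_le_trans x0 xy.
rewrite !cubE ?lt0r_neq0 // lerXn2r ?nnegrE ?rpos_nneg //.
by apply: le_rpos; rewrite lerD2l lerN2 ler_wpM2l // lef_pV2.
Qed.

Lemma cub_ge0 (n x : R) : x != 0 -> 0 <= cub n x.
Proof. by move=> x0; rewrite cubE // exprn_ge0 // rpos_nneg. Qed.

Lemma cub_le1 (n x : R) : 0 <= n -> 0 < x -> cub n x <= 1.
Proof.
move=> n0 x0; rewrite cubE ?lt0r_neq0 //; apply: exprn_ile1; first exact: rpos_nneg.
by rewrite rposP ge_max ler01 gerBl divr_ge0 // ltW.
Qed.

Section Mertens.
Variables (M : nat) (t e a : nat -> R).
Hypothesis H : hecke_seq M t e a.

Let good q := prime q && coprime q M.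

Definition log_weight_at q k : R := (ln q%:R * tau t e q k.+1 / q%:R ^+ k.+1)%R.
Let W := log_weight_at.

(** The sum of log q tau(q^k) / q^k over prime powers up to N: a partial sum of
    the logarithmic derivative at 1. *)
Definition log_sum N : R :=
  \sum_(q < N | good q) \sum_(k < N) (q ^ k.+1 <= N)%N%:R * W q k.

(** The analogue for a of the convolution identity log = Lambda * 1. *)
Lemma ln_hecke N n : (n < N)%N ->
  a n * ln n%:R = \sum_(q < N | good q) \sum_(k < N) \sum_(m < N)
    (q ^ k.+1 * m == n)%N%:R * (ln q%:R * tau t e q k.+1 * a m).
Proof.
move=> nN; have [n0|n0] := posnP n.
  rewrite n0 (hecke0 H) mul0r big1 // => q /andP[pq _].
  rewrite big1 // => k _; rewrite big1 // => m _.
  rewrite muln_eq0 expn_eq0; case: eqP => [q0|_] /=; first by rewrite q0 in pq.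
  by case: eqP => [->|_]; rewrite ?(hecke0 H) ?mulr0 ?mul0r.
case cn: (coprime n M); last first.
  rewrite (hecke_ncop H) ?cn // mul0r big1 // => q /andP[pq qM].
  rewrite big1 // => k _; rewrite big1 // => m _.
  case: eqP => E; last by rewrite mul0r.
  rewrite (hecke_ncop H) ?mulr0 //; apply/negP => mM.
  by move: cn; rewrite -E coprimeMl mM coprimeXl.
have [_ /(_ nN) <-] := @ln_factor N n n0.
rewrite mulrC mulr_suml big_mkcondr /=; apply: eq_bigr => q pq.
case: ifP => qM; last first.
  rewrite [logn _ _](_ : _ = 0%N) ?mul0r //; apply/eqP.
  rewrite -leqn0 leqNgt logn_gt0 mem_primes pq n0 /=; apply/negP => /dvdnP[d nE].
  by move: cn; rewrite nE coprimeMl qM andbF.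
have nN' : (0 < n < N)%N by rewrite n0.
rewrite mulrAC (hecke_newton_sum H pq qM nN') mulrC mulr_sumr.
apply: eq_bigr => k _; rewrite mulr_sumr; apply: eq_bigr => m _.
by rewrite mulrCA !mulrA.
Qed.

Lemma T3_hecke N (x : R) : 0 < x -> x <= N%:R ->
  T3 a N x = \sum_(q < N | good q) \sum_(k < N) W q k * S3 a N (x / q%:R ^+ k.+1).
Proof.
move=> x0 xN.
transitivity (\sum_(n < N) \sum_(q < N | good q) \sum_(k < N) \sum_(m < N)
  (q ^ k.+1 * m == n)%N%:R * ((ln q%:R * tau t e q k.+1 * a m) * (cub n%:R x / n%:R))).
  apply: eq_bigr => n _; rewrite (ln_hecke (ltn_ord n)) -!mulrA [_^-1 * _]mulrC.
  rewrite mulr_suml; apply: eq_bigr => q _; rewrite mulr_suml; apply: eq_bigr => k _.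
  by rewrite mulr_suml; apply: eq_bigr => m _; rewrite !mulrA.
rewrite exchange_big /=; apply: eq_bigr => q /andP[pq _].
rewrite exchange_big /=; apply: eq_bigr => k _.
rewrite exchange_big /= mulr_sumr; apply: eq_bigr => m _.
have q0 : q%:R ^+ k.+1 != 0 :> R by rewrite expf_neq0 // pnatr_eq0 -lt0n prime_gt0.
have xn0 := lt0r_neq0 x0.
rewrite (@sum_pick N _ (fun n => ln q%:R * tau t e q k.+1 * a m * (cub n%:R x / n%:R))).
have [m0|m0] := posnP m; first by rewrite m0 (hecke0 H) !(mul0r, mulr0) if_same.
have m0' : m%:R != 0 :> R by rewrite pnatr_eq0 -lt0n.
rewrite natrM natrX -(cub_dilate m%:R q0 xn0) /W /log_weight_at.
case: ltnP => h; last first.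
  by rewrite cub0 ?mulr0 // -?natrX -?natrM; apply: le_trans xN _; rewrite ler_nat.
by field; rewrite q0 m0'.
Qed.

Lemma S3_small N (x : R) : 0 < x -> x <= 1 -> S3 a N x = 0.
Proof.
move=> x0 x1; apply: big1 => -[[|n] nN] _ /=; first by rewrite (hecke0 H) !mul0r.
by rewrite cub0 ?mulr0 // (le_trans x1) // ler1n.
Qed.

Section SmallMean.
Variable C : R.
Hypothesis C0 : 0 <= C.
Hypothesis aC : small_mean a C.
Hypothesis tau2 : forall q k, good q -> `|tau t e q k| <= 2.

(** T3 is a sum of values S3 (N / q^k). Replacing each by S3 N costs O(q^k / N)
    by S3_lip, and by Chebyshev's bound this adds up to O(1). *)
Lemma S3_log_sum N : (0 < N)%N -> `|S3 a N N%:R * log_sum N| <= 38 * C.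
Proof.
move=> N0; have N0' : 0 < N%:R :> R by rewrite ltr0n.
have N1 : 1 <= N%:R :> R by rewrite ler1n.
have hT := T3_bound (hecke0 H) C0 aC N1 (lexx _).
suff h : `|T3 a N N%:R - S3 a N N%:R * log_sum N| <= 24 * C.
  have := lerB_dist (S3 a N N%:R * log_sum N) (T3 a N N%:R).
  rewrite distrC => h'; lra.
rewrite T3_hecke // /log_sum mulr_sumr -sumrB.
have -> : 24 * C = 6 * C / N%:R * (4 * N%:R) by move: (lt0r_neq0 N0') => n0; field.
apply: (@le_trans _ _ (6 * C / N%:R * psi N N)); last first.
  by rewrite ler_wpM2l ?chebyshev // divr_ge0 ?mulr_ge0.
apply: le_trans (ler_norm_sum _ _ _) _.
rewrite /psi mulr_sumr [leRHS](bigID (fun q : 'I_N => coprime q M)) /=.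
rewrite -[leLHS]addr0; apply: lerD; last first.
  apply: sumr_ge0 => q _; rewrite mulr_ge0 ?divr_ge0 ?mulr_ge0 //.
  by apply: sumr_ge0 => k _; rewrite mulr_ge0 ?ln_nat_ge0.
apply: ler_sum => q gq; have /andP[pq _] := gq.
rewrite mulr_sumr -sumrB; apply: le_trans (ler_norm_sum _ _ _) _.
rewrite mulr_sumr; apply: ler_sum => k _.
have q0 : 0 < q%:R ^+ k.+1 :> R by rewrite exprn_gt0 // ltr0n prime_gt0.
have yx : N%:R / q%:R ^+ k.+1 <= N%:R :> R.
  by rewrite ler_pdivrMr // ler_peMr // -natrX ler1n expn_gt0 prime_gt0.
case: leqP => h; rewrite ?mul1r ?mul0r ?mulr0; last first.
  rewrite S3_small ?mulr0 ?subr0 ?normr0 // ?divr_gt0 //.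
  by rewrite ler_pdivrMr // mul1r -natrX ler_nat ltnW.
have y1 : 1 <= N%:R / q%:R ^+ k.+1 :> R by rewrite ler_pdivlMr // mul1r -natrX ler_nat.
have lip := S3_lip (hecke0 H) C0 aC y1 yx (lexx _).
rewrite [S3 a N N%:R * _]mulrC -mulrBr normrM distrC.
have hW : `|W q k| <= 2 * ln q%:R / q%:R ^+ k.+1.
  rewrite /W /log_weight_at normrM normfV (gtr0_norm q0) ler_pM2r ?invr_gt0 //.
  by rewrite normrM (ger0_norm (ln_nat_ge0 _)) mulrC ler_wpM2r ?ln_nat_ge0 // tau2.
apply: le_trans (ler_pM (normr_ge0 _) (normr_ge0 _) hW lip) _.
rewrite le_eqVlt; apply/orP; left; apply/eqP.
by move: (ln _) (lt0r_neq0 q0) (lt0r_neq0 N0') => l q1 n1; field; rewrite q1 n1.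
Qed.

Lemma log_sum_bounded (x0 del : R) : 0 < del ->
  (forall N (x : R), x0 <= x -> x <= N%:R -> del <= `|S3 a N x|) ->
  exists K : R, forall N : nat, (0 < N)%N -> x0 <= N%:R -> `|log_sum N| <= K.
Proof.
move=> d0 h; exists (38 * C / del) => N N0 xN.
have := S3_log_sum N0; rewrite normrM => h1.
rewrite ler_pdivlMr // mulrC; apply: le_trans h1.
by rewrite ler_wpM2r //; exact: h.
Qed.
End SmallMean.

Section LargeMean.
Variables (kap C' : R).
Hypothesis kap0 : 0 < kap.
Hypothesis a_ge0 : forall n, 0 <= a n.
Hypothesis tau_ge0 : forall q k, good q -> 0 <= tau t e q k.
Hypothesis aK : forall (N : nat) (y : R), 1 <= y -> y <= N%:R ->
  `|ksum a N y - kap * y ^+ 3| <= C' * y ^+ 2.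

Lemma W_ge0 q k : good q -> 0 <= W q k.
Proof.
move=> gq; rewrite /W /log_weight_at !mulr_ge0 ?ln_nat_ge0 ?tau_ge0 //.
by rewrite invr_ge0 exprn_ge0.
Qed.

Lemma T3_le N : (0 < N)%N -> T3 a N N%:R <= S3 a N N%:R * log_sum N.
Proof.
move=> N0; have N0' : 0 < N%:R :> R by rewrite ltr0n.
rewrite T3_hecke // /log_sum mulr_sumr; apply: ler_sum => q gq.
rewrite mulr_sumr; apply: ler_sum => k _; have /andP[pq _] := gq.
have q0 : 0 < q%:R ^+ k.+1 :> R by rewrite exprn_gt0 // ltr0n prime_gt0.
case: leqP => h; rewrite ?mul1r ?mul0r ?mulr0; last first.
  rewrite S3_small ?mulr0 // ?divr_gt0 //.
  by rewrite ler_pdivrMr // mul1r -natrX ler_nat ltnW.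
rewrite mulrC ler_wpM2r ?W_ge0 //; apply: ler_sum => n _.
rewrite ler_wpM2l ?divr_ge0 //; apply: le_cub; rewrite ?divr_gt0 //.
by rewrite ler_pdivrMr // ler_peMr // -natrX ler1n expn_gt0 prime_gt0.
Qed.

(** The main term kap y^3 contributes the integral of 3 kap / y. *)
Lemma S3_lower N (x : R) : 1 <= x -> x <= N%:R -> 3 * kap * ln x - 3 * C' <= S3 a N x.
Proof.
move=> x1 xN; have C'0 : 0 <= C'.
  have N1 := le_trans x1 xN; have := le_trans (normr_ge0 _) (aK (lexx 1) N1).
  by rewrite expr1n mulr1.
pose E (y : R) := ksum a N y * inv4 y - kap * inv1 y.
have c1 : contp (fun y => ksum a N y * inv4 y).
  by apply: contp_mulr; [exact: contp_ksum|exact: contp_inv4].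
have c2 (c : R) : contp (fun y => c * inv1 y).
  by apply: contp_mulr; [exact: contp_constr|exact: contp_inv1].
have c3 : contp (fun y => C' * inv2 y).
  by apply: contp_mulr; [exact: contp_constr|exact: contp_inv2].
have EE : E = fun y => ksum a N y * inv4 y + (- kap) * inv1 y.
  by apply/funext => y; rewrite /E mulNr.
have cE : contp E by rewrite EE; apply: contp_addr.
have iE : Int E 1 x = Int (fun y => ksum a N y * inv4 y) 1 x - kap * ln x.
  rewrite EE IntD // IntZ //; last exact: contp_inv1.
  move/RleP: (x1) => x1'; rewrite {2}/Int RInt_inv //; last by apply: Rlt_0_1.
  by rewrite ln_1 RminusE subr0 mulNr.
have : `|Int E 1 x| <= Int (fun y => C' * inv2 y) 1 x.
  apply: Int_abs => // y /andP[y1 yx]; have y0 : 0 < y by exact: lt_le_trans y1.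
  have yn := lt0r_neq0 y0.
  have -> : E y = (ksum a N y - kap * y ^+ 3) * y^-1 ^+ 4.
    by rewrite /E inv4E inv1E; move: (ksum a N y) => s; field.
  have p4 : 0 <= y^-1 ^+ 4 by rewrite exprn_ge0 // invr_ge0 ltW.
  rewrite normrM (ger0_norm p4) inv2E.
  have -> : C' * y^-1 ^+ 2 = C' * y ^+ 2 * y^-1 ^+ 4 by field.
  by rewrite ler_wpM2r // aK // (le_trans yx).
rewrite IntZ //; last exact: contp_inv2.
have h := Int_inv2_le ltr01 x1; rewrite invr1 in h.
have {}h : C' * Int inv2 1 x <= C' by rewrite -[leRHS]mulr1 ler_wpM2l.
rewrite iE ler_norml (S3_Int N (hecke0 H) x1) => /andP[h1 _]; lra.
Qed.

(** The terms with n >= n0 have logarithm at least ln n0. *)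
Lemma T3_lower N n0 : (0 < n0)%N -> (n0 <= N)%N ->
  ln n0%:R * (S3 a N N%:R - \sum_(n < n0) a n / n%:R) <= T3 a N N%:R.
Proof.
move=> n0p nN.
have N0 : 0 < N%:R :> R by rewrite ltr0n (leq_trans n0p).
have l0 := ln_nat_ge0 n0.
apply: (@le_trans _ _ (ln n0%:R * \sum_(n < N | (n0 <= n)%N) a n / n%:R * cub n%:R N%:R)).
  rewrite ler_wpM2l // /S3 (bigID (fun n : 'I_N => (n0 <= n)%N)) /= -addrA gerDl subr_le0.
  rewrite (big_ord_widen N (fun n => a n / n%:R) nN).
  under [leRHS]eq_bigl => n do rewrite ltnNge.
  by apply: ler_sum => n _; rewrite ler_piMr ?divr_ge0 // cub_le1.
rewrite mulr_sumr /T3 [leRHS](bigID (fun n : 'I_N => (n0 <= n)%N)) /= -[leLHS]addr0.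
apply: lerD; last first.
  apply: sumr_ge0 => n _; rewrite mulr_ge0 ?cub_ge0 ?lt0r_neq0 //.
  by rewrite divr_ge0 // mulr_ge0 ?ln_nat_ge0.
apply: ler_sum => n n0n.
have -> : a n * ln n%:R / n%:R * cub n%:R N%:R = ln n%:R * (a n / n%:R * cub n%:R N%:R).
  by rewrite -!mulrA mulrCA.
have c0 : 0 <= cub n%:R N%:R by rewrite cub_ge0 // lt0r_neq0.
have p0 : 0 <= a n / n%:R * cub n%:R N%:R by apply: mulr_ge0 c0; rewrite divr_ge0.
rewrite ler_wpM2r //.
by apply: le_ln; rewrite ?ltr0n // ler_nat.
Qed.

Lemma ln_unbounded (L : R) : exists n : nat, (0 < n)%N /\ L < ln n%:R.
Proof.
have [n hn] := big_nat_above (exp L).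
have e0 : 0 < exp L by apply/RltP; exact: exp_pos.
exists n; split; first by rewrite -(ltr0n R); exact: lt_trans hn.
by rewrite -[ltLHS]Rpower.ln_exp; apply/RltP; apply: ln_increasing; apply/RltP.
Qed.

(** T3 outgrows every multiple of S3, as S3 is unbounded, but it is at most
    S3 times the sum in question. *)
Lemma log_sum_unbounded (L x0 : R) : exists N : nat,
  [/\ (0 < N)%N, x0 <= N%:R & L < log_sum N].
Proof.
have [n0 [n0p hn0]] := ln_unbounded (2 * (`|L| + 1))%R.
pose c := \sum_(n < n0) a n / n%:R.
have [n1 [n1p hn1]] := ln_unbounded ((3 * C' + `|2 * c| + 1) / (3 * kap))%R.
have [n2 hn2] := big_nat_above x0.
pose N := maxn n0 (maxn n1 n2); exists N.
have n0N : (n0 <= N)%N by rewrite leq_maxl.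
have n1N : (n1 <= N)%N by rewrite /N maxnCA leq_maxl.
have n2N : (n2 <= N)%N by rewrite /N maxnA leq_maxr.
have N0 : (0 < N)%N by exact: leq_trans n0N.
split=> //; first by apply: le_trans (ltW hn2) _; rewrite ler_nat.
have N1 : 1 <= N%:R :> R by rewrite ler1n.
have h1 := S3_lower N1 (lexx _); have h2 := T3_lower n0p n0N; have h3 := T3_le N0.
have hl : ln n1%:R <= ln N%:R by apply: le_ln; rewrite ?ltr0n ?ler_nat.
have k3 : 0 < 3 * kap by rewrite mulr_gt0.
move: hn1; rewrite ltr_pdivrMr // => hn1.
have h4 : ln n1%:R * (3 * kap) <= ln N%:R * (3 * kap) by rewrite ler_pM2r.
have hc := ler_norm (2 * c).
have hS : 2 * c + 1 <= S3 a N N%:R by lra.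
have hS0 : 0 < S3 a N N%:R.
  have := ler_norm (- (2 * c)); rewrite normrN => ?; lra.
have h5 := le_trans h2 h3; rewrite -/c in h5.
have h6 : S3 a N N%:R < 2 * (S3 a N N%:R - c) by lra.
have L1 : 0 <= `|L| by [].
have LL := ler_norm L.
rewrite -(ltr_pM2l hS0); apply: lt_le_trans h5.
move: (S3 _ _ _) (ln n0%:R) (`|L|) hS0 h6 hn0 L1 LL => S l nL hS0 h6 hn0 L1 LL.
have h7 : 2 * (nL + 1) * (S - c) < l * (S - c) by rewrite ltr_pM2r //; lra.
apply: le_lt_trans h7.
have h8 : (nL + 1) * S <= (nL + 1) * (2 * (S - c)).
  by rewrite ler_wpM2l ?(ltW h6) // addr_ge0.
have h9 : S * L <= S * (nL + 1) by rewrite ler_pM2l //; lra.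
lra.
Qed.
End LargeMean.
End Mertens.

(** * Primes in the classes of an abstract class group *)

Lemma cosine_exp (gT : finGroupType) (phi : gT -> R) x k : cosine phi ->
  power_sum (2 * phi x)%R 1%R k = 2 * phi (x ^+ k)%g.
Proof.
move=> [phi1 phiM]; suff [] : power_sum (2 * phi x)%R 1%R k = 2 * phi (x ^+ k)%g /\
  power_sum (2 * phi x)%R 1%R k.+1 = 2 * phi (x ^+ k.+1)%g by [].
elim: k => [|k [IH1 IH2]].
  by rewrite power_sum0 power_sum1 expg0 expg1 phi1 mulr1.
split=> //; rewrite power_sumSS IH1 IH2.
have := phiM (x ^+ k.+1)%g x; rewrite -expgSr [in X in _ + X](expgSr x k) mulgK => E.
by rewrite mul1r -[phi (x ^+ k.+2)%g](addrK (phi (x ^+ k)%g)) E; ring.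
Qed.

Lemma power_sum_inert k : power_sum 0%R (- 1)%R k = if odd k then 0 else 2.
Proof.
suff [] : power_sum 0%R (- 1)%R k = (if odd k then 0 else 2) /\
  power_sum 0%R (- 1)%R k.+1 = (if odd k.+1 then 0 else 2) by [].
elim: k => [|k [IH1 IH2]]; first by rewrite power_sum0 power_sum1.
split=> //; rewrite power_sumSS IH1 IH2 /=; case: (odd k) => /=; ring.
Qed.

Lemma const1_cosine (gT : finGroupType) : cosine (fun _ : gT => 1 : R).
Proof. by split=> // x y; rewrite !mulr1. Qed.

Section PrimeTheorem.
Variables (gT : finGroupType) (r : gT -> nat -> R) (M : nat) (w kap K : R).
Variable Q : nat -> option gT.
Hypothesis ab : abelian [set: gT].
Hypothesis M1 : (1 < M)%N.
Hypothesis w0 : 0 < w.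
Hypothesis kap0 : 0 < kap.
Hypothesis r_ge0 : forall C n, 0 <= r C n.
Hypothesis r1 : forall C, r C 1 = if C == 1%g then w else 0.
Hypothesis rM : forall q, prime q -> coprime q M -> forall C n,
  r C (n * q)%N + (if Q q is Some _ then 1 else -1) *
     (if (q %| n)%N then r C (n %/ q)%N else 0) =
  if Q q is Some x then r (C * x)%g n + r (C * x^-1)%g n else 0.
Hypothesis r_mean : forall C N (y : R), 1 <= y -> y <= N%:R ->
  `|\sum_(n < N) (coprime n M)%:R * r C n * kern n%:R y - kap * y ^+ 3| <= K * y ^+ 2.

(** Coefficients of the L-function of the class character with real part phi;
    dividing by w makes the first one 1. *)
Definition twist (phi : gT -> R) n : R :=
  ((coprime n M)%:R * (w^-1 * \sum_C phi C * r C n))%R.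

Definition tr (phi : gT -> R) q : R := (if Q q is Some x then 2 * phi x else 0)%R.
Definition nm (q : nat) : R := (if Q q is Some _ then 1 else - 1)%R.

(** By d'Alembert's equation, translating the classes by x and by x^-1
    multiplies the phi-twisted sum by 2 phi x. *)
Lemma twist_hecke phi : cosine phi -> hecke_seq M (tr phi) nm (twist phi).
Proof.
move=> cphi; have [phi1 phiM] := cphi; have wn := lt0r_neq0 w0; split.
- rewrite /twist (_ : coprime 0 M = false) ?mul0r // /coprime gcd0n; by case: eqP M1 => [->|].
- rewrite /twist coprime1n mul1r (bigD1 1%g) //= r1 eqxx phi1 mul1r.
  rewrite big1 ?addr0 ?mulVf // => C C1; by rewrite r1 (negPf C1) mulr0.
- by move=> n nM; rewrite /twist (negPf nM) mul0r.
move=> q n pq qM n0; rewrite /twist coprimeMl qM andbT.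
have E : \sum_C phi C * r C (n * q)%N = tr phi q * (\sum_C phi C * r C n) -
    nm q * (if (q %| n)%N then \sum_C phi C * r C (n %/ q)%N else 0).
  have -> : (if (q %| n)%N then \sum_C phi C * r C (n %/ q)%N else 0) =
     \sum_C phi C * (if (q %| n)%N then r C (n %/ q)%N else 0).
    by case: ifP => // _; rewrite big1 // => C _; rewrite mulr0.
  apply/eqP; rewrite eq_sym subr_eq eq_sym mulr_sumr -big_split /=; apply/eqP.
  rewrite (eq_bigr (fun C => phi C *
    (if Q q is Some x then r (C * x)%g n + r (C * x^-1)%g n else 0))); last first.
    by move=> C _; rewrite -(rM pq qM) /nm; case: (Q q) => [x|]; ring.
  rewrite /tr; case: (Q q) => [x|]; last first.
    by rewrite mul0r big1 // => C _; rewrite mulr0.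
  under eq_bigr => C _ do rewrite mulrDr.
  rewrite big_split /= (reindex_inj (mulIg x^-1%g)) /=.
  rewrite [X in _ + X](reindex_inj (mulIg x)) /= -big_split /= mulr_sumr.
  apply: eq_bigr => C _; rewrite mulgVK mulgK -mulrDl addrC phiM; ring.
rewrite E; case: (boolP (q %| n)%N) => qn; last by ring.
have -> : coprime (n %/ q) M = coprime n M.
  by rewrite -{2}(divnK qn) coprimeMl qM andbT.
by ring.
Qed.

Lemma tau_twist phi q k : cosine phi -> tau (tr phi) nm q k =
  if Q q is Some x then 2 * phi (x ^+ k)%g else if odd k then 0 else 2.
Proof.
move=> cphi; rewrite /tau /tr /nm; case: (Q q) => [x|]; first exact: cosine_exp.
exact: power_sum_inert.
Qed.

Lemma tau_twist_bound phi q k : cosine phi -> `|tau (tr phi) nm q k| <= 2.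
Proof.
move=> cphi; rewrite tau_twist //; case: (Q q) => [x|].
  have := cosine_bound (x ^+ k)%g cphi => h.
  by rewrite normrM ger0_norm // -[leRHS]mulr1 ler_pM2l.
by case: odd; rewrite ?normr0 ?ger0_norm.
Qed.

Let one : gT -> R := fun=> 1.
Let cone : cosine one := const1_cosine gT.

Lemma ksum_twist phi N (y : R) :
  ksum (twist phi) N y =
  w^-1 * \sum_C phi C * \sum_(n < N) (coprime n M)%:R * r C n * kern n%:R y.
Proof.
rewrite mulr_sumr /ksum; under [RHS]eq_bigr => C _ do rewrite mulrA mulr_sumr.
rewrite exchange_big /=; apply: eq_bigr => n _.
rewrite /twist mulrA mulr_sumr mulr_suml; apply: eq_bigr => C _; ring.
Qed.

Lemma twist_mean phi : cosine phi ->
  forall N (y : R), 1 <= y -> y <= N%:R ->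
  `|ksum (twist phi) N y - (w^-1 * kap * \sum_C phi C) * y ^+ 3| <=
  (w^-1 * #|gT|%:R * K) * y ^+ 2.
Proof.
move=> cphi N y y1 yN; rewrite ksum_twist.
have -> : w^-1 * kap * (\sum_C phi C) * y ^+ 3 =
   w^-1 * \sum_C phi C * (kap * y ^+ 3) by rewrite -mulr_suml; ring.
rewrite -mulrBr -sumrB normrM gtr0_norm ?invr_gt0 // -!mulrA ler_pM2l ?invr_gt0 //.
apply: le_trans (ler_norm_sum _ _ _) _; rewrite mulr_natl -sumr_const.
apply: ler_sum => C _; rewrite -mulrBr normrM -[leRHS]mul1r.
by apply: ler_pM => //; [exact: cosine_bound|exact: r_mean].
Qed.

Lemma gT_gt0 : 0 < #|gT|%:R :> R.
Proof. by rewrite ltr0n -cardsT cardG_gt0. Qed.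

Lemma K_ge0 : 0 <= K.
Proof.
have := le_trans (normr_ge0 _) (r_mean 1%g (lexx 1) (lexx 1%:R)).
by rewrite expr1n mulr1.
Qed.

(** The mean value of a nontrivial phi cancels the main terms of the classes. *)
Lemma twist_bounded phi : cosine phi -> \sum_x phi x = 0 ->
  exists x0 B : R, forall N : nat, (0 < N)%N -> x0 <= N%:R ->
  `|log_sum M (tr phi) nm N| <= B.
Proof.
move=> cphi phi0; have Ha := twist_hecke cphi; have Hb := twist_hecke cone.
pose CC := w^-1 * #|gT|%:R * K.
have wi : 0 < w^-1 by rewrite invr_gt0.
have C0 : 0 <= CC by rewrite /CC !mulr_ge0 ?K_ge0 ?(ltW wi).
have small : small_mean (twist phi) CC.
  move=> N y y1 yN; have := twist_mean cphi y1 yN.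
  by rewrite phi0 mulr0 mul0r subr0.
have k0 : 0 <= w^-1 * kap * \sum_C one C.
  by rewrite !mulr_ge0 ?(ltW wi) ?(ltW kap0) ?sumr_ge0.
have p_ge0 q k : prime q -> coprime q M ->
    0 <= tau (tr phi) nm q k + tau (tr one) nm q k.
  move=> _ _; rewrite !tau_twist //; case: (Q q) => [x|].
    have := cosine_bound (x ^+ k)%g cphi; rewrite ler_norml => /andP[h _].
    by rewrite /one; lra.
  by case: odd; lra.
have p_two q : prime q -> coprime q M ->
    2 <= (tau (tr phi) nm q 1 + tau (tr one) nm q 1) ^+ 2 +
     (tau (tr phi) nm q 2 + tau (tr one) nm q 2).
  move=> _ _; rewrite !tau_twist // /one; case: (Q q) => [x|] /=; last by lra.
  rewrite expg1; have [phi1 phiM] := cphi; have := phiM x x.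
  rewrite mulgV phi1 -expg2 => E.
  have -> : phi (x ^+ 2)%g = 2 * phi x * phi x - 1 by rewrite -E addrK.
  move: (phi x) => s; have := sqr_ge0 (s + 2^-1); rewrite !expr2 => h; lra.
have [x0 [del [x01 del0 h]]] := S3_nonvanishing (ltnW M1) Ha Hb p_ge0 p_two C0
  (mulr_ge0 (mulr_ge0 (ltW wi) (ler0n _ _)) K_ge0) k0 small (twist_mean cone).
have [B hB] := log_sum_bounded Ha C0 small
  (fun q k _ => tau_twist_bound q k cphi) del0 h.
by exists x0, B.
Qed.

Lemma trivial_unbounded (L x0 : R) : exists N : nat,
  [/\ (0 < N)%N, x0 <= N%:R & L < log_sum M (tr one) nm N].
Proof.
have k0 : 0 < w^-1 * kap * \sum_C one C.
  by rewrite !mulr_gt0 ?invr_gt0 // sumr_const gT_gt0.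
apply: (log_sum_unbounded (twist_hecke cone) k0 _ _ (twist_mean cone)).
  move=> n; rewrite /twist !mulr_ge0 ?invr_ge0 ?(ltW w0) //.
  by apply: sumr_ge0 => C _; rewrite mulr_ge0.
move=> q k _; rewrite tau_twist // /one; case: (Q q) => [x|]; last by case: odd.
by rewrite mulr1.
Qed.

(** Only trivial cosines contribute an unbounded term, and the average of phi
    over the group is 1 for those and 0 for the others. *)
Lemma combination_bounded (s : seq (R * (gT -> R))) :
  (forall t, List.In t s -> cosine t.2) ->
  exists x0 B : R, forall N : nat, (0 < N)%N -> x0 <= N%:R ->
   `|\sum_(t <- s) t.1 * log_sum M (tr t.2) nm N -
     (\sum_(t <- s) t.1 * ((\sum_x t.2 x) / #|gT|%:R)) * log_sum M (tr one) nm N| <= B.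
Proof.
elim: s => [|t s IH] hs.
  by exists 0, 0 => N _ _; rewrite !big_nil mul0r subrr normr0.
have [|x0 [B h]] := IH; first by move=> u us; apply: hs; right.
have ct : cosine t.2 by apply: hs; left.
have [t1|t0] := cosine_sum ct.
  exists x0, B => N N0 xN; have := h N N0 xN; rewrite !big_cons.
  have -> : t.2 = one by apply/funext => x; rewrite t1.
  rewrite sumr_const divff ?lt0r_neq0 ?gT_gt0 // mulr1 mulrDl opprD addrACA subrr.
  by rewrite add0r.
have [x1 [B1 h1]] := twist_bounded ct t0.
exists (Num.max x0 x1), (`|t.1| * B1 + B) => N N0; rewrite ge_max => /andP[xN xN1].
rewrite !big_cons t0 mul0r mulr0 add0r -addrA.
apply: le_trans (ler_normD _ _) _; apply: lerD; last exact: h.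
by rewrite normrM ler_wpM2l // h1.
Qed.

(** Otherwise the combination of the sums log_sum that isolates the primes of
    the classes A and A^-1 would be bounded, while the trivial cosine occurs in
    it with the positive weight 2 / #|gT|. *)
Theorem primes_in_classes (A : gT) (B : nat) : exists q : nat,
  [/\ prime q, (B < q)%N, coprime q M & 0 < r A q].
Proof.
have [s [sP sE]] := even_delta_cosines R ab A.
suff [q [pq Bq qM Qq]] : exists q, [/\ prime q, (B < q)%N, coprime q M &
    if Q q is Some x then (x == A) || (x == A^-1)%g else false].
  exists q; split=> //; move: (rM pq qM A 1); rewrite mul1n.
  have -> : (q %| 1)%N = false by apply/negP; rewrite dvdn1 => /eqP q1; rewrite q1 in pq.
  rewrite mulr0 addr0; case: (Q q) Qq => // x /orP[]/eqP -> ->; rewrite !r1 ?mulgV ?invgK eqxx.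
    by apply: lt_le_trans w0 _; rewrite lerDr; case: ifP => // _; exact: ltW.
  by apply: lt_le_trans w0 _; rewrite lerDl; case: ifP => // _; exact: ltW.
apply: contrapT => none.
pose c0 : R := \sum_(t <- s) t.1 * ((\sum_x t.2 x) / #|gT|%:R).
have c0E : c0 = 2 / #|gT|%:R.
  rewrite /c0; under eq_bigr => t _ do rewrite mulrA.
  rewrite -mulr_suml; congr (_ / _).
  under eq_bigr => t _ do rewrite mulr_sumr.
  rewrite exchange_big /=; under eq_bigr => x _ do rewrite -sE.
  have d1 (z : gT) : \sum_x (x == z)%:R = 1 :> R.
    rewrite (bigD1 z) //= eqxx big1 ?addr0 // => x /negPf ->.
    by [].
  by rewrite big_split /= !d1.
have c0p : 0 < c0 by rewrite c0E divr_gt0 ?gT_gt0.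
have [x0 [B1 h1]] := combination_bounded sP.
pose g q k : R := \sum_(t <- s) t.1 * tau (tr t.2) nm q k.
pose S : R := \sum_(t <- s) `|t.1| * 2.
have S0 : 0 <= S by apply: sumr_ge0 => t _; rewrite mulr_ge0.
have sumP (F G : R * (gT -> R) -> R) : (forall t, cosine t.2 -> F t = G t) ->
    \sum_(t <- s) F t = \sum_(t <- s) G t.
  move=> FG; elim: (s) sP => [|t s' IH] hs; first by rewrite !big_nil.
  rewrite !big_cons; congr (_ + _); first by apply: FG; apply: hs; left.
  by apply: IH => u us; apply: hs; right.
have leP' (F G : R * (gT -> R) -> R) : (forall t, cosine t.2 -> F t <= G t) ->
    \sum_(t <- s) F t <= \sum_(t <- s) G t.
  move=> FG; elim: (s) sP => [|t s' IH] hs; first by rewrite !big_nil.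
  rewrite !big_cons; apply: lerD; first by apply: FG; apply: hs; left.
  by apply: IH => u us; apply: hs; right.
have gS q k : `|g q k| <= S.
  apply: le_trans (ler_norm_sum _ _ _) _; apply: leP' => t ct.
  by rewrite normrM ler_wpM2l // tau_twist_bound.
have g1 q : prime q -> coprime q M -> (B < q)%N -> g q 1 = 0.
  move=> pq qM Bq.
  rewrite /g (sumP _ (fun t => t.1 * (if Q q is Some x then 2 * t.2 x else 0)));
    last by move=> t ct; rewrite tau_twist // expg1.
  case Qq: (Q q) => [x|]; last by rewrite big1 // => t _; rewrite mulr0.
  under eq_bigr => t _ do rewrite mulrCA.
  rewrite -mulr_sumr -sE; case: eqP => [xA|_]; first by case: none; exists q; rewrite Qq xA eqxx.
  case: eqP => [xA|_]; first by case: none; exists q; rewrite Qq xA eqxx orbT.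
  by rewrite addr0 mulr0.
pose K0 : R := \sum_(q < B.+1) ln q%:R.
have perq N n (q : nat) : prime q -> coprime q M ->
    `|\sum_(k < n.+1) (q ^ k.+1 <= N)%N%:R * (ln q%:R / q%:R ^+ k.+1 * g q k.+1)| <=
    (q <= B)%N%:R * (S * ln q%:R) + S * (ln q%:R / (q%:R * (q%:R - 1))).
  move=> pq qM; have l0 := ln_nat_ge0 q.
  have q0 : 0 < q%:R :> R by rewrite ltr0n prime_gt0.
  apply: le_trans (ler_norm_sum _ _ _) _.
  apply: (@le_trans _ _ (\sum_(k < n.+1) ln q%:R / q%:R ^+ k.+1 * `|g q k.+1|)).
    apply: ler_sum => k _; have p0 : 0 <= ln q%:R / q%:R ^+ k.+1 :> R.
      by rewrite divr_ge0 // exprn_ge0 // ltW.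
    rewrite 2!normrM (ger0_norm p0).
    by case: (_ <= _)%N; rewrite ?normr1 ?mul1r // normr0 mul0r mulr_ge0.
  rewrite big_ord_recl /=; apply: lerD.
    rewrite expr1; case: leqP => qB; last by rewrite g1 // normr0 mulr0 mul0r.
    rewrite mul1r mulrC; apply: ler_pM => //; first by rewrite divr_ge0 // ltW.
    by rewrite ler_pdivrMr // ler_peMr // ler1n prime_gt0.
  apply: (@le_trans _ _ (\sum_(k < n) S * ln q%:R * (q%:R ^+ k.+2)^-1)).
    apply: ler_sum => k _; rewrite /bump /= add1n [S * _]mulrC [leRHS]mulrAC.
    by rewrite ler_wpM2l // divr_ge0 // exprn_ge0 // ltW.
  rewrite -mulr_sumr -mulrA; apply: ler_wpM2l => //; apply: ler_wpM2l => //.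
  exact: geometric_tail (prime_gt1 pq).
have bound N : `|\sum_(t <- s) t.1 * log_sum M (tr t.2) nm N| <= S * K0 + S * 2.
  have -> : \sum_(t <- s) t.1 * log_sum M (tr t.2) nm N =
      \sum_(q < N | prime q && coprime q M) \sum_(k < N)
        (q ^ k.+1 <= N)%N%:R * (ln q%:R / q%:R ^+ k.+1 * g q k.+1).
    under eq_bigr => t _ do rewrite /log_sum mulr_sumr.
    rewrite exchange_big /=; apply: eq_bigr => q _.
    under eq_bigr => t _ do rewrite mulr_sumr.
    rewrite exchange_big /=; apply: eq_bigr => k _.
    rewrite /g !mulr_sumr; apply: eq_bigr => t _; rewrite /log_weight_at; ring.
  apply: le_trans (ler_norm_sum _ _ _) _.
  apply: (@le_trans _ _ (\sum_(q < N | prime q && coprime q M)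
     ((q <= B)%N%:R * (S * ln q%:R) + S * (ln q%:R / (q%:R * (q%:R - 1)))))).
    apply: ler_sum => q /andP[pq qM]; have := leq_ltn_trans (leq0n q) (ltn_ord q).
    by move=> N0; have := perq N N.-1 q pq qM; rewrite prednK.
  have sub (F : nat -> R) : (forall q, 0 <= F q) ->
      \sum_(q < N | prime q && coprime q M) F q <= \sum_(q < N | prime q) F q.
    move=> F0; rewrite big_mkcondr /=; apply: ler_sum => q _.
    by case: ifP.
  rewrite big_split /= -mulr_sumr; apply: lerD; last first.
    rewrite ler_wpM2l //; apply: le_trans (ln_sum_bound N).
    apply: (sub (fun q => ln q%:R / (q%:R * (q%:R - 1)))) => -[|q].
      by rewrite mul0r invr0 mulr0.
    by rewrite divr_ge0 ?ln_nat_ge0 // mulr_ge0 // subr_ge0 ler1n.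
  under eq_bigr => q _ do rewrite mulrCA.
  rewrite -mulr_sumr ler_wpM2l //.
  have F0 q : 0 <= (q <= B)%N%:R * ln q%:R :> R by rewrite mulr_ge0 ?ln_nat_ge0.
  apply: le_trans (sub _ F0) _; apply: (@le_trans _ _ (\sum_(q < N) (q <= B)%N%:R * ln q%:R)).
    by rewrite big_mkcond; apply: ler_sum => q _; case: ifP.
  pose N' := maxn N B.+1.
  apply: (@le_trans _ _ (\sum_(q < N') (q <= B)%N%:R * ln q%:R)).
    rewrite (big_ord_widen N' (fun q => (q <= B)%N%:R * ln q%:R : R) (leq_maxl _ _)) big_mkcond.
    by apply: ler_sum => q _; case: ifP.
  rewrite /K0 (big_ord_widen N' (fun q => ln q%:R : R) (leq_maxr _ _)) [leRHS]big_mkcond.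
  by apply: ler_sum => q _; rewrite ltnS; case: ifP; rewrite ?mul1r ?mul0r.
pose L : R := ((S * K0 + S * 2 + B1) / c0)%R.
have [N [N0 xN hN]] := trivial_unbounded L x0.
move: hN; rewrite /L ltr_pdivrMr // => hN.
have := h1 N N0 xN; rewrite -/c0 => h2.
have h3 := bound N.
have := lerB_dist (c0 * log_sum M (tr one) nm N) (\sum_(t <- s) t.1 * log_sum M (tr t.2) nm N).
rewrite distrC => h4; have h5 := ler_norm (c0 * log_sum M (tr one) nm N).
rewrite mulrC in hN; lra.
Qed.
End PrimeTheorem.

(** * Sums over arithmetic progressions *)

Section Grid.
Variables (H H' : R -> R) (m : nat) (A B : R).
Hypothesis PH : profile H H' m A B.

(** The midpoint rule on the cells around the points of the progression, which
    together cover the support. *)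
Lemma profile_grid (q delta L U u0 : R) n :
  0 <= q -> 0 < delta -> 0 <= L -> (forall k, (k < n)%N -> `|u0 + L * k%:R| <= U) ->
  q <= sqrt delta * (u0 + L * n%:R - L / 2) -> sqrt delta * (u0 - L / 2) <= - q ->
  `|L * \sum_(k < n) H (q ^+ 2 - delta * (u0 + L * k%:R) ^+ 2)%R -
     mass H * q ^+ (m + 5) / sqrt delta| <=
  n%:R * (2 * (B * q ^+ (m + 2) * delta + A * q ^+ m * delta ^+ 2 * (2 * U + L / 2) ^+ 2) *
     (L / 2) ^+ 3).
Proof.
move=> q0 d0 L0 hU hV hW.
pose phi (t : R) := H (q ^+ 2 - delta * t ^+ 2)%R.
have phiE : phi = fun t => H (Rminus (pow q 2) (Rmult delta (pow t 2))).
  by apply/funext => t; rewrite /phi !RpowE.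
have cphi : contR phi by rewrite phiE; exact: contR_profile PH _ _.
have iE : RInt phi (u0 - L / 2)%R (u0 + L * n%:R - L / 2)%R =
    mass H * q ^+ (m + 5) / sqrt delta.
  have := @profile_integral _ _ _ _ _ PH q delta (u0 - L / 2)%R (u0 + L * n%:R - L / 2)%R.
  rewrite -phiE RdivE RpowE; apply; first [exact/RleP|exact/RltP].
rewrite -iE; set E := 2 * _ * _.
suff : `|RInt phi (u0 - L / 2)%R (u0 + L * n%:R - L / 2)%R - L * \sum_(k < n) phi (u0 + L * k%:R)%R|
    <= n%:R * E by rewrite distrC.
clear hV iE; elim: n hU => [|n IH] hU.
  rewrite big_ord0 !mulr0 addr0 subr0 mul0r RInt_point.
  by rewrite (_ : zero = 0 :> R) // normr0.
rewrite big_ord_recr /=.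
have -> : RInt phi (u0 - L / 2)%R (u0 + L * n.+1%:R - L / 2)%R =
  RInt phi (u0 - L / 2)%R (u0 + L * n%:R - L / 2)%R +
  RInt phi (u0 + L * n%:R - L / 2)%R (u0 + L * n.+1%:R - L / 2)%R.
  by rewrite -(@RInt_join phi _ (u0 + L * n%:R - L / 2)%R).
rewrite mulrDr opprD addrACA; apply: le_trans (ler_normD _ _) _.
have -> : n.+1%:R * E = n%:R * E + E by rewrite -natr1 mulrDl mul1r.
apply: lerD; first by apply: IH => k kn; apply: hU; exact: ltnW.
have h0 : 0 <= L / 2 by rewrite divr_ge0.
have cell u h : 0 <= h -> `|u| <= U -> `|RInt phi (u - h)%R (u + h)%R - 2 * h * phi u| <=
    2 * (B * q ^+ (m + 2) * delta + A * q ^+ m * delta ^+ 2 * (2 * U + h) ^+ 2) * h ^+ 3.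
  move=> /RleP h00 uU; move/RleP: q0 => q0'; move/RltP: d0 => /Rlt_le d0'.
  have uU' : Rle (Rabs u) U by apply/RleP; rewrite RabsE.
  have /RleP := @profile_cell _ _ _ _ _ PH q delta u h U q0' d0' h00 uU'.
  by rewrite RabsE phiE !RpowE IZRE.
have := cell _ _ h0 (hU n (ltnSn n)).
have -> : u0 + L * n%:R + L / 2 = u0 + L * n.+1%:R - L / 2 by rewrite -natr1; field.
have -> : 2 * (L / 2) * phi (u0 + L * n%:R)%R = L * phi (u0 + L * n%:R)%R by field.
by [].
Qed.
End Grid.

Lemma sqr_posE z : sqr_pos z = rpos z ^+ 2.
Proof. by rewrite /sqr_pos RpowE. Qed.

Lemma root5_posE z : root5_pos z = sqrt (rpos z) ^+ 5.
Proof. by rewrite /root5_pos RpowE. Qed.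

Lemma sqrt_rpos_sqr z : sqrt (rpos z) ^+ 2 = rpos z.
Proof. by rewrite -RpowE pow2_sqrt //; apply/RleP; exact: rpos_nneg. Qed.

Lemma sqrt_nneg z : 0 <= sqrt z.
Proof. by apply/RleP; exact: sqrt_pos. Qed.

(** * Sums of a truncated square over cosets in the plane *)

Section Coset.
Variables (a M nb : nat) (b c : R).
Hypothesis a0 : (0 < a)%N.
Hypothesis M0 : (0 < M)%N.
Hypothesis bnb : `|b| <= nb%:R.

Let delta : R := (4 * a%:R * c - b ^+ 2)%R.
Hypothesis delta1 : 1 <= delta.

(** For T <= s^2, the box |x| <= M radius_x s, |y| <= M radius_y s contains the
    ellipse qform x y < T. *)
Definition radius_y := (2 * a).+1.
Definition radius_x := (nb * radius_y + a.+1)%N.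

Definition lattice_coord (m v0 k : nat) : R := (v0%:R + M%:R * (k%:R - m%:R))%R.

Definition qform (x y : R) : R := (a%:R * x ^+ 2 + b * x * y + c * y ^+ 2)%R.

Definition density : R :=
  (mass sqr_pos * mass root5_pos / (M%:R ^+ 2 * sqrt (delta / 4)%R))%R.

Lemma div_error (d X Y Z : R) : 0 < d -> `|d * X - Y| <= Z -> `|X - Y / d| <= Z / d.
Proof.
move=> d0 h; rewrite ler_pdivlMr // -[X in `|_| * X](gtr0_norm d0) -normrM.
by rewrite mulrBl divfK ?lt0r_neq0 // mulrC.
Qed.

(** A line that misses the ellipse contributes zero either way. *)
Lemma truncate_sqr z u : sqr_pos (rpos z - u ^+ 2)%R = sqr_pos (z - u ^+ 2)%R.
Proof.
rewrite !sqr_posE; case: (lerP 0 z) => z0; first by rewrite (rpos_id z0).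
have u2 := sqr_ge0 u.
by rewrite (rpos_0 (ltW z0)) !(@rpos_0 (_ - u ^+ 2)%R) //; lra.
Qed.

Lemma window_arith (p X Lc B Lh as' Las Ls Lb bu nB : R) :
  Lc = Lb + Las + Ls -> p <= as' -> as' <= Las -> Lh <= Ls -> bu <= Lb ->
  nB <= bu / 2 -> B <= nB -> - B <= nB -> 0 <= bu -> 0 <= X -> X <= 2 * Lh ->
  p <= X - Lc + B + 2 * Lc - Lh /\ X - Lc + B - Lh <= - p.
Proof. by move=> *; split; lra. Qed.

(** On each line y = const the profile is a truncated square whose mass is
    the fifth power of its radius; the masses form the second profile. *)
Lemma coset_sum : exists K : R, forall (x0 y0 s : nat) (T : R),
  (x0 < M)%N -> (y0 < M)%N -> (0 < s)%N -> 0 <= T -> T <= s%:R ^+ 2 ->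
  `|\sum_(j < 2 * (radius_y * s)) \sum_(k < 2 * (radius_x * s))
      rpos (T - qform (lattice_coord (radius_x * s) x0 k)
                      (lattice_coord (radius_y * s) y0 j))%R ^+ 2 -
    density * T ^+ 3| <= K * s%:R ^+ 4.
Proof.
pose rd := sqrt (delta / 4)%R; pose al : R := a%:R; pose mu : R := M%:R.
pose c1 : R := radius_y%:R; pose c2 : R := radius_x%:R; pose be : R := nb%:R.
pose d4 : R := (delta / 4)%R.
have d4p : 0 < d4 by rewrite divr_gt0 // (lt_le_trans ltr01).
have rd2 : rd ^+ 2 = d4 by rewrite -RpowE pow2_sqrt //; apply/RleP; exact: ltW.
have rdp : 0 < rd by apply/RltP/sqrt_lt_R0/RltP.
have rdh : 2^-1 <= rd.
  have d4q : 4^-1 <= d4.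
    by rewrite -[leLHS]mul1r ler_pM2r ?invr_gt0.
  rewrite leNgt; apply/negP => h.
  have : rd ^+ 2 < 2^-1 ^+ 2 by rewrite ltrXn2r // ltW.
  rewrite rd2; lra.
have al1 : 1 <= al by rewrite ler1n.
have mu1 : 1 <= mu by rewrite ler1n.
have al0 : 0 <= al by exact: le_trans ler01 al1.
have mu0 : 0 <= mu by exact: le_trans ler01 mu1.
have mu20 : 0 <= mu / 2 by rewrite divr_ge0.
have c1E : c1 = 2 * al + 1 by rewrite /c1 /radius_y -natr1 natrM.
have c2E : c2 = be * c1 + al + 1 by rewrite /c2 /radius_x natrD natrM -natr1 addrA.
have be0 : 0 <= be by [].
have c10 : 0 < c1 by rewrite c1E; lra.
have bc0 : 0 <= be * c1 by rewrite mulr_ge0 // ltW.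
have c20 : 0 < c2 by rewrite c2E; lra.
pose u1 : R := (mu * c1)%R; pose u2 : R := (al * mu * c2 + be * mu * c1)%R.
pose L : R := (al * mu)%R.
have L0 : 0 < L by rewrite mulr_gt0 // (lt_le_trans ltr01).
have L20 : 0 <= L / 2 by rewrite divr_ge0 // ltW.
pose e1 : R := (2 * c1 * (2 * (5 / 2 * al ^+ 3 * d4 +
   6 * al * d4 ^+ 2 * (2 * u1 + mu / 2) ^+ 2) * (mu / 2) ^+ 3))%R.
pose e2 : R := (2 * c2 * (2 * (2 * al ^+ 2 + (2 * u2 + L / 2) ^+ 2) * (L / 2) ^+ 3))%R.
exists ((mu * (2 * c1) * e2 + mass sqr_pos * e1) / (al ^+ 3 * mu ^+ 2))%R.
move=> x0 y0 s T x0M y0M s0 T0 Ts.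
pose sg : R := s%:R; have sg1 : 1 <= sg by rewrite ler1n.
have sg0 : 0 <= sg by exact: le_trans ler01 sg1.
pose q := sqrt (al * T)%R.
have aT0 : 0 <= al * T by rewrite mulr_ge0.
have q0 : 0 <= q by exact: sqrt_nneg.
have q2 : q ^+ 2 = al * T by rewrite -RpowE pow2_sqrt //; apply/RleP.
have qs : q <= al * sg.
  have as0 : 0 <= al * sg by rewrite mulr_ge0.
  rewrite -(@ler_pXn2r _ 2) ?nnegrE //.
  rewrite q2 exprMn expr2 -mulrA; apply: ler_wpM2l => //.
  by apply: (le_trans Ts); rewrite ler_peMl ?exprn_ge0.
set m2 := (radius_x * s)%N; set m1 := (radius_y * s)%N.
have m2E : m2%:R = c2 * sg :> R by rewrite natrM.
have m1E : m1%:R = c1 * sg :> R by rewrite natrM.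
pose y j := lattice_coord m1 y0 j; pose x k := lattice_coord m2 x0 k.
have y0b : 0 <= y0%:R :> R /\ y0%:R <= mu by rewrite ler_nat ltnW.
have x0b : 0 <= x0%:R :> R /\ x0%:R <= mu by rewrite ler_nat ltnW.
have coordB v0 m k : 0 <= v0%:R :> R /\ v0%:R <= mu -> (k < 2 * m)%N -> (v0 < M)%N ->
    `|lattice_coord m v0 k| <= mu * m%:R.
  move=> [v1 v2] km v0M; rewrite /lattice_coord -/mu ler_norml; apply/andP; split.
    have k0 : 0 <= mu * k%:R by rewrite mulr_ge0 //; lra.
    by rewrite mulrBr; lra.
  have : k%:R + 1 <= 2 * m%:R :> R by rewrite natr1 -natrM ler_nat.
  rewrite -(ler_pM2l (x := mu)); last by lra.
  by rewrite mulrDr mulrBr; lra.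
have yB j : (j < 2 * m1)%N -> `|y j| <= u1 * sg.
  by move=> jm; have := coordB y0 m1 j y0b jm y0M; rewrite m1E mulrA.
pose r5 j := root5_pos (al * T - d4 * y j ^+ 2)%R.
pose I j := \sum_(k < 2 * m2) rpos (T - qform (x k) (y j))%R ^+ 2.
have inner j : (j < 2 * m1)%N -> `|L * (al ^+ 2 * I j) - mass sqr_pos * r5 j| <= e2 * sg ^+ 3.
  move=> jm; have yj := yB j jm; rewrite /r5 /I; move: (y j) yj => yy yj {jm}.
  pose z : R := (al * T - d4 * yy ^+ 2)%R; pose p := sqrt (rpos z).
  have p0 : 0 <= p by exact: sqrt_nneg.
  have p2 : p ^+ 2 = rpos z by exact: sqrt_rpos_sqr.
  have ps : p <= al * sg.
    apply: le_trans qs; rewrite -(@ler_pXn2r _ 2) ?nnegrE // p2 q2 rposP ge_max aT0 /=.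
    by rewrite gerBl mulr_ge0 ?sqr_ge0 // ltW.
  pose u0 : R := (al * (x0%:R - mu * m2%:R) + b / 2 * yy)%R.
  have uE k : al * x k + b / 2 * yy = u0 + L * k%:R.
    by rewrite /x /lattice_coord /u0 /L -/mu; ring.
  have by2 : `|b / 2 * yy| <= be * u1 * sg / 2.
    rewrite 2!normrM (gtr0_norm (x := 2^-1)) ?invr_gt0 //.
    have h : `|b| * `|yy| <= be * (u1 * sg) by apply: ler_pM.
    move: h; rewrite mulrA; move: (`|b|) (`|yy|) => B Y h.
    by rewrite mulrAC ler_pM2r ?invr_gt0.
  have bu : be * u1 * sg <= L * be * c1 * sg.
    have -> : L * be * c1 * sg = al * (be * u1 * sg) by rewrite /L /u1; ring.
    by rewrite ler_peMl // !mulr_ge0 //; lra.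
  have L1 : 1 <= L by rewrite -[1]mulr1 ler_pM.
  have Ls : L / 2 <= L * sg.
    by rewrite ler_pM2l //; lra.
  have as0 : 0 <= al * sg by rewrite mulr_ge0.
  have Las : al * sg <= L * (al * sg) by rewrite ler_peMl.
  have bu0 : 0 <= be * u1 * sg by rewrite !mulr_ge0 //; lra.
  have LcE : L * (c2 * sg) = L * be * c1 * sg + L * (al * sg) + L * sg by rewrite c2E; ring.
  have s1 : sqrt 1%:R = 1 :> R by exact: sqrt_1.
  have ax0 : 0 <= al * x0%:R by rewrite mulr_ge0 //; lra.
  have ax1 : al * x0%:R <= L by rewrite ler_wpM2l //; case: x0b => //; lra.
  have nb1 := ler_norm (b / 2 * yy); have nb2 := ler_norm (- (b / 2 * yy)).
  rewrite normrN in nb2.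
  have uU k : (k < 2 * m2)%N -> `|u0 + L * k%:R| <= u2 * sg.
    move=> km; rewrite -uE; apply: le_trans (ler_normD _ _) _.
    have -> : u2 * sg = al * (mu * m2%:R) + be * u1 * sg by rewrite /u2 /u1 m2E; ring.
    apply: lerD; last by lra.
    rewrite normrM ger0_norm //.
    by rewrite ler_wpM2l ?(coordB _ _ _ x0b) //; lra.
  have u0E : u0 = al * x0%:R - L * (c2 * sg) + b / 2 * yy by rewrite /u0 m2E /L; ring.
  have L2 : L = 2 * (L / 2) by move: (L) => l; field.
  have eqW (v w : R) : v = w -> v <= w by move=> ->.
  have [w1 w2] := window_arith LcE ps Las Ls bu by2 nb1 nb2 bu0 ax0
    (le_trans ax1 (eqW _ _ L2)).
  have hV : p <= sqrt 1%:R * (u0 + L * (2 * m2)%:R - L / 2).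
    rewrite s1 mul1r natrM m2E u0E.
    by rewrite [L * (2 * _)]mulrCA.
  have hU : sqrt 1%:R * (u0 - L / 2) <= - p by rewrite s1 mul1r u0E.
  have := @profile_grid _ _ _ _ _ profile_sqr p 1%:R L (u2 * sg)%R u0 (2 * m2) p0
    (ltr0Sn _ 0) (ltW L0) uU hV hU.
  rewrite s1 divr1 natrM m2E -/p -root5_posE IZRE.
  have -> : \sum_(k < 2 * m2) sqr_pos (p ^+ 2 - 1%:R * (u0 + L * k%:R) ^+ 2)%R =
     al ^+ 2 * \sum_(k < 2 * m2) rpos (T - qform (x k) yy)%R ^+ 2.
    rewrite mulr_sumr; apply: eq_bigr => k _.
    rewrite mul1r p2 truncate_sqr sqr_posE -exprMn -rposZ //.
    have E : al * (T - qform (x k) yy) = z - (u0 + L * k%:R) ^+ 2.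
      by rewrite -uE /qform /z /d4 /delta -/al; field.
    by rewrite E.
  move=> h; apply: le_trans h _.
  have -> : e2 * sg ^+ 3 = 2 * (c2 * sg) * (2 * (2 * (al * sg) ^+ 2 +
    ((2 * u2 + L / 2) * sg) ^+ 2) * (L / 2) ^+ 3) by rewrite /e2; ring.
  have u20 : 0 <= u2 by rewrite /u2 addr_ge0 // !mulr_ge0 //; lra.
  have sgL : 2 * (u2 * sg) + L / 2 <= (2 * u2 + L / 2) * sg.
    have -> : (2 * u2 + L / 2) * sg = 2 * (u2 * sg) + L / 2 * sg by ring.
    by rewrite lerD2l ler_peMr.
  have n0 : 0 <= 2 * (u2 * sg) + L / 2.
    by apply: addr_ge0 => //; rewrite !mulr_ge0.
  apply: ler_wpM2l; first by rewrite !mulr_ge0 // ltW.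
  apply: ler_wpM2r; first by rewrite exprn_ge0.
  apply: ler_wpM2l => //; apply: lerD.
    by rewrite mulr1; apply: ler_wpM2l => //; apply: lerXn2r; rewrite ?nnegrE.
  rewrite expr0 expr1n !mul1r; apply: lerXn2r; rewrite ?nnegrE //.
  exact: le_trans sgL.
have outer : `|mu * (\sum_(j < 2 * m1) r5 j) - mass root5_pos * q ^+ 6 / rd| <= e1 * sg ^+ 4.
  pose u0 : R := (y0%:R - mu * m1%:R)%R.
  have yE j : y j = u0 + mu * j%:R by rewrite /y /lattice_coord /u0 -/mu; ring.
  have yU j : (j < 2 * m1)%N -> `|u0 + mu * j%:R| <= u1 * sg by rewrite -yE; exact: yB.
    have as_ge0 : 0 <= al * sg by rewrite mulr_ge0.
  have outer_arith : 2 * (al * sg) + mu / 2 <= mu * (c1 * sg).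
    have -> : mu * (c1 * sg) = mu * (2 * (al * sg)) + mu * sg by rewrite c1E; ring.
    apply: lerD; first by rewrite ler_peMl // mulr_ge0.
    by rewrite ler_wpM2l //; lra.
  have u0E : u0 = y0%:R - mu * (c1 * sg) by rewrite /u0 m1E.
  have hV : q <= sqrt d4 * (u0 + mu * (2 * m1)%:R - mu / 2).
    apply: le_trans qs _; rewrite natrM m1E.
    have h : al * sg <= 2^-1 * (u0 + mu * (2 * (c1 * sg)) - mu / 2).
      rewrite u0E; have : 0 <= y0%:R :> R by [].
      move: outer_arith => h y00; lra.
    apply: le_trans h _; rewrite ler_wpM2r //.
    by rewrite u0E; have : 0 <= y0%:R :> R by []; have := outer_arith; have := as_ge0; lra.
  have hU : sqrt d4 * (u0 - mu / 2) <= - q.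
    have h : al * sg <= 2^-1 * - (u0 - mu / 2).
      by rewrite u0E; case: y0b => _ y01; have := outer_arith; lra.
    have h0 : 0 <= - (u0 - mu / 2) by have := as_ge0; lra.
    rewrite lerNr -mulrN; apply: le_trans qs _; apply: le_trans h _.
    by rewrite ler_wpM2r.
  have := @profile_grid _ _ _ _ _ profile_root5 q d4 mu (u1 * sg)%R u0 (2 * m1) q0 d4p mu0 yU hV hU.
  rewrite -/rd natrM m1E RdivE !IZRE expr1 q2.
  under eq_bigr => j _ do rewrite -yE.
  move=> h; apply: le_trans h _.
  have -> : e1 * sg ^+ 4 = 2 * (c1 * sg) * (2 * (5 / 2 * (al * sg) ^+ 3 * d4 +
    6 * (al * sg) * d4 ^+ 2 * ((2 * u1 + mu / 2) * sg) ^+ 2) * (mu / 2) ^+ 3).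
    by rewrite /e1; ring.
  have u10 : 0 <= u1 by rewrite /u1 mulr_ge0 // ltW.
  have sgL : 2 * (u1 * sg) + mu / 2 <= (2 * u1 + mu / 2) * sg.
    have -> : (2 * u1 + mu / 2) * sg = 2 * (u1 * sg) + mu / 2 * sg by ring.
    by rewrite lerD2l ler_peMr.
  have n0 : 0 <= 2 * (u1 * sg) + mu / 2.
    by apply: addr_ge0 => //; rewrite !mulr_ge0.
  apply: ler_wpM2l; first by rewrite !mulr_ge0 // ltW.
  apply: ler_wpM2r; first by rewrite exprn_ge0.
  apply: ler_wpM2l => //; apply: lerD.
    apply: ler_wpM2r; first exact: ltW.
    by apply: ler_wpM2l; [rewrite divr_ge0|apply: lerXn2r; rewrite ?nnegrE].
  have d42 : 0 <= d4 ^+ 2 by rewrite exprn_ge0 // ltW.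
  apply: ler_pM.
  - by apply: mulr_ge0 d42; apply: mulr_ge0 q0.
  - by rewrite exprn_ge0.
  - by apply: ler_wpM2r => //; apply: ler_wpM2l.
  - by apply: lerXn2r; rewrite ?nnegrE // (le_trans n0).
have dE : density * T ^+ 3 = (mass sqr_pos * (mass root5_pos * q ^+ 6 / rd)) / (al ^+ 3 * mu ^+ 2).
  have -> : q ^+ 6 = (al * T) ^+ 3 by rewrite -q2 -exprM.
  rewrite /density -/rd -/mu; move: (lt0r_neq0 rdp) => rdn.
  have aln : al != 0 by rewrite lt0r_neq0 // (lt_le_trans ltr01).
  have mun : mu != 0 by rewrite lt0r_neq0 // (lt_le_trans ltr01).
  by field; rewrite rdn aln mun.
have den : 0 < al ^+ 3 * mu ^+ 2.
  by rewrite mulr_gt0 ?exprn_gt0 // (lt_le_trans ltr01).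
rewrite dE [leRHS]mulrAC; apply: div_error den _.
have -> : al ^+ 3 * mu ^+ 2 * (\sum_(j < 2 * m1) I j) - mass sqr_pos * (mass root5_pos * q ^+ 6 / rd) =
  mu * (\sum_(j < 2 * m1) (L * (al ^+ 2 * I j) - mass sqr_pos * r5 j)) +
  mass sqr_pos * (mu * (\sum_(j < 2 * m1) r5 j) - mass root5_pos * q ^+ 6 / rd).
  by rewrite sumrB -!mulr_sumr /L; ring.
have ms : 0 < mass sqr_pos by apply/RltP; exact: mass_pos profile_sqr.
apply: le_trans (ler_normD _ _) _; rewrite mulrDl; apply: lerD; last first.
  by rewrite normrM (gtr0_norm ms) -[leRHS]mulrA ler_pM2l.
have mup : 0 < mu by exact: lt_le_trans mu1.
rewrite normrM (gtr0_norm mup) -2![leRHS]mulrA ler_pM2l //.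
apply: le_trans (ler_norm_sum _ _ _) _.
apply: (@le_trans _ _ (\sum_(j < 2 * m1) e2 * sg ^+ 3)).
  by apply: ler_sum => j _; exact: inner.
rewrite sumr_const card_ord -[leLHS]mulr_natl natrM m1E le_eqVlt; apply/orP; left; apply/eqP.
by ring.
Qed.
End Coset.

From mathcomp Require Import classical_sets.
Require Import Defs.
Local Open Scope classical_set_scope.
Local Open Scope ring_scope.

(** * Forms under unimodular substitutions *)

Lemma bqf_ext f g : (forall x y, bqf_eval f x y = bqf_eval g x y) -> f = g.
Proof.
case: f => a b c; case: g => a' b' c' E.
have := E 1 0; have := E 0 1; have := E 1 1; rewrite /bqf_eval /= => E1 E2 E3.
have ha : a = a' by lia.
have hc : c = c' by lia.
have hb : b = b' by lia.
by rewrite ha hb hc.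
Qed.

Definition bqf_act (f : bqf) (s t u v : int) : bqf :=
  BQF (bqf_eval f s u)
      (2 * qa f * s * t + qb f * (s * v + t * u) + 2 * qc f * u * v)
      (bqf_eval f t v).

Lemma bqf_actE f s t u v x y :
  bqf_eval (bqf_act f s t u v) x y = bqf_eval f (s * x + t * y) (u * x + v * y).
Proof. rewrite /bqf_eval /bqf_act /= /bqf_eval; ring. Qed.

Lemma proper_equiv_act f s t u v :
  s * v - t * u = 1 -> proper_equiv f (bqf_act f s t u v).
Proof.
by move=> d; exists s, t, u, v; split=> // x y; rewrite bqf_actE.
Qed.

Lemma proper_equivP f g : proper_equiv f g ->
  exists s t u v, s * v - t * u = 1 /\ g = bqf_act f s t u v.
Proof.
move=> [s [t [u [v [d E]]]]]; exists s, t, u, v; split=> //.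
by apply: bqf_ext => x y; rewrite E bqf_actE.
Qed.

Lemma proper_equiv_refl f : proper_equiv f f.
Proof.
exists 1, 0, 0, 1; split; first by ring.
by move=> x y; congr (bqf_eval f _ _); ring.
Qed.

Lemma proper_equiv_sym f g : proper_equiv f g -> proper_equiv g f.
Proof.
move=> [s [t [u [v [d E]]]]]; exists v, (- t), (- u), s; split.
  by rewrite -d; ring.
move=> x y; rewrite E; congr (bqf_eval f _ _).
  have -> : s * (v * x + - t * y) + t * (- u * x + s * y) =
            (s * v - t * u) * x by ring.
  by rewrite d mul1r.
have -> : u * (v * x + - t * y) + v * (- u * x + s * y) =
          (s * v - t * u) * y by ring.
by rewrite d mul1r.
Qed.

Lemma proper_equiv_trans f g h :
  proper_equiv f g -> proper_equiv g h -> proper_equiv f h.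
Proof.
move=> [s [t [u [v [d E]]]]] [s' [t' [u' [v' [d' E']]]]].
exists (s * s' + t * u'), (s * t' + t * v'), (u * s' + v * u'),
  (u * t' + v * v'); split.
  have -> : (s * s' + t * u') * (u * t' + v * v') -
            (s * t' + t * v') * (u * s' + v * u') =
            (s * v - t * u) * (s' * v' - t' * u') by ring.
  by rewrite d d' mul1r.
by move=> x y; rewrite E' E; congr (bqf_eval f _ _); ring.
Qed.

Lemma disc_act f s t u v :
  disc (bqf_act f s t u v) = (s * v - t * u) ^+ 2 * disc f.
Proof. rewrite /disc /bqf_act /= /bqf_eval; ring. Qed.

Lemma primitiveP f : primitive f <->
  (forall d : int, (d %| qa f)%Z -> (d %| qb f)%Z -> (d %| qc f)%Z ->
   (d %| 1%R)%Z).
Proof.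
rewrite /primitive; split.
  by move=> E d da db dc; rewrite -E !dvdz_gcd da db dc.
move=> H; have := H (gcdz (gcdz (qa f) (qb f)) (qc f)).
rewrite dvdz_gcdr (dvdz_trans (dvdz_gcdl _ _) (dvdz_gcdl _ _)).
rewrite (dvdz_trans (dvdz_gcdl _ _) (dvdz_gcdr _ _)).
move=> /(_ isT isT isT); rewrite dvdz1 => /eqP.
by rewrite /gcdz absz_nat => ->.
Qed.

Lemma forms_equiv D f g : proper_equiv f g -> forms D f -> forms D g.
Proof.
move=> E; have [s [t [u [v [d gE]]]]] := proper_equivP E.
have [s' [t' [u' [v' [d' fE]]]]] := proper_equivP (proper_equiv_sym E).
move=> [/primitiveP fp pd fD]; split.
- apply/primitiveP => e /dvdzP[ka ea] /dvdzP[kb eb] /dvdzP[kc ec].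
  apply: fp; rewrite fE /bqf_act /= /bqf_eval ea eb ec; apply/dvdzP.
  + exists (ka * s' ^+ 2 + kb * s' * u' + kc * u' ^+ 2); ring.
  + exists (2 * ka * s' * t' + kb * (s' * v' + t' * u') + 2 * kc * u' * v').
    ring.
  + exists (ka * t' ^+ 2 + kb * t' * v' + kc * v' ^+ 2); ring.
- move=> x y xy0; rewrite gE bqf_actE; apply: pd; apply: contraNneq xy0.
  move=> [e1 e2]; have x0 : x = 0.
    rewrite -[x]mul1r -d.
    have -> : (s * v - t * u) * x =
      v * (s * x + t * y) - t * (u * x + v * y) by ring.
    by rewrite e1 e2 !mulr0 subr0.
  have y0 : y = 0.
    rewrite -[y]mul1r -d.
    have -> : (s * v - t * u) * y =
      s * (u * x + v * y) - u * (s * x + t * y) by ring.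
    by rewrite e1 e2 !mulr0 subr0.
  by rewrite x0 y0.
by rewrite gE disc_act d expr1n mul1r.
Qed.

Lemma class_of_eq f g : proper_equiv f g -> class_of f = class_of g.
Proof.
move=> E; apply/seteqP; split=> h /= H.
  exact: proper_equiv_trans (proper_equiv_sym E) H.
exact: proper_equiv_trans E H.
Qed.

Lemma class_of_inj f g : class_of f = class_of g -> proper_equiv f g.
Proof.
move=> E; have : class_of g g by exact: proper_equiv_refl.
by rewrite -E.
Qed.

(** * Direct compositions *)

Lemma forms_qa_gt0 D f : forms D f -> 0 < qa f.
Proof.
move=> [_ pd _]; have := pd 1 0 isT; rewrite /bqf_eval; lia.
Qed.

Lemma direct_composition_sym f g h :
  direct_composition f g h -> direct_composition g f h.
Proof.
move=> [a1 [b1 [c1 [d1 [a2 [b2 [c2 [d2 [E E1 E2]]]]]]]]].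
exists a1, c1, b1, d1, a2, c2, b2, d2; split=> //.
move=> x y z w; rewrite mulrC E; congr (bqf_eval h _ _); ring.
Qed.

Lemma direct_composition_equivr f g h h' : proper_equiv h h' ->
  direct_composition f g h -> direct_composition f g h'.
Proof.
move=> /proper_equiv_sym [s [t [u [v [d E']]]]].
move=> [a1 [b1 [c1 [d1 [a2 [b2 [c2 [d2 [E E1 E2]]]]]]]]].
exists (s * a1 + t * a2), (s * b1 + t * b2), (s * c1 + t * c2),
  (s * d1 + t * d2), (u * a1 + v * a2), (u * b1 + v * b2),
  (u * c1 + v * c2), (u * d1 + v * d2); split.
- by move=> x y z w; rewrite E E'; congr (bqf_eval h' _ _); ring.
- rewrite -E1 -[RHS]mul1r -d; ring.
- rewrite -E2 -[RHS]mul1r -d; ring.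
Qed.

(** Fixing the first argument at (x, y), the composition substitutes into h a
    matrix whose determinant squares to f(x, y)^2 by comparing discriminants;
    so the determinant is the form f up to sign, and the sign is decided at
    (1, 0). *)
Lemma direct_composition_det D f g h a1 b1 c1 d1 a2 b2 c2 d2 :
  D < 0 -> forms D f -> forms D g -> forms D h ->
  (forall x y z w : int, bqf_eval f x y * bqf_eval g z w =
          bqf_eval h (a1 * x * z + b1 * x * w + c1 * y * z + d1 * y * w)
                     (a2 * x * z + b2 * x * w + c2 * y * z + d2 * y * w)) ->
  a1 * b2 - a2 * b1 = bqf_eval f 1 0 ->
  [/\ (a1 * d2 - a2 * d1) + (c1 * b2 - c2 * b1) = qb f
    & c1 * d2 - c2 * d1 = qc f].
Proof.
move=> D0 ff fg fh E E1.
have a0 := forms_qa_gt0 ff.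
have [[_ _ fD] [_ _ gD] [_ _ hD]] := And3 ff fg fh.
set q := (a1 * d2 - a2 * d1) + (c1 * b2 - c2 * b1).
set r := c1 * d2 - c2 * d1.
have sq x y : (qa f * x ^+ 2 + q * x * y + r * y ^+ 2) ^+ 2 =
              bqf_eval f x y ^+ 2.
  have : BQF (bqf_eval f x y * qa g) (bqf_eval f x y * qb g)
             (bqf_eval f x y * qc g) =
         bqf_act h (a1 * x + c1 * y) (b1 * x + d1 * y)
                   (a2 * x + c2 * y) (b2 * x + d2 * y).
    apply: bqf_ext => z w; rewrite bqf_actE.
    transitivity (bqf_eval f x y * bqf_eval g z w).
      by rewrite /bqf_eval /=; ring.
    by rewrite E; congr (bqf_eval h _ _); ring.
  move=> /(congr1 disc); rewrite disc_act hD => H.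
  have D0' : D != 0 by lia.
  apply: (mulIf D0'); rewrite -{2}gD.
  have -> : bqf_eval f x y ^+ 2 * disc g =
     disc (BQF (bqf_eval f x y * qa g) (bqf_eval f x y * qb g)
             (bqf_eval f x y * qc g)) by rewrite /disc /=; ring.
  rewrite H; congr (_ ^+ 2 * _).
  have -> : qa f = a1 * b2 - a2 * b1 by rewrite E1 /bqf_eval; ring.
  rewrite /q /r; ring.
pose P x y := (qa f * x ^+ 2 + q * x * y + r * y ^+ 2) ^+ 2 -
              bqf_eval f x y ^+ 2.
have P0 x y : P x y = 0 by rewrite /P sq subrr.
(* coefficients of x^3 y and of x^2 y^2 *)
have qE : q = qb f.
  have : 24 * (qa f * (q - qb f)) = 0.
    have <- : 8 * (P 1 1 - P 1 (-1)) - (P 1 2 - P 1 (-2)) =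
              24 * (qa f * (q - qb f)) by rewrite /P /bqf_eval; ring.
    by rewrite !P0.
  by move=> /eqP; rewrite !mulf_eq0 /= => /orP[] /eqP; lia.
split=> //.
have : 4 * (qa f * (r - qc f)) = 0.
  have <- : P 1 1 + P 1 (-1) - 2 * P 0 1 = 4 * (qa f * (r - qc f)).
    by rewrite /P /bqf_eval qE; ring.
  by rewrite !P0.
by move=> /eqP; rewrite !mulf_eq0 /= => /orP[] /eqP; lia.
Qed.

Lemma direct_composition_equivl D f f' g h : D < 0 ->
  forms D f -> forms D g -> forms D h -> proper_equiv f f' ->
  direct_composition f g h -> direct_composition f' g h.
Proof.
move=> D0 ff fg fh [s [t [u [v [d E']]]]].
move=> [a1 [b1 [c1 [d1 [a2 [b2 [c2 [d2 [E E1 E2]]]]]]]]].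
have [mid last] := direct_composition_det D0 ff fg fh E E1.
exists (s * a1 + u * c1), (s * b1 + u * d1), (t * a1 + v * c1),
  (t * b1 + v * d1), (s * a2 + u * c2), (s * b2 + u * d2),
  (t * a2 + v * c2), (t * b2 + v * d2); split.
- by move=> x y z w; rewrite E' E; congr (bqf_eval h _ _); ring.
- transitivity ((a1 * b2 - a2 * b1) * s ^+ 2 +
    (a1 * d2 - a2 * d1 + (c1 * b2 - c2 * b1)) * s * u +
    (c1 * d2 - c2 * d1) * u ^+ 2); first by ring.
  by rewrite E1 mid last E' /bqf_eval; ring.
- by rewrite -E2 -[RHS]mul1r -d; ring.
Qed.

(** Two families of integer plane vectors with the same 2 x 2 minors, the
    minors being coprime, differ by one integer matrix: with Bezout
    coefficients e_ij, it is the sum of the e_ij [w'_i w'_j] adj [w_i w_j],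
    and the claim for the k-th vector is the Pluecker relation among the
    vectors i, j, k. *)
Lemma same_minors (I : Type) (X Y X' Y' : I -> int) (s : seq (int * I * I)) :
  (forall i j, X i * Y j - Y i * X j = X' i * Y' j - Y' i * X' j) ->
  \sum_(t <- s) t.1.1 * (X t.1.2 * Y t.2 - Y t.1.2 * X t.2) = 1 ->
  exists M11 M12 M21 M22 : int, forall k,
    X' k = M11 * X k + M12 * Y k /\ Y' k = M21 * X k + M22 * Y k.
Proof.
move=> E B.
exists (\sum_(t <- s) t.1.1 * (X' t.1.2 * Y t.2 - X' t.2 * Y t.1.2)).
exists (\sum_(t <- s) t.1.1 * (X' t.2 * X t.1.2 - X' t.1.2 * X t.2)).
exists (\sum_(t <- s) t.1.1 * (Y' t.1.2 * Y t.2 - Y' t.2 * Y t.1.2)).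
exists (\sum_(t <- s) t.1.1 * (Y' t.2 * X t.1.2 - Y' t.1.2 * X t.2)).
move=> k; split.
  rewrite -[LHS]mulr1 -B mulr_sumr !mulr_suml -big_split /=.
  apply: eq_bigr => -[[e i] j] _ /=.
  transitivity (e * (X' i * (X k * Y j - Y k * X j) +
                     X' j * (X i * Y k - Y i * X k))); last by ring.
  by rewrite !E; ring.
rewrite -[LHS]mulr1 -B mulr_sumr !mulr_suml -big_split /=.
apply: eq_bigr => -[[e i] j] _ /=.
transitivity (e * (Y' i * (X k * Y j - Y k * X j) +
                   Y' j * (X i * Y k - Y i * X k))); last by ring.
by rewrite !E; ring.
Qed.

Lemma primitive_bezout f : primitive f ->
  exists e1 e2 e3 : int, e1 * qa f + e2 * qb f + e3 * qc f = 1.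
Proof.
rewrite /primitive => <-.
have [u [v uv]] := Bezoutz (gcdz (qa f) (qb f)) (qc f).
have [u' [v' uv']] := Bezoutz (qa f) (qb f).
exists (u * u'), (u * v'), v; rewrite -uv -uv'; ring.
Qed.

(** The minors of a direct composition are determined by f and g, so two
    composites of the same pair differ by a substitution of determinant 1. *)
Lemma direct_composition_uniq D f g h h' : D < 0 ->
  forms D f -> forms D g -> forms D h -> forms D h' ->
  direct_composition f g h -> direct_composition f g h' -> proper_equiv h h'.
Proof.
move=> D0 ff fg fh fh' H H'; apply: proper_equiv_sym.
have a0 := forms_qa_gt0 ff; have [fp _ _] := ff.
have [e1 [e2 [e3 be]]] := primitive_bezout fp.
move: H H' => [a1 [b1 [c1 [d1 [a2 [b2 [c2 [d2 [E E1 E2]]]]]]]]].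
move=> [a1' [b1' [c1' [d1' [a2' [b2' [c2' [d2' [E' E1' E2']]]]]]]]].
have Esym x y z w : bqf_eval g x y * bqf_eval f z w =
   bqf_eval h (a1 * x * z + c1 * x * w + b1 * y * z + d1 * y * w)
              (a2 * x * z + c2 * x * w + b2 * y * z + d2 * y * w).
  by rewrite mulrC E; congr (bqf_eval h _ _); ring.
have Esym' x y z w : bqf_eval g x y * bqf_eval f z w =
   bqf_eval h' (a1' * x * z + c1' * x * w + b1' * y * z + d1' * y * w)
              (a2' * x * z + c2' * x * w + b2' * y * z + d2' * y * w).
  by rewrite mulrC E'; congr (bqf_eval h' _ _); ring.
have [m1 l1] := direct_composition_det D0 ff fg fh E E1.
have [m2 l2] := direct_composition_det D0 fg ff fh Esym E2.
have [m1' l1'] := direct_composition_det D0 ff fg fh' E' E1'.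
have [m2' l2'] := direct_composition_det D0 fg ff fh' Esym' E2'.
pose X (i : bool * bool) := if i.1 then if i.2 then d1 else c1
                            else if i.2 then b1 else a1.
pose Y (i : bool * bool) := if i.1 then if i.2 then d2 else c2
                            else if i.2 then b2 else a2.
pose X' (i : bool * bool) := if i.1 then if i.2 then d1' else c1'
                            else if i.2 then b1' else a1'.
pose Y' (i : bool * bool) := if i.1 then if i.2 then d2' else c2'
                            else if i.2 then b2' else a2'.
have minors i j : X i * Y j - Y i * X j = X' i * Y' j - Y' i * X' j.
  by case: i => [[] []]; case: j => [[] []]; rewrite /X /Y /X' /Y' /=; lra.
pose s := [:: (e1, (false, false), (false, true));
              (e2, (false, false), (true, true));
              (e2, (true, false), (false, true));
              (e3, (true, false), (true, true))].
have B : \sum_(t <- s) t.1.1 * (X t.1.2 * Y t.2 - Y t.1.2 * X t.2) = 1.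
  rewrite !big_cons big_nil /X /Y /= -be -m1 -l1.
  have -> : qa f = a1 * b2 - a2 * b1 by rewrite E1 /bqf_eval; ring.
  by ring.
have [M11 [M12 [M21 [M22 M]]]] := same_minors minors B.
have [Ma1 Ma2] := M (false, false); have [Mb1 Mb2] := M (false, true).
rewrite /X /Y /X' /Y' /= in Ma1 Ma2 Mb1 Mb2.
have a0' : a1 * b2 - a2 * b1 != 0 by move: E1; rewrite /bqf_eval; lra.
have d : M11 * M22 - M12 * M21 = 1.
  apply: (mulIf a0'); rewrite mul1r [RHS]E1 -E1' Ma1 Ma2 Mb1 Mb2; ring.
exists M11, M12, M21, M22; split=> //.
(* both sides are quadratic forms that agree at the three vectors
   (a1, a2), (b1, b2) and their sum, of which two are independent *)
have H x z w : bqf_eval h (a1 * x * z + b1 * x * w) (a2 * x * z + b2 * x * w) =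
  bqf_eval (bqf_act h' M11 M12 M21 M22)
    (a1 * x * z + b1 * x * w) (a2 * x * z + b2 * x * w).
  have := E x 0 z w; rewrite E' bqf_actE Ma1 Ma2 Mb1 Mb2 !(mulr0, mul0r, addr0).
  by move=> <-; congr (bqf_eval h' _ _); ring.
move=> x y; rewrite -bqf_actE; move: H; set k := bqf_act _ _ _ _ _ => H.
pose N := a1 * b2 - a2 * b1.
have N2 : N ^+ 2 != 0 by rewrite expf_neq0.
apply: (mulfI N2).
have scale q : N ^+ 2 * bqf_eval q x y = bqf_eval q (N * x) (N * y).
  by rewrite /bqf_eval; ring.
rewrite !scale.
have -> : N * x = a1 * 1 * (b2 * x - b1 * y) + b1 * 1 * (a1 * y - a2 * x).
  by rewrite /N; ring.
have -> : N * y = a2 * 1 * (b2 * x - b1 * y) + b2 * 1 * (a1 * y - a2 * x).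
  by rewrite /N; ring.
exact: H.
Qed.

Lemma class_mul_class_of D f g h : D < 0 ->
  forms D f -> forms D g -> forms D h -> direct_composition f g h ->
  class_mul D (class_of f) (class_of g) = class_of h.
Proof.
move=> D0 ff fg fh H; apply/seteqP; split=> k /=.
  move=> [fk [f' [g' [E E' H']]]].
  apply: (direct_composition_uniq D0 ff fg fh fk H).
  have ff' := forms_equiv E ff; have fg' := forms_equiv E' fg.
  apply: (direct_composition_equivl D0 ff' fg fk (proper_equiv_sym E)).
  apply: direct_composition_sym.
  apply: (direct_composition_equivl D0 fg' ff' fk (proper_equiv_sym E')).
  exact: direct_composition_sym.
move=> E; split; first exact: forms_equiv E fh.
exists f, g; split; [exact: proper_equiv_refl|exact: proper_equiv_refl|].
exact: direct_composition_equivr E H.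
Qed.

(** * Concordant forms *)

Lemma coprime_primeP m n : (0 < n)%N ->
  (forall l, prime l -> (l %| m)%N -> ~~ (l %| n)%N) -> coprime m n.
Proof.
move=> n0 H; apply/negPn/negP; rewrite /coprime => g1.
have g0 : (0 < gcdn m n)%N by rewrite gcdn_gt0 n0 orbT.
have := H (pdiv (gcdn m n)) (pdiv_prime _).
rewrite (dvdn_trans (pdiv_dvd _) (dvdn_gcdl _ _)).
by rewrite (dvdn_trans (pdiv_dvd _) (dvdn_gcdr _ _)) => /(_ ltac:(lia) isT).
Qed.

Lemma posdefP f : disc f < 0 -> 0 < qa f -> posdef f.
Proof.
case: f => a b c; rewrite /disc /= => d a0 x y xy0.
have E : 4 * a * bqf_eval (BQF a b c) x y =
         (2 * a * x + b * y) ^+ 2 - (b ^+ 2 - 4 * a * c) * y ^+ 2.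
  by rewrite /bqf_eval /=; ring.
have : 0 < 4 * a * bqf_eval (BQF a b c) x y.
  rewrite E; have [y0|y0] := eqVneq y 0.
    have x0 : x != 0 by apply: contraNneq xy0 => ->; rewrite y0.
    rewrite y0 mulr0 expr0n mulr0 subr0 addr0 exprn_even_gt0 //=.
    by rewrite !mulf_neq0 //; lia.
  rewrite ltr_wpDl ?sqr_ge0 // -mulNr mulr_gt0 //; first by lia.
  by rewrite exprn_even_gt0.
by rewrite pmulr_rgt0 //; lia.
Qed.

Lemma primitive_primeP f : primitive f <->
  (forall l : nat, prime l -> (l%:Z %| qa f)%Z -> (l%:Z %| qb f)%Z ->
   ~~ (l%:Z %| qc f)%Z).
Proof.
rewrite primitiveP; split=> [H l pl la lb|H d da db dc].
  apply/negP => lc; have := H _ la lb lc; rewrite dvdz1 absz_nat.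
  by move=> /eqP l1; rewrite l1 in pl.
rewrite dvdz1; have [//|d1] := eqVneq `|d|%N 1%N.
have [d0|d0] := posnP `|d|%N.
  have dE : d = 0 by lia.
  move: da db dc; rewrite dE !dvd0z => /eqP a0 /eqP b0 /eqP c0.
  by have := H 2 isT; rewrite a0 b0 c0 dvdz0 => /(_ isT isT).
have pd : ((pdiv `|d|)%:Z %| d)%Z by rewrite dvdzE absz_nat pdiv_dvd.
have := H (pdiv `|d|) (pdiv_prime _).
rewrite (dvdz_trans pd da) (dvdz_trans pd db) (dvdz_trans pd dc).
by move=> /(_ _ isT isT); move=> /(_ ltac:(lia)).
Qed.

Lemma proper_equiv_shift a b c k :
  proper_equiv (BQF a b c) (BQF a (b + 2 * a * k) (a * k ^+ 2 + b * k + c)).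
Proof.
exists 1, k, 0, 1; split; first by ring.
by move=> x y; rewrite /bqf_eval /=; ring.
Qed.

Lemma proper_equiv_swap a b c : proper_equiv (BQF a b c) (BQF c (- b) a).
Proof.
exists 0, (-1), 1, 0; split; first by ring.
by move=> x y; rewrite /bqf_eval /=; ring.
Qed.

(** Forms with the same positive leading coefficient and discriminant are
    equivalent when their middle coefficients agree modulo 2a. *)
Lemma proper_equiv_mid a b c b' c' k : a != 0 -> b' = b + 2 * a * k ->
  disc (BQF a b c) = disc (BQF a b' c') ->
  proper_equiv (BQF a b c) (BQF a b' c').
Proof.
move=> a0 -> E; have <- : a * k ^+ 2 + b * k + c = c'.
  have a4 : 4 * a != 0 by lia.
  apply: (mulfI a4); move: E; rewrite /disc /= => E.
  have -> : 4 * a * c' = (b + 2 * a * k) ^+ 2 - (b ^+ 2 - 4 * a * c).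
    by rewrite E; ring.
  ring.
exact: proper_equiv_shift.
Qed.

(** A primitive vector is the first column of a unimodular matrix. *)
Lemma proper_equiv_lead f x y : gcdz x y = 1 ->
  exists2 g, proper_equiv f g & qa g = bqf_eval f x y.
Proof.
move=> xy; have [u [v uv]] := Bezoutz x y.
exists (bqf_act f x (- v) y u) => //; apply: proper_equiv_act.
by rewrite -xy -uv; ring.
Qed.

(** A primitive form properly represents integers prime to any given N: let
    x collect the primes of N that divide a but not c, and y those that do
    not divide a. *)
Lemma proper_equiv_coprime_lead f (N : nat) : primitive f -> (0 < N)%N ->
  exists2 g, proper_equiv f g & coprimez (qa g) N%:Z.
Proof.
move=> /primitive_primeP fp N0; case: f fp => a b c /= fp.
pose P1 (l : nat) := (l%:Z %| a)%Z && ~~ (l%:Z %| c)%Z.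
pose P2 (l : nat) := ~~ (l%:Z %| a)%Z.
pose x := (\prod_(l <- primes N | P1 l) l)%N.
pose y := (\prod_(l <- primes N | P2 l) l)%N.
have dv P l : prime l ->
    (l %| \prod_(k <- primes N | P k) k)%N = (l \in primes N) && P l.
  move=> pl; rewrite big_seq_cond Euclid_dvd_prod // big_has_cond.
  apply/hasP/andP => [[k]|[lN Pl]]; last first.
    by exists l => //=; rewrite lN Pl dvdnn.
  rewrite mem_primes => /and3P[pk N1 kN] /andP[/andP[kp Pk] /=].
  by rewrite dvdn_prime2 // => /eqP ->; rewrite kp.
have lxy l : prime l -> ~~ ((l %| x)%N && (l %| y)%N).
  by move=> pl; rewrite !dv // /P1 /P2; case: (l%:Z %| a)%Z; rewrite /= ?andbF.
have y0 : (0 < y)%N.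
  rewrite /y big_seq_cond prodn_cond_gt0 // => l /andP[].
  by rewrite mem_primes => /andP[/prime_gt0].
have xy : gcdz x y = 1.
  rewrite /gcdz !absz_nat; congr Posz; apply/eqP/coprime_primeP => // l pl lx.
  by have := lxy l pl; rewrite lx.
have [g eg ga] := proper_equiv_lead (BQF a b c) xy.
exists g => //; rewrite ga /coprimez /gcdz absz_nat.
rewrite eqz_nat; apply: coprime_primeP => // l pl lf; apply/negP => lN.
have lp : l \in primes N by rewrite mem_primes pl N0.
have := fp l pl.
have lE (z : nat) : (l%:Z %| z%:Z)%Z = (l %| z)%N by rewrite dvdzE !absz_nat.
have {}lf : (l%:Z %| bqf_eval (BQF a b c) x y)%Z by rewrite dvdzE absz_nat.
have pz u v : (l%:Z %| u * v)%Z = (l%:Z %| u)%Z || (l%:Z %| v)%Z.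
  by rewrite !dvdzE abszM !absz_nat Euclid_dvdM.
have lxE := dv P1 l pl; have lyE := dv P2 l pl.
move: lf; rewrite /bqf_eval /= !expr2.
rewrite -/x lp /= -lE in lxE; rewrite -/y lp /= -lE in lyE.
have [la|la] := boolP (l%:Z %| a)%Z; last first.
  rewrite /P1 /P2 (negPf la) /= in lxE lyE.
  rewrite -addrA rpredDr; last first.
    by rewrite rpredD // !pz lyE !orbT.
  by rewrite !pz lxE (negPf la).
rewrite /P1 /P2 la /= in lxE lyE => /=.
have [lc|lc] := boolP (l%:Z %| c)%Z.
  rewrite lc /= in lxE.
  rewrite rpredDr; last by rewrite !pz lc.
  rewrite rpredDl; last by rewrite !pz la.
  by rewrite !pz lxE lyE !orbF => -> /(_ isT isT).
rewrite lc in lxE; rewrite rpredDl; last first.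
  by rewrite rpredD // !pz lxE ?orbT.
by rewrite !pz lyE (negPf lc).
Qed.

(** Dirichlet's composition of united forms. *)
Lemma direct_composition_concordant a1 a2 b c :
  direct_composition (BQF a1 b (a2 * c)) (BQF a2 b (a1 * c))
                     (BQF (a1 * a2) b c).
Proof.
exists 1, 0, 0, (- c), 0, a1, a2, b; split.
- by move=> x y z w; rewrite /bqf_eval /=; ring.
- by rewrite /bqf_eval /=; ring.
- by rewrite /bqf_eval /=; ring.
Qed.

Lemma forms_concordant D a1 a2 b c : D < 0 ->
  forms D (BQF a1 b (a2 * c)) -> forms D (BQF a2 b (a1 * c)) ->
  forms D (BQF (a1 * a2) b c).
Proof.
move=> D0 f1 f2; have a1p := forms_qa_gt0 f1; have a2p := forms_qa_gt0 f2.
move: f1 f2 a1p a2p.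
move=> [/primitive_primeP /= p1 _ d1] [/primitive_primeP /= p2 _ d2] /= a1p a2p.
have dd : disc (BQF (a1 * a2) b c) = D by rewrite -d1 /disc /=; ring.
split=> //; last by apply: posdefP; rewrite ?dd //= mulr_gt0.
apply/primitive_primeP => l pl /= la lb; apply/negP => lc.
move: la; rewrite dvdzE abszM Euclid_dvdM // => /orP[la|la].
  by have := p1 l pl la lb; rewrite dvdz_mull.
by have := p2 l pl la lb; rewrite dvdz_mull.
Qed.

Lemma forms_parity D f : forms D f -> (2 %| qb f - D)%Z.
Proof.
move=> [_ _ <-]; rewrite /disc.
have -> : qb f - (qb f ^+ 2 - 4 * qa f * qc f) =
   2 * (2 * qa f * qc f) - qb f * (qb f - 1) by ring.
rewrite rpredB //; first by rewrite dvdz_mulr.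
move: (qb f) => b.
have [q [->|->]] : exists q, b = 2 * q \/ b = 2 * q + 1.
- by exists (b %/ 2)%Z; lia.
- by rewrite -mulrA dvdz_mulr.
- by rewrite addrK mulrCA dvdz_mulr.
Qed.

(** The congruences on the common middle coefficient b modulo 2 a1 and 2 a2
    are compatible since both old middle coefficients have the parity of D. *)
Lemma concordant2 D f g : D < 0 -> forms D f -> forms D g ->
  coprimez (qa f) (qa g) ->
  exists b c k l, [/\ b = qb f + 2 * qa f * k, b = qb g + 2 * qa g * l,
    proper_equiv f (BQF (qa f) b (qa g * c)) &
    proper_equiv g (BQF (qa g) b (qa f * c))].
Proof.
move=> D0 ff fg cop; have a1p := forms_qa_gt0 ff; have a2p := forms_qa_gt0 fg.
have /dvdzP[h hE] : (2 %| qb g - qb f)%Z.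
  have -> : qb g - qb f = (qb g - D) - (qb f - D) by ring.
  by rewrite rpredB // forms_parity.
have [u [v uv]] := Bezoutz (qa f) (qa g).
rewrite (eqP cop) in uv.
pose b := qb f + 2 * qa f * (u * h).
have bE : b = qb g + 2 * qa g * (- v * h).
  have -> : qb g = qb f + h * 2 by rewrite -hE; ring.
  rewrite /b; transitivity (qb f + 2 * h * (u * qa f + v * qa g) -
    2 * qa g * v * h); first by ring.
  by rewrite uv; ring.
have [_ _ df] := ff; have [_ _ dg] := fg.
pose c1 := qa f * (u * h) ^+ 2 + qb f * (u * h) + qc f.
pose c2 := qa g * (- v * h) ^+ 2 + qb g * (- v * h) + qc g.
have e1 : b ^+ 2 - 4 * qa f * c1 = D.
  by rewrite -df /disc /c1 /b; ring.
have e2 : b ^+ 2 - 4 * qa g * c2 = D.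
  by rewrite -dg /disc /c2 bE; ring.
have e12 : qa f * c1 = qa g * c2.
  have e4 : 4 * (qa f * c1) = 4 * (qa g * c2).
    transitivity (b ^+ 2 - D); first by rewrite -e1; ring.
    by rewrite -e2; ring.
  by move: e4; move: (qa f * c1) (qa g * c2) => ? ?; lia.
have /dvdzP[c c1E] : (qa g %| c1)%Z.
  rewrite -(@Gauss_dvdzr _ (qa f)) ?e12 ?dvdz_mulr //.
  by rewrite coprimez_sym.
have a20 : qa g != 0 by lia.
have c2E : c2 = qa f * c.
  by apply: (mulfI a20); rewrite -e12 c1E; ring.
exists b, c, (u * h), (- v * h); split=> //.
- have fE : f = BQF (qa f) (qb f) (qc f) by case: (f).
  rewrite {1}fE; apply: (@proper_equiv_mid _ _ _ _ _ (u * h)) => //.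
    by lia.
  by rewrite -fE df /disc /= -e1 c1E; ring.
- have gE : g = BQF (qa g) (qb g) (qc g) by case: (g).
  rewrite {1}gE; apply: (@proper_equiv_mid _ _ _ _ _ (- v * h)) => //.
  by rewrite -gE dg /disc /= -e2 c2E; ring.
Qed.

Lemma coprimez_absz (a : int) (n : int) : 0 < n ->
  coprimez a `|n|%N%:Z -> coprimez a n.
Proof. by move=> n0; rewrite gez0_abs //; lia. Qed.

Lemma concordant_exists D f g : D < 0 -> forms D f -> forms D g ->
  exists a1 a2 b c, [/\ coprimez a1 a2, proper_equiv f (BQF a1 b (a2 * c)) &
    proper_equiv g (BQF a2 b (a1 * c))].
Proof.
move=> D0 ff fg; have a1p := forms_qa_gt0 ff.
have [gp _ _] := fg.
have [|g' eg cop] := @proper_equiv_coprime_lead g `|qa f| gp; first by lia.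
have fg' := forms_equiv eg fg.
have {}cop : coprimez (qa f) (qa g') by rewrite coprimez_sym coprimez_absz.
have [b [c [k [l [_ _ h1 h2]]]]] := concordant2 D0 ff fg' cop.
exists (qa f), (qa g'), b, c; split=> //.
exact: proper_equiv_trans eg h2.
Qed.

(** A common middle coefficient for three forms makes associativity visible. *)
Lemma concordant3_exists D f g h : D < 0 ->
  forms D f -> forms D g -> forms D h ->
  exists a1 a2 a3 b c, [/\ proper_equiv f (BQF a1 b (a2 * a3 * c)),
    proper_equiv g (BQF a2 b (a1 * a3 * c)) &
    proper_equiv h (BQF a3 b (a1 * a2 * c))].
Proof.
move=> D0 ff fg fh.
have [a1 [a2 [b [c [cop e1 e2]]]]] := concordant_exists D0 ff fg.
have f1 := forms_equiv e1 ff; have f2 := forms_equiv e2 fg.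
have f12 := forms_concordant D0 f1 f2.
have a1p := forms_qa_gt0 f1; have a2p := forms_qa_gt0 f2.
have a12p := forms_qa_gt0 f12; rewrite /= in a1p a2p a12p.
have [hp _ _] := fh.
have [|h' eh cop'] := @proper_equiv_coprime_lead h `|a1 * a2| hp.
  by move: a12p; move: (a1 * a2) => ?; lia.
have fh' := forms_equiv eh fh.
have {}cop' : coprimez (a1 * a2) (qa h') by rewrite coprimez_sym coprimez_absz.
have [b' [c' [k [l [/= b'E _ h1 h2]]]]] := concordant2 D0 f12 fh' cop'.
rewrite /= in h1 h2.
have f12' := forms_equiv h1 f12.
have [_ _ d1] := f1; have [_ _ d2] := f2; have [_ _ d12'] := f12'.
exists a1, a2, (qa h'), b', c'; split.
- apply: (proper_equiv_trans e1).
  apply: (@proper_equiv_mid _ _ _ _ _ (a2 * k)); first by lia.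
    by rewrite b'E; ring.
  by rewrite [LHS]d1 -d12' /disc /=; ring.
- apply: (proper_equiv_trans e2).
  apply: (@proper_equiv_mid _ _ _ _ _ (a1 * k)); first by lia.
    by rewrite b'E; ring.
  by rewrite [LHS]d2 -d12' /disc /=; ring.
- exact: proper_equiv_trans eh h2.
Qed.

(** * Finiteness of the number of classes *)

(** Gauss reduction: make |b| <= a by a shift, and swap as long as c < a. *)
Lemma reduced_exists D f : D < 0 -> forms D f ->
  exists2 g, proper_equiv f g &
    [/\ `|qa g| <= - D, `|qb g| <= - D & `|qc g| <= - D].
Proof.
move=> D0; have [n] := ubnP `|qa f|%N; elim: n f => // n IH f fn ff.
have a0 := forms_qa_gt0 ff.
pose k := - ((qb f + qa f) %/ (2 * qa f))%Z.
pose g := BQF (qa f) (qb f + 2 * qa f * k) (qa f * k ^+ 2 + qb f * k + qc f).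
have eg : proper_equiv f g.
  have fE : f = BQF (qa f) (qb f) (qc f) by case: (f).
  by rewrite {1}fE; apply: proper_equiv_shift.
have bE : qb g = ((qb f + qa f) %% (2 * qa f))%Z - qa f.
  have := divz_eq (qb f + qa f) (2 * qa f).
  move=> /(congr1 (fun z => z - qa f)); rewrite addrK /g /= /k => E.
  rewrite {1}E; ring.
have a20 : 2 * qa f != 0 by lia.
have b1 : - qa g <= qb g <= qa g.
  have := modz_ge0 (qb f + qa f) a20; have := ltz_mod (qb f + qa f) a20.
  rewrite bE /=; lia.
have fg := forms_equiv eg ff; have [_ _ dg] := fg.
have [ca|ac] := ltP (qc g) (qa g).
  have es : proper_equiv g (BQF (qc g) (- qb g) (qa g)).
    exact: proper_equiv_swap.
  have fg' := forms_equiv es fg.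
  have c0 := forms_qa_gt0 fg'; rewrite [qa (BQF _ _ _)]/= in c0.
  have [|h eh hD] := IH (BQF (qc g) (- qb g) (qa g)) _ fg'.
    have ag : qa g = qa f by [].
    by move: fn ca c0; rewrite -ag /=; move: (qc g) (qa g) => ? ?; lia.
  by exists h => //; apply: proper_equiv_trans eg (proper_equiv_trans es eh).
exists g => //.
have a0' : 0 < qa g by [].
clearbody g; clear -dg b1 ac a0' D0.
move: dg b1 ac a0'; rewrite /disc; move: (qa g) (qb g) (qc g) => a b c.
move=> dg /andP[b1 b2] ac a0'.
have bb : b * b <= a * c.
  apply: (@le_trans _ _ (a * a)); last by rewrite ler_pM2l.
  have : 0 <= (a - b) * (a + b) by apply: mulr_ge0; lia.
  have -> : (a - b) * (a + b) = a * a - b * b by ring.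
  by rewrite subr_ge0.
have acD : a * c <= - D.
  have : D = b * b - 4 * (a * c) by rewrite -dg; ring.
  have : 0 < a * c by rewrite mulr_gt0 //; lia.
  by move: bb; move: (a * c) (b * b) => ? ?; lia.
have cac : c <= a * c.
  have -> : a * c = c + (a - 1) * c by ring.
  by rewrite lerDl mulr_ge0 //; lia.
by move: (a * c) acD cac => ? ? ?; split; lia.
Qed.

(** * The class group as a finite type *)

Definition bqf_opp (f : bqf) := BQF (qa f) (- qb f) (qc f).

(** The class group by its properties only, so that what follows does not depend
    on how classes are encoded. *)
Record class_group (D : int) := ClassGroup {
  cg_type :> finGroupType;
  cg_rep : cg_type -> bqf;
  cg_idx : bqf -> cg_type;
  cg_repP : forall C, forms D (cg_rep C);
  cg_idxP : forall f g, forms D f -> forms D g ->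
    (cg_idx f = cg_idx g <-> proper_equiv f g);
  cg_repK : forall C, cg_idx (cg_rep C) = C;
  cg_mulP : forall f g h, forms D f -> forms D g -> forms D h ->
    direct_composition f g h -> (cg_idx f * cg_idx g)%g = cg_idx h;
  cg_oneE : 1%g = cg_idx (principal_form D);
  cg_invE : forall f, forms D f -> ((cg_idx f)^-1)%g = cg_idx (bqf_opp f);
  cg_mulC : commutative (@mulg cg_type)
}.

Lemma forms_opp D f : D < 0 -> forms D f -> forms D (bqf_opp f).
Proof.
move=> D0 ff; have a0 := forms_qa_gt0 ff; move: ff => [/primitiveP fp _ fD].
have dD : disc (bqf_opp f) = D by rewrite -fD /disc /=; ring.
split=> //; last by apply: posdefP; rewrite ?dD.
by apply/primitiveP => d da /=; rewrite rpredN => db dc; exact: fp.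
Qed.

Lemma proper_equiv_opp f g : proper_equiv f g ->
  proper_equiv (bqf_opp f) (bqf_opp g).
Proof.
move=> [s [t [u [v [d E]]]]]; exists s, (- t), (- u), v; split.
  by rewrite -d; ring.
have oppE h x y : bqf_eval (bqf_opp h) x y = bqf_eval h x (- y).
  by rewrite /bqf_eval /=; ring.
by move=> x y; rewrite !oppE E; congr (bqf_eval f _ _); ring.
Qed.

Lemma principal_formP D : D < 0 ->
  ((D = 0 %[mod 4])%Z \/ (D = 1 %[mod 4])%Z) ->
  exists b c, principal_form D = BQF 1 b c /\ forms D (BQF 1 b c).
Proof.
move=> D0 D4.
have [b [c [-> dE]]] : exists b c, principal_form D = BQF 1 b c /\
    disc (BQF 1 b c) = D.
  rewrite /principal_form /disc; case: D4 => D4.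
    have -> : (2 %| D)%Z by lia.
    by exists 0, (- (D %/ 4)%Z); split=> //=; lia.
  have -> : (2 %| D)%Z = false by lia.
  by exists 1, ((1 - D) %/ 4)%Z; split=> //=; lia.
exists b, c; split=> //; split=> //; last by apply: posdefP; rewrite ?dE.
by apply/primitiveP => d /=.
Qed.

(** Forms with leading coefficient 1 form one class: the middle coefficients
    have the parity of the discriminant. *)
Lemma lead1_equiv D b c b' c' : forms D (BQF 1 b c) -> forms D (BQF 1 b' c') ->
  proper_equiv (BQF 1 b c) (BQF 1 b' c').
Proof.
move=> f1 f2; have [_ _ d1] := f1; have [_ _ d2] := f2.
have /dvdzP[k kE] : (2 %| b' - b)%Z.
  have -> : b' - b = (b' - D) - (b - D) by ring.
  by rewrite rpredB //; [exact: (forms_parity f2)|exact: (forms_parity f1)].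
apply: (@proper_equiv_mid _ _ _ _ _ k) => //; last by rewrite d1 d2.
have -> : b' = b + (b' - b) by ring.
by rewrite kE; ring.
Qed.

Section Build.
Variable D : int.
Hypothesis D0 : D < 0.
Hypothesis D4 : (D = 0 %[mod 4])%Z \/ (D = 1 %[mod 4])%Z.

Let n := `|D|.*2.+1.
Let code := ('I_n * 'I_n * 'I_n)%type.
Let dec (t : code) : bqf :=
  BQF ((t.1.1 : nat)%:Z + D) ((t.1.2 : nat)%:Z + D) ((t.2 : nat)%:Z + D).

Lemma dec_surj f : forms D f -> exists t, proper_equiv f (dec t).
Proof.
move=> /(reduced_exists D0)[[a b c] e /= [ha hb hc]].
have ba z : `|z| <= - D -> (`|z - D| < n)%N by rewrite /n => ?; lia.
exists (Ordinal (ba _ ha), Ordinal (ba _ hb), Ordinal (ba _ hc)).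
rewrite /dec /=.
have ab z : `|z| <= - D -> `|z - D|%N%:Z + D = z by move=> ?; lia.
by rewrite !ab.
Qed.

(* depends only on the class of f *)
Let can (f : bqf) : option code := [pick t | `[<proper_equiv f (dec t)>]].

Lemma can_eq f g : proper_equiv f g -> can f = can g.
Proof.
move=> e; apply: eq_pick => t; apply/asboolP/asboolP => h.
  exact: proper_equiv_trans (proper_equiv_sym e) h.
exact: proper_equiv_trans e h.
Qed.

Definition class_rep :=
  {t : code | `[<forms D (dec t)>] && (can (dec t) == Some t)}.
HB.instance Definition _ := Finite.on class_rep.
HB.instance Definition _ := SubType.on class_rep.
Local Notation T := class_rep.
Let rep (C : T) := dec (val C).

Lemma rep_forms C : forms D (rep C).
Proof. by rewrite /rep; have := valP C => /= /andP[h _]; apply/asboolP. Qed.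

Lemma rep_surj f : forms D f -> exists C : T, proper_equiv f (rep C).
Proof.
move=> ff; case: (@pickP _ (fun t => `[<proper_equiv f (dec t)>])) => [t ht|h0].
  have e : proper_equiv f (dec t) by apply/asboolP.
  have cE : can f = can (dec t) := can_eq e.
  case E : (can f) => [u|]; last first.
    move: E; rewrite /can; case: pickP => // h0 _.
    by have := h0 t; rewrite ht.
  have eu : proper_equiv f (dec u).
    by move: E; rewrite /can; case: pickP => // w /asboolP ew [<-].
  have hu : `[<forms D (dec u)>] && (can (dec u) == Some u).
    apply/andP; split; first by apply/asboolP; exact: forms_equiv eu ff.
    by rewrite -(can_eq eu) E.
  by exists (Sub u hu); rewrite /rep SubK.
by have [t e] := dec_surj ff; have := h0 t; rewrite /= asboolT.
Qed.

Lemma rep_inj C C' : proper_equiv (rep C) (rep C') -> C = C'.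
Proof.
move=> e; apply: val_inj.
have /andP[_ /eqP h1] := valP C; have /andP[_ /eqP h2] := valP C'.
by have := can_eq e; rewrite /rep h1 h2 => -[].
Qed.

(** Composition is computed on concordant forms, where the axioms are
    identities in the leading coefficients; direct_composition_uniq makes it
    independent of the choices. *)
Lemma class_group_exists : inhabited (class_group D).
Proof.
have [pb [pc [pE pF]]] := principal_formP D0 D4.
have [C0 _] := rep_surj pF.
have idx_ex f : exists C : T, forms D f -> proper_equiv f (rep C).
  have [ff|nf] := pselect (forms D f); last by exists C0.
  by have [C e] := rep_surj ff; exists C.
have [idx idxP] := choice idx_ex.
have idx_eq f g : forms D f -> forms D g ->
    (idx f = idx g <-> proper_equiv f g).
  move=> ff fg; split=> [e|e].
    apply: proper_equiv_trans (idxP f ff) _; rewrite e.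
    exact: proper_equiv_sym (idxP g fg).
  apply: rep_inj; apply: proper_equiv_trans (proper_equiv_sym (idxP f ff)) _.
  exact: proper_equiv_trans e (idxP g fg).
have repK C : idx (rep C) = C.
  by apply: rep_inj; apply: proper_equiv_sym; apply: idxP; apply: rep_forms.
have idxE f a b c : forms D f -> proper_equiv f (BQF a b c) ->
   idx f = idx (BQF a b c) /\ forms D (BQF a b c).
  move=> ff e; have fg := forms_equiv e ff; split=> //.
  exact/idx_eq.
have mul_ex (C : T * T) : exists E : T, exists h,
    [/\ forms D h, direct_composition (rep C.1) (rep C.2) h & E = idx h].
  have f1 := rep_forms C.1; have f2 := rep_forms C.2.
  have [a1 [a2 [b [c [_ e1 e2]]]]] := concordant_exists D0 f1 f2.
  have g1 := forms_equiv e1 f1; have g2 := forms_equiv e2 f2.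
  have g := forms_concordant D0 g1 g2.
  exists (idx (BQF (a1 * a2) b c)), (BQF (a1 * a2) b c); split=> //.
  have H := direct_composition_concordant a1 a2 b c.
  have H1 := direct_composition_equivl D0 g1 g2 g (proper_equiv_sym e1) H.
  apply: direct_composition_sym.
  apply: (direct_composition_equivl D0 g2 f1 g (proper_equiv_sym e2)).
  exact: direct_composition_sym.
have [mul' mulP'] := choice mul_ex.
pose mul C C' := mul' (C, C').
have mulP f g h : forms D f -> forms D g -> forms D h ->
    direct_composition f g h -> mul (idx f) (idx g) = idx h.
  move=> ff fg fh H; rewrite /mul; have [h' [fh' H' ->]] := mulP' (idx f, idx g).
  apply/idx_eq => //; apply: (direct_composition_uniq D0 _ _ fh' fh H').
  - exact: rep_forms.
  - exact: rep_forms.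
  have e1 := idxP f ff; have e2 := idxP g fg.
  have H1 := direct_composition_equivl D0 ff fg fh e1 H.
  apply: direct_composition_sym.
  apply: (direct_composition_equivl D0 fg (rep_forms _) fh e2).
  exact: direct_composition_sym.
have mul_conc a1 a2 b c : forms D (BQF a1 b (a2 * c)) ->
    forms D (BQF a2 b (a1 * c)) ->
    mul (idx (BQF a1 b (a2 * c))) (idx (BQF a2 b (a1 * c))) =
    idx (BQF (a1 * a2) b c).
  move=> f1 f2; apply: mulP => //; first exact: forms_concordant.
  exact: direct_composition_concordant.
have mulA : associative mul.
  move=> C1 C2 C3.
  have [a1 [a2 [a3 [b [c [e1 e2 e3]]]]]] :=
    concordant3_exists D0 (rep_forms C1) (rep_forms C2) (rep_forms C3).
  have [i1 g1] := idxE _ _ _ _ (rep_forms C1) e1.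
  have [i2 g2] := idxE _ _ _ _ (rep_forms C2) e2.
  have [i3 g3] := idxE _ _ _ _ (rep_forms C3) e3.
  rewrite -(repK C1) -(repK C2) -(repK C3) i1 i2 i3.
  have g12 : forms D (BQF (a1 * a2) b (a3 * c)).
    by apply: forms_concordant => //; rewrite mulrA.
  have g23 : forms D (BQF (a2 * a3) b (a1 * c)).
    by apply: forms_concordant => //; rewrite mulrCA mulrA.
  have -> : mul (idx (BQF a1 b (a2 * a3 * c))) (idx (BQF a2 b (a1 * a3 * c))) =
            idx (BQF (a1 * a2) b (a3 * c)).
    by rewrite -!mulrA mul_conc // !mulrA.
  have -> : mul (idx (BQF a2 b (a1 * a3 * c))) (idx (BQF a3 b (a1 * a2 * c))) =
            idx (BQF (a2 * a3) b (a1 * c)).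
    have -> : a1 * a3 * c = a3 * (a1 * c) by ring.
    have -> : a1 * a2 * c = a2 * (a1 * c) by ring.
    by rewrite mul_conc // mulrCA mulrA.
  by rewrite !mul_conc // mulrA.
have mulC : commutative mul.
  move=> C1 C2; rewrite -(repK C1) -(repK C2).
  have [h [fh H E]] := mulP' (C1, C2).
  rewrite (mulP _ _ _ _ _ fh H) ?(mulP _ _ _ _ _ fh (direct_composition_sym H)) //;
  exact: rep_forms.
have opp_ok f : forms D f -> idx (bqf_opp (rep (idx f))) = idx (bqf_opp f).
  move=> ff; apply/idx_eq; do ?[exact: forms_opp|apply: forms_opp => //; exact: rep_forms].
  by apply: proper_equiv_opp; apply: proper_equiv_sym; apply: idxP.
pose inv C := idx (bqf_opp (rep C)).
pose one := idx (principal_form D).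
have lead1 b c : disc (BQF 1 b c) = D -> forms D (BQF 1 b c).
  move=> d1; split=> //; last by apply: posdefP; rewrite ?d1.
  by apply/primitiveP => d /=.
have mul1 : left_id one mul.
  move=> C; rewrite -(repK C) /one pE; have := rep_forms C.
  case: (rep C) => a b c fC; have [_ _ dC] := fC.
  have f1 : forms D (BQF 1 b (a * c)).
    by apply: lead1; rewrite -dC /disc /=; ring.
  have -> : idx (BQF 1 pb pc) = idx (BQF 1 b (a * c)).
    by apply/idx_eq => //; exact: (lead1_equiv pF).
  by have := mul_conc 1 a b c f1; rewrite !mul1r => ->.
have mulV : left_inverse one inv mul.
  move=> C; rewrite /inv -{2}(repK C) /one pE; have := rep_forms C.
  case: (rep C) => a b c fC; have [_ _ dC] := fC.
  have es : proper_equiv (bqf_opp (BQF a b c)) (BQF c b a).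
    by have := proper_equiv_swap a (- b) c; rewrite opprK.
  have fs := forms_equiv es (forms_opp D0 fC).
  have -> : idx (bqf_opp (BQF a b c)) = idx (BQF c b a).
    by apply/idx_eq => //; exact: forms_opp.
  have := mul_conc c a b 1; rewrite !mulr1 => -> //.
  have e1 : proper_equiv (BQF (c * a) b 1) (BQF 1 (- b) (c * a)).
    exact: proper_equiv_swap.
  have f1 : forms D (BQF 1 (- b) (c * a)).
    by apply: lead1; rewrite -dC /disc /=; ring.
  have f2 := forms_equiv (proper_equiv_sym e1) f1.
  apply/idx_eq => //; apply: proper_equiv_trans e1 _.
  exact: lead1_equiv f1 pF.
pose GT : finGroupType :=
  HB.pack_for finGroupType T (Finite_isGroup.Build T mulA mul1 mulV).
split; apply: (@ClassGroup D GT rep idx) => //.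
exact: rep_forms.
Qed.
End Build.

(** * Representation numbers *)

Definition int_box (B : nat) : seq int :=
  [seq i%:Z - B%:Z | i <- iota 0 B.*2.+1].

Definition box (B : nat) : seq (int * int) :=
  [seq (x, y) | x <- int_box B, y <- int_box B].

Lemma mem_int_box B x : (x \in int_box B) = (`|x| <= B%:Z).
Proof.
apply/mapP/idP => [[k]|xB].
  by rewrite mem_iota /= => kB ->; lia.
exists (absz (x + B%:Z)); first by rewrite mem_iota; lia.
lia.
Qed.

Lemma uniq_int_box B : uniq (int_box B).
Proof. by rewrite map_inj_uniq ?iota_uniq // => i j; lia. Qed.

Lemma mem_box B v : (v \in box B) = (`|v.1| <= B%:Z) && (`|v.2| <= B%:Z).
Proof.
case: v => x y; rewrite -!mem_int_box /=; apply/allpairsP/andP.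
  by move=> [[x' y']] /= [hx hy [-> ->]].
by move=> [hx hy]; exists (x, y).
Qed.

Lemma uniq_box B : uniq (box B).
Proof.
by apply: allpairs_uniq; rewrite ?uniq_int_box // => -[? ?] [? ?] _ _ [-> ->].
Qed.

(** Completing the square bounds both coordinates of a solution of f = n. *)
Definition sol_bound (f : bqf) (n : nat) : nat :=
  ((`|qa f| + `|qc f|) * n * 4)%N.

Definition sols (f : bqf) (n : nat) : seq (int * int) :=
  [seq v <- box (sol_bound f n) | bqf_eval f v.1 v.2 == n%:Z].

Definition rnum (f : bqf) (n : nat) : nat := size (sols f n).

Lemma uniq_sols f n : uniq (sols f n).
Proof. by rewrite filter_uniq // uniq_box. Qed.

Lemma sol_bounded D f n x y : D < 0 -> forms D f ->
  bqf_eval f x y = n%:Z -> (x, y) \in box (sol_bound f n).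
Proof.
move=> D0 ff E; rewrite mem_box /=.
have a0 := forms_qa_gt0 ff; have [_ pd dE] := ff.
have c0 : 0 < qc f.
  by have := pd 0 1 isT; rewrite /bqf_eval !expr2 !(mulr0, mulr1, add0r, mul0r).
have sq (z : int) m : z * z <= m%:Z -> `|z| <= m%:Z.
  by move=> h; have [z0|] := ler0P z; nia.
have yb : y * y <= (4 * `|qa f| * n)%N%:Z.
  have <- : 4 * qa f * bqf_eval f x y = (4 * `|qa f| * n)%N%:Z.
    by rewrite E !PoszM gez0_abs // ltW.
  have -> : 4 * qa f * bqf_eval f x y =
     (2 * qa f * x + qb f * y) ^+ 2 + (- D - 1) * y ^+ 2 + y * y.
    by rewrite -dE /disc /bqf_eval; ring.
  rewrite lerDr addr_ge0 ?sqr_ge0 // mulr_ge0 ?sqr_ge0 //; lia.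
have xb : x * x <= (4 * `|qc f| * n)%N%:Z.
  have <- : 4 * qc f * bqf_eval f x y = (4 * `|qc f| * n)%N%:Z.
    by rewrite E !PoszM gez0_abs // ltW.
  have -> : 4 * qc f * bqf_eval f x y =
     (2 * qc f * y + qb f * x) ^+ 2 + (- D - 1) * x ^+ 2 + x * x.
    by rewrite -dE /disc /bqf_eval; ring.
  rewrite lerDr addr_ge0 ?sqr_ge0 // mulr_ge0 ?sqr_ge0 //; lia.
have := sq _ _ xb; have := sq _ _ yb; rewrite /sol_bound mulnDl.
by move=> h1 h2; apply/andP; split; nia.
Qed.

Lemma mem_sols D f n v : D < 0 -> forms D f ->
  (v \in sols f n) = (bqf_eval f v.1 v.2 == n%:Z).
Proof.
move=> D0 ff; rewrite mem_filter; case: eqP => //= E.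
by case: v E => x y E; exact: sol_bounded D0 ff E.
Qed.

Lemma rnum_bij D D' f g (P : pred (int * int)) (phi : int * int -> int * int)
    m n : D < 0 -> forms D f -> D' < 0 -> forms D' g -> injective phi ->
  (forall v, bqf_eval g v.1 v.2 = n%:Z ->
     bqf_eval f (phi v).1 (phi v).2 = m%:Z /\ P (phi v)) ->
  (forall w, bqf_eval f w.1 w.2 = m%:Z -> P w ->
     exists2 v, w = phi v & bqf_eval g v.1 v.2 = n%:Z) ->
  count P (sols f m) = rnum g n.
Proof.
move=> D0 ff D0' fg inj h1 h2; rewrite -size_filter /rnum -[RHS](size_map phi).
apply: perm_size; apply: uniq_perm.
- by rewrite filter_uniq // uniq_sols.
- by rewrite map_inj_uniq // uniq_sols.
move=> w; rewrite mem_filter (mem_sols _ _ D0 ff); apply/andP/mapP.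
  move=> [Pw /eqP E]; have [v wE gE] := h2 w E Pw.
  by exists v => //; rewrite (mem_sols _ _ D0' fg) gE.
move=> [v]; rewrite (mem_sols _ _ D0' fg) => /eqP /h1[E Pw] ->.
by rewrite E.
Qed.

Lemma rnum_equiv D f g n : D < 0 -> forms D f -> proper_equiv f g ->
  rnum f n = rnum g n.
Proof.
move=> D0 ff e; have fg := forms_equiv e ff.
have [s [t [u [v [d E]]]]] := e.
rewrite /rnum -[LHS]count_predT.
apply: (@rnum_bij D D _ _ _
  (fun w => (s * w.1 + t * w.2, u * w.1 + v * w.2))) => //.
- have cx x y : x = v * (s * x + t * y) - t * (u * x + v * y).
    by rewrite -[LHS]mul1r -d; ring.
  have cy x y : y = s * (u * x + v * y) - u * (s * x + t * y).
    by rewrite -[LHS]mul1r -d; ring.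
  move=> [x y] [x' y'] /= [e1 e2].
  congr (_, _).
    by apply: (etrans (cx x y)); rewrite e1 e2 -cx.
  by apply: (etrans (cy x y)); rewrite e1 e2 -cy.
- by move=> [x y] /=; rewrite E.
- move=> [x y] /= h _; exists (v * x - t * y, s * y - u * x) => /=.
    by congr (_, _); rewrite -[LHS]mul1r -d; ring.
  by rewrite E -h; congr (bqf_eval f _ _); rewrite -[RHS]mul1r -d; ring.
Qed.

Lemma rnum_opp D f n : D < 0 -> forms D f -> rnum (bqf_opp f) n = rnum f n.
Proof.
move=> D0 ff; have fo := forms_opp D0 ff.
rewrite /rnum -[LHS]count_predT.
apply: (@rnum_bij D D _ _ _ (fun w => (w.1, - w.2))) => //.
- by move=> [x y] [x' y'] /= [-> /oppr_inj ->].
- by move=> [x y] /= <-; split=> //; rewrite /bqf_eval /=; ring.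
- move=> [x y] /= <- _; exists (x, - y); first by rewrite /= opprK.
  by rewrite /bqf_eval /=; ring.
Qed.

Lemma rnum_gt0 D f n : D < 0 -> forms D f ->
  (0 < rnum f n)%N <-> exists x y, bqf_eval f x y = n%:Z.
Proof.
move=> D0 ff; rewrite /rnum -has_predT; split.
  move=> /hasP[[x y]]; rewrite (mem_sols _ _ D0 ff) => /eqP E _.
  by exists x, y.
move=> [x [y E]]; apply/hasP; exists (x, y) => //.
by rewrite (mem_sols _ _ D0 ff) E.
Qed.

(** Scaling by q is a bijection onto the solutions divisible by q. *)
Lemma rnum_mul_sq D f (q n : nat) : D < 0 -> forms D f -> (0 < q)%N ->
  count (fun v => (q%:Z %| v.1)%Z && (q%:Z %| v.2)%Z) (sols f (n * q ^ 2)) =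
  rnum f n.
Proof.
move=> D0 ff q0; have q0' : q%:Z != 0 by lia.
apply: (@rnum_bij D D _ _ _ (fun w => (q%:Z * w.1, q%:Z * w.2))) => //.
- by move=> [x y] [x' y'] /= [/(mulfI q0') -> /(mulfI q0') ->].
- move=> [x y] /= h; split; last by rewrite !dvdz_mulr.
  rewrite PoszM -h -mulnn PoszM.
  by rewrite /bqf_eval; ring.
- move=> [x y] /= h /andP[/dvdzP[x' xE] /dvdzP[y' yE]].
  exists (x', y') => /=; first by rewrite xE yE; congr (_, _); ring.
  apply: (mulIf (expf_neq0 2 q0')).
  transitivity (bqf_eval f x y).
    by rewrite xE yE /bqf_eval; ring.
  by rewrite h PoszM -mulnn PoszM; ring.
Qed.

Lemma rnum_dvd_sq D f (q n : nat) : D < 0 -> forms D f -> prime q ->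
  count (fun v => (q%:Z %| v.1)%Z && (q%:Z %| v.2)%Z) (sols f (n * q)) =
  if (q %| n)%N then rnum f (n %/ q) else 0%N.
Proof.
move=> D0 ff pq; have q0 := prime_gt0 pq; case: ifP => [/dvdnP[m ->]|qn].
  by rewrite mulnK // -(rnum_mul_sq _ D0 ff q0) -mulnA mulnn.
apply/eqP; rewrite -leqn0 leqNgt -has_count; apply/negP => /hasP[[x y]] /=.
rewrite (mem_sols _ _ D0 ff) /= => /eqP E.
move=> /andP[/dvdzP[x' xE] /dvdzP[y' yE]].
have : (q%:Z %| n%:Z)%Z.
  have q0' : q%:Z != 0 by lia.
  apply/dvdzP; exists (bqf_eval f x' y'); apply: (mulIf q0').
  by rewrite -PoszM -E xE yE /bqf_eval; ring.
by rewrite dvdzE !absz_nat qn.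
Qed.

(** * Hecke relations *)

Lemma Euclid_dvdzM (q : nat) (u v : int) : prime q ->
  (q%:Z %| u * v)%Z = (q%:Z %| u)%Z || (q%:Z %| v)%Z.
Proof. by move=> pq; rewrite !dvdzE abszM absz_nat Euclid_dvdM. Qed.

Lemma forms_prime_lead D (q : nat) b c : D < 0 -> prime q -> ~~ (q%:Z %| D)%Z ->
  disc (BQF q%:Z b c) = D -> forms D (BQF q%:Z b c).
Proof.
move=> D0 pq qD dE; have q0 := prime_gt0 pq; split=> //; last first.
  by apply: posdefP; rewrite ?dE.
apply/primitive_primeP => l pl /=; rewrite dvdzE !absz_nat => lq lb.
move: lq lb; rewrite dvdn_prime2 // => /eqP-> qb.
case/negP: qD; rewrite -dE /disc /= rpredB //.
  by rewrite expr2 dvdz_mulr.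
by rewrite -mulrA dvdz_mull // dvdz_mulr.
Qed.

(** The solutions of [q a, b, q c] = n q are the vectors of two sublattices
    of index q, on each of which the form is q times another form. *)
Lemma rnum_split_form D (q : nat) a b c n : D < 0 -> prime q ->
  ~~ (q%:Z %| D)%Z ->
  forms D (BQF (q%:Z * a) b (q%:Z * c)) ->
  forms D (BQF a b (q%:Z * (q%:Z * c))) ->
  forms D (BQF (q%:Z * (q%:Z * a)) b c) ->
  (rnum (BQF (q%:Z * a) b (q%:Z * c)) (n * q) +
   (if (q %| n)%N then rnum (BQF (q%:Z * a) b (q%:Z * c)) (n %/ q) else 0) =
   rnum (BQF a b (q%:Z * (q%:Z * c))) n +
   rnum (BQF (q%:Z * (q%:Z * a)) b c) n)%N.
Proof.
move=> D0 pq qD ff f1 f2; have q0 := prime_gt0 pq; have q0' : q%:Z != 0 by lia.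
have qb : ~~ (q%:Z %| b)%Z.
  apply: contra qD => qb; have [_ _ <-] := ff; rewrite /disc /= rpredB //.
    by rewrite expr2 dvdz_mulr.
  by rewrite -!mulrA dvdz_mull // dvdz_mulr.
set f := BQF (q%:Z * a) b (q%:Z * c) in ff *.
rewrite -(rnum_dvd_sq _ D0 ff pq).
pose A := [pred v : int * int | (q%:Z %| v.1)%Z].
pose B := [pred v : int * int | (q%:Z %| v.2)%Z].
have <- : count B (sols f (n * q)) = rnum (BQF a b (q%:Z * (q%:Z * c))) n.
  apply: (@rnum_bij D D _ _ _ (fun w => (w.1, q%:Z * w.2))) => //.
  - by move=> [x y] [x' y'] /= [-> /(mulfI q0') ->].
  - move=> [x y] /= h; split; last by rewrite dvdz_mulr.
    by rewrite PoszM -h /bqf_eval /=; ring.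
  - move=> [x y] /= h /dvdzP[y' yE]; exists (x, y') => /=.
      by rewrite yE; congr (_, _); ring.
    apply: (mulIf q0'); rewrite -PoszM -h yE /bqf_eval /=; ring.
have <- : count A (sols f (n * q)) = rnum (BQF (q%:Z * (q%:Z * a)) b c) n.
  apply: (@rnum_bij D D _ _ _ (fun w => (q%:Z * w.1, w.2))) => //.
  - by move=> [x y] [x' y'] /= [/(mulfI q0') -> ->].
  - move=> [x y] /= h; split; last by rewrite dvdz_mulr.
    by rewrite PoszM -h /bqf_eval /=; ring.
  - move=> [x y] /= h /dvdzP[x' xE]; exists (x', y) => /=.
      by rewrite xE; congr (_, _); ring.
    apply: (mulIf q0'); rewrite -PoszM -h xE /bqf_eval /=; ring.
rewrite [RHS]addnC -count_predUI; congr (_ + _)%N.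
rewrite /rnum; apply/esym/eqP; rewrite -all_count; apply/allP => -[x y].
rewrite (mem_sols _ _ D0 ff) => /eqP /= E.
have : (q%:Z %| b * x * y)%Z.
  have -> : b * x * y = n%:Z * q%:Z - q%:Z * (a * x ^+ 2) - q%:Z * (c * y ^+ 2).
    by rewrite -PoszM -E /bqf_eval /=; ring.
  apply: rpredB; last exact: dvdz_mulr.
  by apply: rpredB; [exact: dvdz_mull|exact: dvdz_mulr].
by rewrite !Euclid_dvdzM // (negPf qb) /=.
Qed.

Section Hecke.
Variables (D : int) (G : class_group D).
Hypothesis D0 : D < 0.

Definition cnum (C : G) (n : nat) : nat := rnum (cg_rep C) n.

Lemma cnum_idx f n : forms D f -> cnum (cg_idx G f) n = rnum f n.
Proof.
move=> ff; apply: (rnum_equiv _ D0 (cg_repP _)).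
by apply/(@cg_idxP D G) => //; [exact: cg_repP|rewrite cg_repK].
Qed.

Lemma cnum_inv C n : cnum (C^-1)%g n = cnum C n.
Proof.
have fC := cg_repP C; rewrite -{1}(cg_repK C) cg_invE // cnum_idx.
  exact: rnum_opp fC.
exact: forms_opp.
Qed.

(** Writing C = Q E with Q the class of [q, b, c], a concordant pair and a shift
    give a form [q a, b', q c'] in C, to which rnum_split_form applies: its two
    lines modulo q belong to the classes C Q^-1 and C Q. *)
Lemma cnum_split (q : nat) b c : prime q -> ~~ (q%:Z %| D)%Z ->
  disc (BQF q%:Z b c) = D ->
  exists Q : G, forall (C : G) n,
    (cnum C (n * q) + (if (q %| n)%N then cnum C (n %/ q) else 0) =
     cnum (C * Q)%g n + cnum (C * Q^-1)%g n)%N.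
Proof.
move=> pq qD dq; have q0 := prime_gt0 pq; have q0' : q%:Z != 0 by lia.
have fq := forms_prime_lead D0 pq qD dq.
pose Q := cg_idx G (BQF q%:Z b c); exists Q => C n.
pose E := (C * Q^-1)%g.
have [Ep _ _] := cg_repP E.
have [e eE cop] := proper_equiv_coprime_lead Ep q0.
have fe := forms_equiv eE (cg_repP E).
have [|b1 [c1 [k [l [/= b1E _ h1 h2]]]]] := @concordant2 D _ e D0 fq fe.
  by rewrite coprimez_sym.
rewrite /= in h1 h2; set a := qa e in h1 h2 *.
have g1 := forms_equiv h1 fq; have g2 := forms_equiv h2 fe.
have g12 := forms_concordant D0 g1 g2.
have CE : C = cg_idx G (BQF (q%:Z * a) b1 c1).
  rewrite -(cg_mulP _ g1 g2 g12 (direct_composition_concordant _ _ _ _)).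
  have <- : Q = cg_idx G (BQF q%:Z b1 (a * c1)) by apply/cg_idxP.
  have <- : E = cg_idx G (BQF a b1 (q%:Z * c1)).
    rewrite -(cg_repK E); apply/cg_idxP => //; first exact: cg_repP.
    exact: proper_equiv_trans eE h2.
  by rewrite cg_mulC mulgKV.
(* move the second zero of the form modulo q to (0, 1) *)
have qb1 : coprimez b1 q%:Z.
  rewrite coprimezE coprime_sym absz_nat prime_coprime //.
  apply: contra qD => qb; have [_ _ <-] := g1; rewrite /disc /= rpredB //.
    by rewrite expr2 dvdz_mulr // dvdzE absz_nat.
  by rewrite -!mulrA dvdz_mull // dvdz_mulr.
have [u [v uv]] := Bezoutz b1 q%:Z; rewrite (eqP qb1) in uv.
pose k2 := - u * c1; pose b' := b1 + 2 * (q%:Z * a) * k2.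
pose c' := a * k2 ^+ 2 + c1 * v.
have c'E : q%:Z * c' = (q%:Z * a) * k2 ^+ 2 + b1 * k2 + c1.
  rewrite /c' /k2; have -> : q%:Z * (a * (- u * c1) ^+ 2 + c1 * v) =
     q%:Z * a * (- u * c1) ^+ 2 - b1 * (u * c1) + c1 * (u * b1 + v * q%:Z).
    by ring.
  by rewrite uv; ring.
have eF : proper_equiv (BQF (q%:Z * a) b1 c1) (BQF (q%:Z * a) b' (q%:Z * c')).
  by rewrite c'E; exact: proper_equiv_shift.
have fF := forms_equiv eF g12; have [Fp _ dF] := fF.
have a0 : 0 < a by exact: (forms_qa_gt0 g2).
have c0 : 0 < c'.
  have /forms_qa_gt0 /= := forms_equiv (proper_equiv_swap _ _ _) fF.
  by rewrite pmulr_rgt0; lia.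
have e1 : proper_equiv (BQF a b1 (q%:Z * c1)) (BQF a b' (q%:Z * (q%:Z * c'))).
  apply: (@proper_equiv_mid _ _ _ _ _ (q%:Z * k2)).
  - by lia.
  - by rewrite /b'; ring.
  - by have [_ _ ->] := g2; rewrite -dF /disc /=; ring.
have f1 := forms_equiv e1 g2.
have f2' : forms D (BQF c' (- b') (q%:Z * (q%:Z * a))).
  have d2 : disc (BQF c' (- b') (q%:Z * (q%:Z * a))) = D.
    by rewrite -dF /disc /=; ring.
  split=> //; last by apply: posdefP; rewrite ?d2.
  apply/primitive_primeP => m pm /= mc; rewrite rpredN => mb; apply/negP => mq.
  have mqa : (m%:Z %| q%:Z * a)%Z.
    by move: mq; rewrite !Euclid_dvdzM // orbA orbb.
  have mqc : (m%:Z %| q%:Z * c')%Z by apply: dvdz_mull.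
  by have /negP := (primitive_primeP _).1 Fp m pm mqa mb; apply.
have f2 : forms D (BQF (q%:Z * (q%:Z * a)) b' c').
  have := forms_equiv (proper_equiv_swap _ _ _) f2'; by rewrite opprK.
have CF : C = cg_idx G (BQF (q%:Z * a) b' (q%:Z * c')).
  by rewrite CE; apply/cg_idxP.
have E1 : E = cg_idx G (BQF a b' (q%:Z * (q%:Z * c'))).
  rewrite -(cg_repK E); apply/cg_idxP => //; first exact: cg_repP.
  exact: proper_equiv_trans eE (proper_equiv_trans h2 e1).
have E2 : (C * Q)%g = cg_idx G (BQF (q%:Z * (q%:Z * a)) b' c').
  have -> : cg_idx G (BQF (q%:Z * (q%:Z * a)) b' c') =
            cg_idx G (BQF c' (- b') (q%:Z * (q%:Z * a))).
    by apply/cg_idxP => //; exact: proper_equiv_swap.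
  have dq' : disc (BQF q%:Z b' (c' * (q%:Z * a))) = D.
    by rewrite -dF /disc /=; ring.
  have fq' := forms_prime_lead D0 pq qD dq'.
  have QE : Q = cg_idx G (BQF q%:Z b' (c' * (q%:Z * a))).
    apply/cg_idxP => //; apply: (@proper_equiv_mid _ _ _ _ _ (k + a * k2)) => //.
      by rewrite /b' b1E; ring.
    by rewrite dq dq'.
  have fqo := forms_opp D0 fq'.
  have fc : forms D (BQF (c' * q%:Z) (- b') (q%:Z * a)).
    by rewrite mulrC; apply: forms_equiv fF; exact: proper_equiv_swap.
  have := cg_mulP G f2' fqo fc (direct_composition_concordant _ _ _ _).
  rewrite -cg_invE // -QE => H.
  have {H} : (cg_idx G (BQF c' (- b') (q%:Z * (q%:Z * a))) * Q^-1)%g = C.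
    rewrite H CF; apply/cg_idxP => //; rewrite [c' * _]mulrC.
    by apply: proper_equiv_sym; exact: proper_equiv_swap.
  by move=> {1}<-; rewrite mulgKV.
rewrite -/E E1 E2 !cnum_idx // addnC [in RHS]addnC.
rewrite -(rnum_split_form n D0 pq qD fF f1 f2) {1 2}CF !cnum_idx //.
by rewrite addnC.
Qed.

End Hecke.

(** A unimodular change of variables that moves the zero (x, y) modulo q to the
    first basis vector makes the leading coefficient a multiple of q, and the
    factor can be moved to the last coefficient. *)
Lemma isotropic_split D f (q : nat) x y : forms D f -> prime q ->
  (q%:Z %| bqf_eval f x y)%Z -> ~~ ((q%:Z %| x)%Z && (q%:Z %| y)%Z) ->
  exists b c, disc (BQF q%:Z b c) = D.
Proof.
move=> [_ _ fD] pq qf xy.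
have lead s t u v : s * v - t * u = 1 -> (q%:Z %| bqf_eval f s u)%Z ->
    exists b c, disc (BQF q%:Z b c) = D.
  move=> d /dvdzP[a aE]; pose g := bqf_act f s t u v.
  exists (qb g), (a * qc g); have := disc_act f s t u v.
  rewrite d expr1n mul1r fD => <-.
  by rewrite /disc /= aE; ring.
have inv z : ~~ (q%:Z %| z)%Z -> exists u v, u * z + v * q%:Z = 1.
  move=> qz; have : coprimez z q%:Z.
    by rewrite coprimezE coprime_sym absz_nat prime_coprime // -[q]absz_nat -dvdzE.
  by have [u [v uv]] := Bezoutz z q%:Z; move=> /eqP g1; exists u, v; rewrite uv.
case: (boolP (q%:Z %| x)%Z) xy => /= [qx qy|qx _].
  have [u [v uv]] := inv _ qy; apply: (lead (u * x) (-1) 1 0); first by ring.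
  have -> : bqf_eval f (u * x) 1 = u ^+ 2 * bqf_eval f x y +
      q%:Z * (v * (qb f * u * x + qc f * (u * y + 1))).
    rewrite /bqf_eval; have -> : q%:Z * (v * (qb f * u * x + qc f * (u * y + 1))) =
      (v * q%:Z) * (qb f * u * x + qc f * (u * y + 1)) by ring.
    have -> : v * q%:Z = 1 - u * y by rewrite -uv; ring.
    by ring.
  by apply: rpredD; [exact: dvdz_mull|exact: dvdz_mulr].
have [u [v uv]] := inv _ qx; apply: (lead 1 0 (u * y) 1); first by ring.
have -> : bqf_eval f 1 (u * y) = u ^+ 2 * bqf_eval f x y +
    q%:Z * (v * (qb f * u * y + qa f * (u * x + 1))).
  rewrite /bqf_eval; have -> : q%:Z * (v * (qb f * u * y + qa f * (u * x + 1))) =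
    (v * q%:Z) * (qb f * u * y + qa f * (u * x + 1)) by ring.
  have -> : v * q%:Z = 1 - u * x by rewrite -uv; ring.
  by ring.
by apply: rpredD; [exact: dvdz_mull|exact: dvdz_mulr].
Qed.

Definition primitive_at (p : nat) (v : int * int) :=
  ~~ ((p%:Z %| v.1)%Z && (p%:Z %| v.2)%Z).

Lemma gcd_primitive_at (p : nat) m n : prime p ->
  gcdz (gcdz m n) p%:Z = 1 <-> primitive_at p (m, n).
Proof.
move=> pp; have -> : primitive_at p (m, n) = ~~ (p %| gcdn `|m| `|n|)%N.
  by rewrite /primitive_at /= !dvdzE absz_nat dvdn_gcd.
rewrite -prime_coprime // coprime_sym /coprime /gcdz !absz_nat.
by split=> [[->]|/eqP->].
Qed.

Section Hecke2.
Variables (D : int) (G : class_group D).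
Hypothesis D0 : D < 0.
Hypothesis D4 : (D = 0 %[mod 4])%Z \/ (D = 1 %[mod 4])%Z.

(** The form vanishes modulo q only at multiples of q. *)
Lemma cnum_inert (q : nat) : prime q ->
  (forall b c, disc (BQF q%:Z b c) <> D) ->
  forall (C : G) n,
    cnum C (n * q) = if (q %| n)%N then cnum C (n %/ q) else 0%N.
Proof.
move=> pq nq C n; have fC := cg_repP C; rewrite /cnum -(rnum_dvd_sq _ D0 fC pq).
rewrite /rnum; apply/esym/eqP; rewrite -all_count; apply/allP => -[x y].
rewrite (mem_sols _ _ D0 fC) /= => /eqP E.
apply/negPn/negP => xy; have [|b [c dE]] := isotropic_split fC pq _ xy.
  by rewrite E PoszM dvdz_mull.
exact: nq dE.
Qed.

(** A form that represents 1 has leading coefficient 1 up to equivalence. *)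
Lemma cnum_eq1 (C : G) : (0 < cnum C 1)%N = (C == 1%g).
Proof.
have [b [c [pE pF]]] := principal_formP D0 D4.
apply/idP/eqP => [|->]; last first.
  rewrite cg_oneE pE cnum_idx //; apply/(rnum_gt0 _ D0 pF).
  by exists 1, 0; rewrite /bqf_eval /=; ring.
move=> /(rnum_gt0 _ D0 (cg_repP C))[x [y E]].
have xy : gcdz x y = 1.
  have : (gcdz x y %| bqf_eval (cg_rep C) x y)%Z.
    apply: rpredD; first apply: rpredD.
    - by rewrite expr2 mulrA dvdz_mull // dvdz_gcdl.
    - by rewrite dvdz_mull // dvdz_gcdr.
    - by rewrite expr2 mulrA dvdz_mull // dvdz_gcdr.
  by rewrite E dvdz1 /gcdz absz_nat => /eqP->.
have [g eg ga] := proper_equiv_lead (cg_rep C) xy.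
have fg := forms_equiv eg (cg_repP C).
case: g ga eg fg => a b' c' /=; rewrite E => -> eg fg.
rewrite -(cg_repK C) cg_oneE pE; apply/cg_idxP => //; first exact: cg_repP.
by apply: proper_equiv_trans eg _; exact: lead1_equiv fg pF.
Qed.

(** If q is represented at all, the Hecke relation at q and n = 1 leaves the
    classes Q and Q^-1 of the forms with leading coefficient q. *)
Lemma cnum_prime (q : nat) : prime q -> ~~ (q%:Z %| D)%Z ->
  forall C E : G, (0 < cnum C q)%N -> (0 < cnum E q)%N -> E = C \/ E = (C^-1)%g.
Proof.
move=> pq qD C E.
have q1 : (q %| 1)%N = false by rewrite dvdn1; case: q pq {qD} => [|[]].
have [[b [c dE]]|nq] := pselect (exists b c, disc (BQF q%:Z b c) = D).
  have [Q QP] := cnum_split G D0 pq qD dE.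
  have HQ (F : G) : (0 < cnum F q)%N -> F = Q \/ F = (Q^-1)%g.
    have := QP F 1%N; rewrite mul1n q1 addn0 => ->.
    rewrite addn_gt0 !cnum_eq1 => /orP[] /eqP H; [right|left].
      by rewrite -[F](mulgK Q) H mul1g.
    by rewrite -[F](mulgKV Q) H mul1g.
  by move=> /HQ[->|->] /HQ[->|->]; rewrite ?invgK; auto.
have H (F : G) : cnum F q = 0%N.
  rewrite -(mul1n q) cnum_inert ?q1 // => b c dE.
  by apply: nq; exists b, c.
by rewrite H.
Qed.

(** * Proper classes as elements of the class group *)

Definition cls (C : G) : set bqf := class_of (cg_rep C).

Lemma cls_idx f : forms D f -> cls (cg_idx G f) = class_of f.
Proof.
move=> ff; apply: class_of_eq; apply/(@cg_idxP D G) => //; first exact: cg_repP.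
by rewrite cg_repK.
Qed.

Lemma cls_inj : injective cls.
Proof.
move=> C E /class_of_inj e; rewrite -(cg_repK C) -(cg_repK E).
by apply/cg_idxP => //; exact: cg_repP.
Qed.

Lemma cls_surj A : classes D A -> exists C, A = cls C.
Proof. by move=> [f ff ->]; exists (cg_idx G f); rewrite cls_idx. Qed.

Lemma cls_one : class_one D = cls 1%g.
Proof.
have [b [c [pE pF]]] := principal_formP D0 D4.
by rewrite /class_one cg_oneE pE cls_idx.
Qed.

(** The classes of the theorem, as sets of forms, multiply as the elements of
    the class group. *)
Lemma cls_mul C E : class_mul D (cls C) (cls E) = cls (C * E)%g.
Proof.
have [a1 [a2 [b [c [_ e1 e2]]]]] := concordant_exists D0 (cg_repP C) (cg_repP E).
have g1 := forms_equiv e1 (cg_repP C); have g2 := forms_equiv e2 (cg_repP E).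
have g := forms_concordant D0 g1 g2.
have H := direct_composition_concordant a1 a2 b c.
rewrite /cls (class_of_eq e1) (class_of_eq e2).
rewrite (class_mul_class_of D0 g1 g2 g H) -(cls_idx g) -(cg_mulP G g1 g2 g H).
rewrite /cls; congr (class_of (cg_rep (_ * _)%g)).
- rewrite -(cg_repK C); apply/cg_idxP => //; first exact: cg_repP.
  exact: proper_equiv_sym.
- rewrite -(cg_repK E); apply/cg_idxP => //; first exact: cg_repP.
  exact: proper_equiv_sym.
Qed.

Lemma cls_exp C n : class_exp D (cls C) n = cls (C ^+ n)%g.
Proof.
rewrite /class_exp cls_one; case: n => [|n] //.
elim: n => [|n IH] //.
have -> : iterop n.+2 (class_mul D) (cls C) (cls 1%g) =
          class_mul D (cls C) (iterop n.+1 (class_mul D) (cls C) (cls 1%g)) by [].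
by rewrite IH cls_mul -expgS.
Qed.

Lemma has_order4 C : has_order D (cls C) 4 <-> #[C]%g = 4%N.
Proof.
rewrite /has_order cls_exp cls_one; split.
  move=> [_ /cls_inj C4 H]; have dv : (#[C]%g %| 4)%N by rewrite order_dvdn C4.
  have := H #[C]%g; rewrite cls_exp expg_order order_gt0 /= => H'.
  have := dvdn_leq (isT : 0 < 4)%N dv; rewrite leq_eqVlt => /orP[/eqP//|lt].
  by have := H' lt.
move=> o4; split=> //; first by rewrite -o4 expg_order.
move=> m /andP[m0 m4]; rewrite cls_exp => /cls_inj /eqP.
by rewrite -order_dvdn o4 => /(dvdn_leq m0); rewrite leqNgt m4.
Qed.

(** * Completely p-primitive classes *)

Variable p : nat.
Hypothesis pp : prime p.

Lemma Qstar_cls C N : Qstar p (cls C) N <->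
  N != 0 /\ exists v, primitive_at p v /\ bqf_eval (cg_rep C) v.1 v.2 = N.
Proof.
split.
  move=> [f [s [t [u [v [d E]]]]] [N0 [m [n [g H]]]]]; split=> //.
  exists (s * m + t * n, u * m + v * n); split; last by rewrite -E.
  move/(gcd_primitive_at _ _ pp): g; rewrite /primitive_at /=; apply: contra.
  move=> /andP[h1 h2]; apply/andP; split.
    rewrite -[m]mul1r -d.
    have -> : (s * v - t * u) * m = v * (s * m + t * n) - t * (u * m + v * n).
      by ring.
    by apply: rpredB; exact: dvdz_mull.
  rewrite -[n]mul1r -d.
  have -> : (s * v - t * u) * n = s * (u * m + v * n) - u * (s * m + t * n).
    by ring.
  by apply: rpredB; exact: dvdz_mull.
move=> [N0 [[m n] [g H]]]; exists (cg_rep C); first exact: proper_equiv_refl.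
by split=> //; exists m, n; split=> //; apply/gcd_primitive_at.
Qed.

Lemma Q_cls C N : Q (cls C) N <->
  N != 0 /\ exists v, bqf_eval (cg_rep C) v.1 v.2 = N.
Proof.
split.
  move=> [f [s [t [u [v [d E]]]]] [N0 [m [n H]]]]; split=> //.
  by exists (s * m + t * n, u * m + v * n); rewrite -E.
move=> [N0 [[m n] H]]; exists (cg_rep C); first exact: proper_equiv_refl.
by split=> //; exists m, n.
Qed.

(** The representations of n p that are not p-primitive are p times those of
    n / p. *)
Lemma Qstar_clsM C (n : nat) : (0 < n)%N -> Qstar p (cls C) (n * p)%N%:Z <->
  ((if (p %| n)%N then cnum C (n %/ p) else 0) < cnum C (n * p))%N.
Proof.
move=> n0; have fC := cg_repP C; have p0 := prime_gt0 pp.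
rewrite Qstar_cls /cnum -(rnum_dvd_sq _ D0 fC pp).
set P : pred (int * int) := (fun v : int * int => (_ : bool)).
have -> : (count P (sols (cg_rep C) (n * p)) < rnum (cg_rep C) (n * p))%N =
  has (primitive_at p) (sols (cg_rep C) (n * p)).
  rewrite /rnum -(count_predC P (sols _ _)) -[X in (X < _)%N]addn0 ltn_add2l.
  by rewrite has_count.
split.
  move=> [_ [v [vp E]]]; apply/hasP; exists v => //.
  by rewrite (mem_sols _ _ D0 fC) E.
move=> /hasP[v]; rewrite (mem_sols _ _ D0 fC) => /eqP E vp.
split; last by exists v.
by rewrite eqz_nat -lt0n muln_gt0 n0.
Qed.

Lemma Qstar_clsN C (n : nat) : (0 < n)%N -> ~~ (p %| n)%N ->
  Qstar p (cls C) n%:Z <-> (0 < cnum C n)%N.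
Proof.
move=> n0 pn; have fC := cg_repP C; rewrite Qstar_cls; split.
  by move=> [_ [[x y] [_ E]]]; apply/(rnum_gt0 _ D0 fC); exists x, y.
move=> /(rnum_gt0 _ D0 fC)[x [y E]]; split; first by rewrite eqz_nat -lt0n.
exists (x, y); split=> //; rewrite /primitive_at /=.
apply: contra pn => /andP[px py].
have : (p%:Z %| n%:Z)%Z by rewrite -E; apply: rpredD; [apply: rpredD|];
  rewrite ?expr2 ?mulrA; exact: dvdz_mull.
by rewrite dvdzE !absz_nat.
Qed.

End Hecke2.

Section Main.
Variables (D : int) (G : class_group D) (p : nat).
Hypothesis D0 : D < 0.
Hypothesis D4 : (D = 0 %[mod 4])%Z \/ (D = 1 %[mod 4])%Z.
Hypothesis pp : prime p.

Definition hecke (P : G) := forall (C : G) n,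
  (cnum C (n * p) + (if (p %| n)%N then cnum C (n %/ p) else 0) =
   cnum (C * P)%g n + cnum (C * P^-1)%g n)%N.

Lemma heckeV P : hecke P -> hecke (P^-1)%g.
Proof. by move=> H C n; rewrite H invgK addnC. Qed.

Section Relation.
Variable P : G.
Hypothesis HP : hecke P.

Let p0 : (0 < p)%N. Proof. exact: prime_gt0. Qed.

Lemma hecke_coprime C n : ~~ (p %| n)%N ->
  cnum C (n * p) = (cnum (C * P)%g n + cnum (C * P^-1)%g n)%N.
Proof. by move=> pn; rewrite -HP (negPf pn) addn0. Qed.

Lemma hecke_mul C n :
  (cnum C (n * p * p) + cnum C n =
   cnum (C * P)%g (n * p) + cnum (C * P^-1)%g (n * p))%N.
Proof. by rewrite -HP dvdn_mull // mulnK. Qed.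

(** The relations at p give
    r_C(p^2) = r_C(1) + r_(C P^2)(1) + r_(C P^-2)(1). *)
Lemma Qstar_psq C : Qstar p (cls C) (p%:Z ^+ 2) <->
  (C * P * P = 1)%g \/ (C * P^-1 * P^-1 = 1)%g.
Proof.
have p1 : (p %| 1)%N = false by rewrite dvdn1; case: p pp => [|[]].
have -> : p%:Z ^+ 2 = (1 * p * p)%N%:Z by rewrite mul1n PoszM expr2.
rewrite (Qstar_clsM D0 pp) ?mul1n // dvdnn divnn p0.
have := hecke_mul C 1; rewrite !mul1n.
have := hecke_coprime (C * P)%g (negbT p1).
have := hecke_coprime (C * P^-1)%g (negbT p1).
rewrite !mul1n mulgK mulgKV => -> -> E.
have -> : (cnum C 1 < cnum C (p * p))%N =
  (0 < cnum (C * P * P)%g 1 + cnum (C * P^-1 * P^-1)%g 1)%N by lia.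
rewrite addn_gt0 !cnum_eq1 //; split=> [/orP[]/eqP|[->|->]]; auto.
  by rewrite eqxx.
by rewrite eqxx orbT.
Qed.

Lemma Qstar_psqM C q : ~~ (p %| q)%N -> (0 < q)%N ->
  Qstar p (cls C) (q * p * p)%N%:Z ->
  (0 < cnum (C * P * P)%g q)%N \/ (0 < cnum (C * P^-1 * P^-1)%g q)%N.
Proof.
move=> pq q0; rewrite (Qstar_clsM D0 pp) ?muln_gt0 ?q0 // dvdn_mull // mulnK //.
have := hecke_mul C q; rewrite !(hecke_coprime _ pq) mulgK mulgKV; lia.
Qed.

(** For q prime to p, r_C(q p^3) - r_C(q p) is the sum of the r_(C P^3)(q) and
    r_(C P^-3)(q). *)
Lemma Qstar_pcubeM C q : ~~ (p %| q)%N -> (0 < q)%N ->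
  Qstar p (cls C) (q * p * p * p)%N%:Z ->
  (0 < cnum (C * P * P * P)%g q)%N \/ (0 < cnum (C * P^-1 * P^-1 * P^-1)%g q)%N.
Proof.
move=> pq q0; rewrite (Qstar_clsM D0 pp) ?muln_gt0 ?q0 ?p0 //.
rewrite dvdn_mull // mulnK // (hecke_coprime _ pq).
have := hecke_mul C (q * p).
have := hecke_mul (C * P)%g q; have := hecke_mul (C * P^-1)%g q.
by rewrite !(hecke_coprime _ pq) !mulgK !mulgKV; lia.
Qed.

(** The relations at p give r_C(n p^2) = 2 r_C(n) - r_C(n / p^2) for p | n and
    r_C(n p^2) = 3 r_C(n) otherwise, so that p-primitive representations
    propagate by induction. *)
Lemma hecke_completely_primitive C :
  cnum (C * P * P)%g =1 cnum C -> cnum (C * P^-1 * P^-1)%g =1 cnum C ->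
  completely_primitive p (cls C).
Proof.
move=> E1 E2; apply/seteqP; split=> N /=; last first.
  by move=> /(Qstar_cls pp)[N0 [v [_ E]]]; apply/Q_cls; split=> //; exists v.
have star n : (0 < n)%N -> (0 < cnum C n)%N -> Qstar p (cls C) n%:Z.
  have [m] := ubnP n; elim: m n => // m IH n nm n0 Cn.
  have [/dvdnP[k kE]|pn] := boolP (p %| n)%N; last exact/(Qstar_clsN D0 pp).
  have k0 : (0 < k)%N by move: n0; rewrite kE muln_gt0 => /andP[].
  rewrite kE in n0 nm Cn *; apply/(Qstar_clsM D0 pp) => //.
  case: ifP => // /dvdnP[j jE]; rewrite jE in k0 n0 nm Cn *.
  have j0 : (0 < j)%N by move: k0; rewrite muln_gt0 => /andP[].
  rewrite mulnK //; have h1 := hecke_mul C j.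
  have [/dvdnP[i iE]|pj] := boolP (p %| j)%N; last first.
    move: h1; rewrite !(hecke_coprime _ pj) mulgK mulgKV E1 E2; lia.
  rewrite iE in j0 k0 n0 nm Cn h1 *.
  have i0 : (0 < i)%N by move: j0; rewrite muln_gt0 => /andP[].
  have h2 := hecke_mul (C * P)%g i; have h3 := hecke_mul (C * P^-1)%g i.
  have h4 := HP C i; rewrite mulgK E1 in h2; rewrite mulgKV E2 in h3.
  have p1 := prime_gt1 pp.
  have [x0|x0] := posnP (cnum C (i * p)); first by lia.
  have lt : (i * p < m)%N.
    apply: leq_trans (_ : i * p * p * p <= m)%N; last by rewrite -ltnS.
    by rewrite -mulnA ltn_Pmulr // -[1%N]muln1; apply: ltn_mul.
  have /(Qstar_clsM D0 pp C i0) h5 := IH _ lt j0 x0.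
  by lia.
move=> /Q_cls[N0 [v E]]; have fC := cg_repP C; have [_ pd _] := fC.
have v0 : v != (0, 0).
  by apply: contraNneq N0 => v0; rewrite -E v0 /bqf_eval /= !expr2 !(mulr0, addr0).
have Np : 0 < N by rewrite -E; case: v v0 {E} => x y; exact: pd.
have NE : N = `|N|%N%:Z by lia.
rewrite NE; apply: star; first by lia.
by apply/(rnum_gt0 _ D0 fC); exists v.1, v.2; rewrite -NE.
Qed.

End Relation.

Hypothesis PT : forall (C : G) B, exists q : nat,
  [/\ prime q, (B < q)%N, ~~ (q%:Z %| D)%Z & (0 < cnum C q)%N].

Lemma completely_primitive_iff pb pc (C : G) : ~~ (p%:Z %| D)%Z ->
  disc (BQF p%:Z pb pc) = D -> ~ Qstar p (@cls D G 1%g) (p%:Z ^+ 2) ->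
  completely_primitive p (cls C) <->
  (Qstar p (@cls D G (C ^+ 2)%g) (p%:Z ^+ 2) /\ #[C]%g = 4%N).
Proof.
move=> pD dp np; have [P0 H0] := cnum_split G D0 pp pD dp.
have P2 (P : G) : hecke P -> (P * P)%g <> 1%g.
  by move=> HP PP; apply: np; apply/(Qstar_psq HP); left; rewrite mul1g.
have big (E : G) : exists q : nat,
    [/\ prime q, ~~ (p %| q)%N, ~~ (q%:Z %| D)%Z & (0 < cnum E q)%N].
  have [q [pq pltq qD Eq]] := PT E p; exists q; split=> //.
  by rewrite dvdn_prime2 // neq_ltn pltq.
split=> [cp|[C2 o4]].
  have QQ n : (0 < n)%N -> (0 < cnum C n)%N -> Qstar p (cls C) (n * p * p)%N%:Z.
    move=> n0 /(rnum_gt0 _ D0 (cg_repP C))[x [y xyE]].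
    rewrite -cp; apply/Q_cls; split.
      by rewrite eqz_nat -lt0n !muln_gt0 n0 prime_gt0.
    exists (x * p%:Z, y * p%:Z) => /=; rewrite !PoszM -xyE /bqf_eval; ring.
  (* from a prime represented by C *)
  have [P [HP CP]] : exists P : G, hecke P /\ (C * C = P * P)%g.
    have [q [pq pnq qD Cq]] := big C.
    have star := QQ q (prime_gt0 pq) Cq.
    have aux (P : G) : hecke P -> (0 < cnum (C * P * P)%g q)%N ->
        (C * C = P^-1 * P^-1)%g.
      move=> HP CPq; have [E|E] := cnum_prime D0 D4 pq qD Cq CPq.
        by case: (P2 P HP); apply: (mulgI C); rewrite mulgA mulg1.
      have h : (C * (C * P * P) = 1)%g by rewrite E mulgV.
      by apply: (mulIg P); apply: (mulIg P); rewrite mulgKV mulVg -h !mulgA.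
    have [h|h] := Qstar_psqM H0 pnq (prime_gt0 pq) star.
      by exists (P0^-1)%g; split; [exact: heckeV|exact: aux].
    exists P0; split=> //.
    by have := aux _ (heckeV H0) h; rewrite !invgK.
  (* from a prime represented by C P^-1 *)
  have P4 : (P * P * (P * P) = 1)%g.
    have [q [pq pnq qD Eq]] := big (C * P^-1)%g.
    have Cq : (0 < cnum C (q * p))%N.
      by rewrite (hecke_coprime HP _ pnq) addn_gt0 Eq orbT.
    have qp0 : (0 < q * p)%N by rewrite muln_gt0 !prime_gt0.
    have star := QQ (q * p)%N qp0 Cq.
    have [h|h] := Qstar_pcubeM HP pnq (prime_gt0 pq) star;
        have [E|E] := cnum_prime D0 D4 pq qD Eq h.
    - by apply: (mulgI C); rewrite mulg1 !mulgA E mulgKV.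
    - have : (C * P * P * P * (C * P^-1) = 1)%g by rewrite E mulVg.
      rewrite -mulgA [(P * (C * P^-1))%g]cg_mulC mulgKV.
      by rewrite [(C * P * P * C)%g]cg_mulC !mulgA CP -mulgA.
    - case: (P2 P HP); apply: (mulgI (C * P^-1 * P^-1 * P^-1)%g).
      by rewrite mulgA !mulgKV mulg1 E.
    - have : (C * P^-1 * P^-1 * P^-1 * (C * P^-1) = 1)%g by rewrite E mulVg.
      rewrite mulgA [(C * P^-1 * P^-1 * P^-1 * C)%g]cg_mulC !mulgA CP.
      rewrite mulgK mulgV mul1g.
      move=> PV; case: (P2 P HP); apply: invg_inj.
      by rewrite invMg PV invg1.
  have C4 : (C ^+ 4 = 1)%g by rewrite (expgnDr C 2 2) !expgS expg0 mulg1 CP P4.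
  have CC : (C ^+ 2 = P * P)%g by rewrite !expgS expg0 mulg1.
  split.
    by apply/(Qstar_psq HP); right; rewrite CC !mulgK mulgV.
  have o4 : (#[C]%g %| 4)%N by rewrite order_dvdn C4.
  have o2 : ~~ (#[C]%g %| 2)%N.
    by rewrite order_dvdn CC; apply/eqP; exact: P2.
  have := dvdn_leq (isT : 0 < 4)%N o4; move: (order_gt0 C) o4 o2.
  by case: (#[C]%g) => [|[|[|[|[|n]]]]].
have C4 : (C * C * (C * C) = 1)%g.
  have : (C ^+ 4 = 1)%g by rewrite -o4 expg_order.
  by rewrite (expgnDr C 2 2) !expgS expg0 mulg1.
have aux (P : G) : hecke P -> (C * C * P * P = 1)%g ->
    completely_primitive p (cls C).
  move=> HP E; apply: (hecke_completely_primitive HP) => n.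
    have -> : (C * P * P = C^-1)%g.
      by apply: (mulgI C); rewrite mulgV !mulgA.
    by rewrite cnum_inv.
  have -> : (C * P^-1 * P^-1 = C^-1)%g.
    apply: (mulgI C); rewrite mulgV !mulgA.
    have -> : (C * C = P^-1 * P^-1)%g.
      by apply: (mulIg P); apply: (mulIg P); rewrite mulgKV mulVg.
    have PC : (P^-1 * P^-1 = C * C)%g.
      by apply: (mulIg P); apply: (mulIg P); rewrite mulgKV mulVg.
    by rewrite -mulgA PC C4.
  by rewrite cnum_inv.
have [h|h] := (Qstar_psq H0 _).1 C2; move: h; rewrite !expgS expg0 mulg1 => h.
  exact: aux H0 h.
exact: aux (heckeV H0) h.
Qed.
End Main.

(** * Counting lattice points by residues *)

Section Residues.
Variable M : nat.
Hypothesis M0 : (0 < M)%N.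

Definition cop (z : int) : bool := coprimez z M%:Z.

Lemma copMD z u : cop (z + M%:Z * u) = cop z.
Proof.
by rewrite /cop /coprimez mulrC addrC !(gcdzC _ M) gcdzMDl.
Qed.

Definition residue_count (g : int -> int -> int) : nat :=
  \sum_(x < M) \sum_(y < M) cop (g x%:Z y%:Z).

(** For fixed y, the map x -> al x + be y permutes the residues modulo M. *)
Lemma residue_count_change (f g : int -> int -> int) (al be ga : int) :
  cop al -> cop ga -> (forall x y, ga * f x y = g (al * x + be * y) y) ->
  (forall x u y, exists w, g (x + M%:Z * u) y = g x y + M%:Z * w) ->
  residue_count f = residue_count g.
Proof.
move=> ca cg E per; rewrite /residue_count exchange_big [RHS]exchange_big /=.
apply: eq_bigr => y _; have M0' : M%:Z != 0 by lia.
have lt x : (absz ((al * x + be * y%:Z) %% M%:Z)%Z < M)%N.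
  by have := ltz_pmod (al * x + be * y%:Z) (d := M%:Z); have := modz_ge0 (al * x + be * y%:Z) M0'; lia.
pose h (x : 'I_M) := Ordinal (lt x%:Z).
have inj : injective h.
  move=> x x' /(congr1 val) /= e.
  have {}e : ((al * x%:Z + be * y%:Z) %% M = (al * x'%:Z + be * y%:Z) %% M)%Z.
    have := modz_ge0 (al * x%:Z + be * y%:Z) M0'.
    have := modz_ge0 (al * x'%:Z + be * y%:Z) M0'; lia.
  move/eqP: e; rewrite eqz_mod_dvd.
  have -> : al * x%:Z + be * y%:Z - (al * x'%:Z + be * y%:Z) = al * (x%:Z - x'%:Z) by ring.
  rewrite Gauss_dvdzr; last by rewrite coprimez_sym.
  have small (i : 'I_M) : ((i : nat)%:Z %% M = (i : nat)%:Z)%Z.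
    by rewrite modz_small // ltz_nat ltn_ord.
  rewrite -eqz_mod_dvd => /eqP; rewrite !small => e.
  by apply: val_inj; case: e.
rewrite [RHS](reindex_inj inj) /=; apply: eq_bigr => x _; congr nat_of_bool.
have -> : cop (f x%:Z y%:Z) = cop (ga * f x%:Z y%:Z) by rewrite /cop coprimezMl (cg : coprimez ga M).
rewrite E; set z := al * _ + _.
have zE : z = (absz (z %% M)%Z)%:Z + M%:Z * (z %/ M)%Z.
  by rewrite gez0_abs ?modz_ge0 // addrC mulrC -divz_eq.
have [w wE] := per (absz (z %% M)%Z)%:Z (z %/ M)%Z y%:Z.
by rewrite {1}zE wE copMD.
Qed.

End Residues.

(** Completing the square takes f, up to a factor prime to D, to a form that
    depends on D only. *)
Lemma residue_count_form D f : D < 0 -> forms D f -> coprimez (qa f) D ->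
  residue_count `|D| (bqf_eval f) = residue_count `|D|
    (if (2 %| D)%Z then fun x y => x ^+ 2 - (D %/ 4)%Z * y ^+ 2
     else fun x y => x ^+ 2 - D * y ^+ 2).
Proof.
move=> D0 ff ca; have [_ _ fD] := ff.
have DM : `|D|%N%:Z = - D by rewrite ltz0_abs.
have copE z : cop `|D| z = coprimez z D by rewrite /cop DM coprimezN.
have M0 : (0 < `|D|)%N by rewrite absz_gt0; lia.
have par := forms_parity ff.
case: (boolP (2 %| D)%Z) => ev.
  have [b' bE] : exists b', qb f = 2 * b'.
    have : (2 %| qb f)%Z by rewrite -(subrK D (qb f)) rpredD.
    by move=> /dvdzP[b' ->]; exists b'; rewrite mulrC.
  have dE : D = 4 * (b' ^+ 2 - qa f * qc f).
    by rewrite -fD /disc bE; ring.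
  have d4 : (D %/ 4)%Z = b' ^+ 2 - qa f * qc f by rewrite {1}dE mulrC mulzK.
  rewrite d4; apply: (residue_count_change M0 (al := qa f) (be := b') (ga := qa f)).
  - by rewrite copE.
  - by rewrite copE.
  - by move=> x y; rewrite /bqf_eval bE; ring.
  - by move=> x u y; exists (2 * x * u + `|D|%N%:Z * u ^+ 2); ring.
have c2 : coprimez 2 D.
  by rewrite coprimezE /= prime_coprime //; rewrite dvdzE in ev.
apply: (residue_count_change M0 (al := 2 * qa f) (be := qb f) (ga := 4 * qa f)).
- by rewrite copE coprimezMl c2.
- by rewrite copE coprimezMl ca andbT -[4]/(2 * 2 : int) coprimezMl c2.
- by move=> x y; rewrite -fD /disc /bqf_eval; ring.
- by move=> x u y; exists (2 * x * u + `|D|%N%:Z * u ^+ 2); ring.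
Qed.

(** * Mean values of representation numbers *)

Section Window.
Variables (M m1 m2 : nat).
Hypothesis M0 : (0 < M)%N.

(** Two residues modulo M and two quotients: the index set of a box of integer
    vectors, grouped into cosets of M Z^2. *)
Definition window := ('I_M * 'I_M * ('I_(2 * m1) * 'I_(2 * m2)))%type.

Definition icoord (m v0 k : nat) : int := v0%:Z + M%:Z * (k%:Z - m%:Z).

Definition wvec (t : window) : int * int :=
  (icoord m2 t.1.1 t.2.2, icoord m1 t.1.2 t.2.1).

Lemma icoord_inj m (v v' : 'I_M) (k k' : nat) :
  icoord m v k = icoord m v' k' -> v = v' /\ k = k'.
Proof.
rewrite /icoord => e.
have e' : (k * M + v = k' * M + v')%N.
  apply/eqP; rewrite -eqz_nat !PoszD !PoszM; apply/eqP.
  have -> : k%:Z * M%:Z + v%:Z = v%:Z + M%:Z * (k%:Z - m%:Z) + M%:Z * m%:Z by ring.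
  by rewrite e; ring.
have := congr1 (fun z => z %/ M)%N e'; have := congr1 (fun z => z %% M)%N e'.
rewrite !modnMDl !modn_small ?ltn_ord // => ev.
rewrite !divnMDl // !divn_small ?ltn_ord // !addn0 => ek.
by split=> //; exact: val_inj.
Qed.

Lemma wvec_inj : injective wvec.
Proof.
move=> [[x y] [j k]] [[x' y'] [j' k']] [] /= /icoord_inj[-> ek] /icoord_inj[-> ej].
by congr (_, (_, _)); exact: val_inj.
Qed.

Lemma icoord_surj m z : `|z| < m%:Z -> exists (v : 'I_M) (k : 'I_(2 * m)), z = icoord m v k.
Proof.
move=> zm; pose h := absz (z + M%:Z * m%:Z).
have Mm : m%:Z <= M%:Z * m%:Z by rewrite ler_peMl //; lia.
have hE : h%:Z = z + M%:Z * m%:Z by rewrite gez0_abs //; lia.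
have hk : (h %/ M < 2 * m)%N.
  rewrite ltn_divLR // -ltz_nat hE !PoszM.
  have -> : 2%:Z * m%:Z * M%:Z = M%:Z * m%:Z + M%:Z * m%:Z by ring.
  lia.
exists (Ordinal (ltn_pmod h M0)), (Ordinal hk); rewrite /icoord /= mulrBr.
have -> : (h %% M)%N%:Z + (M%:Z * (h %/ M)%N%:Z - M%:Z * m%:Z) = h%:Z - M%:Z * m%:Z.
  by rewrite {3}(divn_eq h M) PoszD PoszM; ring.
by rewrite hE addrK.
Qed.

Lemma wvec_surj x y : `|x| < m2%:Z -> `|y| < m1%:Z -> exists t, wvec t = (x, y).
Proof.
move=> /icoord_surj[v [k ->]] /icoord_surj[v' [k' ->]].
by exists (v, v', (k', k)).
Qed.

Lemma rnum_window D f n : D < 0 -> forms D f ->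
  (forall x y, bqf_eval f x y = n%:Z -> `|x| < m2%:Z /\ `|y| < m1%:Z) ->
  rnum f n = (\sum_(t : window) (bqf_eval f (wvec t).1 (wvec t).2 == n%:Z))%N.
Proof.
move=> D0 ff h; pose P (t : window) := bqf_eval f (wvec t).1 (wvec t).2 == n%:Z.
rewrite -[RHS](_ : #|P| = _); last by rewrite -sum1_card big_mkcond.
rewrite /rnum cardE -(size_map wvec); apply: perm_size; apply: uniq_perm.
- exact: uniq_sols.
- by rewrite map_inj_uniq ?enum_uniq //; exact: wvec_inj.
move=> [x y]; rewrite (mem_sols _ _ D0 ff) /=; apply/eqP/mapP => [e|[t]].
  have [hx hy] := h _ _ e; have [t tE] := wvec_surj hx hy.
  by exists t => //; rewrite mem_enum unfold_in /P tE /= e.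
by rewrite mem_enum unfold_in /P => /eqP e [-> ->].
Qed.

End Window.

Lemma window_bound D f (nb s n : nat) x y : D < 0 -> forms D f -> (`|qb f| <= nb)%N ->
  (n < s ^ 2)%N -> bqf_eval f x y = n%:Z ->
  `|x| < (radius_x `|qa f| nb * s)%N%:Z /\ `|y| < (radius_y `|qa f| * s)%N%:Z.
Proof.
move=> D0 ff bn ns E; have a0 := forms_qa_gt0 ff; have [_ _ fD] := ff.
pose a := `|qa f|%N; have aE : qa f = a%:Z by rewrite /a gez0_abs // ltW.
have a1 : (0 < a)%N by rewrite absz_gt0 gt_eqF.
have s0 : (0 < s)%N by case: (s) ns => //; rewrite ltn0.
have sqE : 4 * qa f * bqf_eval f x y = (2 * qa f * x + qb f * y) ^+ 2 + (- D) * y ^+ 2.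
  by rewrite -fD /disc /bqf_eval; ring.
have lt4 : 4 * qa f * bqf_eval f x y < (2 * (a * s)%N%:Z) ^+ 2.
  rewrite E aE; have -> : (2 * (a * s)%N%:Z) ^+ 2 = (4 * (a * (a * s ^ 2)))%N%:Z.
    by rewrite !PoszM; ring.
  have -> : 4 * a%:Z * n%:Z = (4 * (a * n))%N%:Z by rewrite !PoszM mulrA.
  rewrite ltz_nat ltn_pmul2l // ltn_pmul2l //.
  by apply: leq_trans ns _; rewrite leq_pmull.
have lt_sq (z : int) : z ^+ 2 < (2 * (a * s)%N%:Z) ^+ 2 -> `|z| < 2 * (a * s)%N%:Z.
  by rewrite -(real_normK (num_real z)) ltr_pXn2r // nnegrE // mulr_ge0.
have yb : `|y| < 2 * (a * s)%N%:Z.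
  apply: lt_sq; apply: le_lt_trans lt4; rewrite sqE.
  have h : 0 <= (- D - 1) * y ^+ 2 by rewrite mulr_ge0 ?sqr_ge0 //; lia.
  have := sqr_ge0 (2 * qa f * x + qb f * y); move: h; rewrite mulrBl mul1r; lra.
have ub : `|2 * qa f * x + qb f * y| < 2 * (a * s)%N%:Z.
  apply: lt_sq; apply: le_lt_trans lt4; rewrite sqE.
  by rewrite lerDl mulr_ge0 ?sqr_ge0 // oppr_ge0 ltW.
split; last first.
  apply: lt_trans yb _; rewrite /radius_y -/a mulSn -mulnA PoszD -PoszM; lia.
have by_ : `|qb f * y| <= nb%:Z * (2 * (a * s)%N%:Z).
  rewrite normrM; by apply: ler_pM => //; exact: ltW.
have xb : 2 * a%:Z * `|x| < 2 * (a * s)%N%:Z + nb%:Z * (2 * (a * s)%N%:Z).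
  have -> : 2 * a%:Z * `|x| = `|2 * qa f * x + qb f * y - qb f * y|.
    by rewrite addrK aE normrM ger0_norm ?mulr_ge0.
  apply: le_lt_trans (ler_normB _ _) _; exact: ltr_leD.
have {}xb : `|x| < s%:Z + nb%:Z * s%:Z.
  rewrite -(ltr_pM2l (x := 2 * a%:Z)) ?mulr_gt0 //; apply: lt_le_trans xb _.
  by rewrite le_eqVlt; apply/orP; left; apply/eqP; rewrite PoszM; ring.
apply: lt_le_trans xb _; rewrite -PoszM -PoszD lez_nat /radius_x /radius_y -/a.
by rewrite mulnDl addnC leq_add ?leq_mul ?leq_pmulr // ?leq_pmull.
Qed.

Lemma exists_root (T : R) : 1 <= T -> exists s : nat,
  [/\ (0 < s)%N, T <= s%:R ^+ 2 & s%:R ^+ 2 <= 4 * T].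
Proof.
move=> T1; have ex : exists s : nat, `[< T <= s%:R ^+ 2 >].
  exists (Num.bound T); apply/asboolP.
  have h : T <= (Num.bound T)%:R by apply/ltW/archi_boundP; lra.
  by apply: (le_trans h); rewrite expr2 ler_peMl // (le_trans T1).
have [s /asboolP hs smin] := ex_minnP ex.
have s0 : (0 < s)%N by case: (s) hs => //; rewrite expr0n /= => ?; lra.
exists s; split=> //; case: s s0 hs smin => // -[|s] _ hs smin; first by rewrite expr1n; lra.
have : s.+1%:R ^+ 2 < T.
  by rewrite ltNge; apply/negP => h; have := smin s.+1; rewrite ltnn => /(_ (asboolT h)).
have : s.+2%:R <= 2 * s.+1%:R :> R by rewrite -natrM ler_nat; lia.
move: (s.+1%:R) (ler0n R s.+1) (s.+2%:R) (ler0n R s.+2) => v v0 u u0 uv vT.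
have : u ^+ 2 <= (2 * v) ^+ 2 by apply: lerXn2r; rewrite ?nnegrE ?mulr_ge0.
rewrite exprMn; lra.
Qed.

(** The constant density for forms of discriminant D and the modulus |D|: it does
    not depend on the form. *)
Definition disc_density (D : int) : R :=
  (mass sqr_pos * mass root5_pos / (`|D|%N%:R ^+ 2 * sqrt ((- D)%:~R / 4)%R))%R.

Section FormMean.
Variables (D : int) (f : bqf).
Hypothesis D0 : D < 0.
Hypothesis ff : forms D f.
Let M := `|D|%N.
Let a := `|qa f|%N.
Let nb := `|qb f|%N.
Let b : R := (qb f)%:~R.
Let c : R := (qc f)%:~R.

Lemma M_gt0 : (0 < M)%N. Proof. by rewrite absz_gt0 lt_eqF. Qed.

Lemma lead_abs : qa f = a%:Z.
Proof. by rewrite /a gez0_abs // ltW // (forms_qa_gt0 ff). Qed.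

Lemma form_ge0 x y : 0 <= bqf_eval f x y.
Proof.
have [_ pd _] := ff; have [[-> ->]|ne] := eqVneq (x, y) (0, 0).
  by rewrite /bqf_eval expr0n !mulr0 !addr0.
exact/ltW/pd.
Qed.

Lemma discR : 4 * a%:R * c - b ^+ 2 = (- D)%:~R.
Proof.
have [_ _ <-] := ff; rewrite /disc opprB lead_abs /b /c.
by rewrite rmorphB rmorphXn /= !rmorphM /=.
Qed.

Lemma qform_wvec m1 m2 (t : window M m1 m2) :
  (bqf_eval f (wvec t).1 (wvec t).2)%:~R =
  qform a b c (lattice_coord M m2 t.1.1 t.2.2) (lattice_coord M m1 t.1.2 t.2.1).
Proof.
have cE m v k : (icoord M m v k)%:~R = lattice_coord M m v k.
  by rewrite /icoord /lattice_coord rmorphD rmorphM rmorphB.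
rewrite -!cE /wvec /=; move: (icoord _ _ _) (icoord _ _ _) => X Y.
by rewrite /bqf_eval /qform !expr2 !(rmorphD, rmorphM) /= lead_abs.
Qed.

Lemma cop_wvec m1 m2 (t : window M m1 m2) :
  cop M (bqf_eval f (wvec t).1 (wvec t).2) = cop M (bqf_eval f (t.1.1 : nat)%:Z (t.1.2 : nat)%:Z).
Proof.
case: t => -[x y] [j k] /=; rewrite /icoord.
move: (k%:Z - m2%:Z : int) (j%:Z - m1%:Z : int) => u v.
rewrite -(copMD M (bqf_eval f x%:Z y%:Z) (qa f * (2 * x%:Z * u + M%:Z * u ^+ 2) +
  qb f * (x%:Z * v + u * y%:Z + M%:Z * u * v) + qc f * (2 * y%:Z * v + M%:Z * v ^+ 2))).
by congr (cop M _); rewrite /bqf_eval; ring.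
Qed.

(** The weight depends on the value of the form only, so the sum is one over
    lattice vectors, and whether the value is prime to M depends on the coset
    of M Z^2. *)
Lemma form_mean : exists K : R, forall (N : nat) (y : R), 1 <= y -> y <= N%:R ->
  `|\sum_(n < N) (coprime n M)%:R * (rnum f n)%:R * kern n%:R y -
    disc_density D * (residue_count M (bqf_eval f))%:R * y ^+ 3| <= K * y ^+ 2.
Proof.
have a0 : (0 < a)%N by rewrite absz_gt0 gt_eqF // (forms_qa_gt0 ff).
have bnb : `|b| <= nb%:R by rewrite /b /nb -intr_norm natr_absz.
have delta1 : 1 <= 4 * a%:R * c - b ^+ 2.
  by rewrite discR (ler_int _ 1); lia.
have [K0 hK] := coset_sum a0 M_gt0 bnb delta1.
exists (M%:R ^+ 2 * (16 * `|K0|)) => N y y1 yN.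
have [s [s0 ys sy]] := exists_root y1.
pose m1 := (radius_y a * s)%N; pose m2 := (radius_x a nb * s)%N.
pose h (t : window M m1 m2) := `|bqf_eval f (wvec t).1 (wvec t).2|%N.
have hE (t : window M m1 m2) : bqf_eval f (wvec t).1 (wvec t).2 = (h t)%:Z.
  by rewrite /h gez0_abs // form_ge0.
have stepA : \sum_(n < N) (coprime n M)%:R * (rnum f n)%:R * kern n%:R y =
    \sum_(t : window M m1 m2) (coprime (h t) M)%:R * kern (h t)%:R y.
  transitivity (\sum_(n < N) \sum_(t : window M m1 m2)
      (h t == n)%N%:R * ((coprime n M)%:R * kern n%:R y)).
    apply: eq_bigr => n _; have [ns|ns] := ltnP n (s ^ 2).
      rewrite (@rnum_window M m1 m2 M_gt0 D f n D0 ff); last first.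
        by move=> x' y' E; apply: (window_bound D0 ff (leqnn _) ns E).
      rewrite natr_sum mulr_sumr mulr_suml; apply: eq_bigr => t _.
      by rewrite hE eqz_nat mulrAC mulrC.
    have -> : kern n%:R y = 0.
      rewrite kernE rpos_0 ?expr0n // subr_le0; apply: (le_trans ys).
      by rewrite -natrX ler_nat.
    by rewrite mulr0 big1 // => t _; rewrite !mulr0.
  rewrite exchange_big /=; apply: eq_bigr => t _.
  rewrite (@sum_pick N (h t) (fun n => (coprime n M)%:R * kern n%:R y)).
  case: ltnP => // Nh; rewrite kernE rpos_0 ?expr0n ?mulr0 // subr_le0.
  by apply: (le_trans yN); rewrite ler_nat.
pose S (x0 y0 : nat) : R := \sum_(j < 2 * m1) \sum_(k < 2 * m2)
  rpos (y - qform a b c (lattice_coord M m2 x0 k) (lattice_coord M m1 y0 j))%R ^+ 2.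
have stepB : \sum_(t : window M m1 m2) (coprime (h t) M)%:R * kern (h t)%:R y =
    \sum_(x < M) \sum_(y < M) (cop M (bqf_eval f x%:Z y%:Z))%:R * S x y.
  rewrite pair_bigA /=.
  under [RHS]eq_bigr => p _ do rewrite /S pair_bigA /= mulr_sumr.
  rewrite pair_bigA /=; apply: eq_bigr => -[[x0 y0] [j k]] _.
  have -> : coprime (h ((x0, y0), (j, k))) M = cop M (bqf_eval f x0%:Z y0%:Z).
    by rewrite -(cop_wvec ((x0, y0), (j, k))) hE /cop coprimezE !absz_nat.
  rewrite kernE; congr (_ * rpos (_ - _)%R ^+ 2).
  by rewrite -[(h _)%:R]/((h _)%:~R) -hE qform_wvec.
have dE : density a M b c = disc_density D by rewrite /density discR.
have -> : disc_density D * (residue_count M (bqf_eval f))%:R * y ^+ 3 =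
    \sum_(x0 < M) \sum_(y0 < M) (cop M (bqf_eval f x0%:Z y0%:Z))%:R *
      (disc_density D * y ^+ 3).
  rewrite mulrAC mulrC /residue_count natr_sum mulr_suml; apply: eq_bigr => x0 _.
  by rewrite natr_sum mulr_suml.
rewrite stepA stepB -sumrB.
have -> : M%:R ^+ 2 * (16 * `|K0|) * y ^+ 2 = \sum_(x < M) \sum_(y0 < M) 16 * `|K0| * y ^+ 2.
  by rewrite !sumr_const card_ord -!mulrnA -[RHS]mulr_natl natrM expr2 -!mulrA.
apply: le_trans (ler_norm_sum _ _ _) _; apply: ler_sum => x0 _.
rewrite -sumrB; apply: le_trans (ler_norm_sum _ _ _) _; apply: ler_sum => y0 _.
have y20 : 0 <= y ^+ 2 by exact: sqr_ge0.
case: (cop M _); last by rewrite !mul0r subr0 normr0; apply: mulr_ge0 y20; rewrite mulr_ge0.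
rewrite !mul1r -dE; have y0' : 0 <= y by exact: le_trans y1.
apply: le_trans (hK x0 y0 s y (ltn_ord _) (ltn_ord _) s0 y0' ys) _.
apply: (@le_trans _ _ (`|K0| * s%:R ^+ 4)); first by rewrite ler_wpM2r ?ler_norm // exprn_ge0.
have -> : 16 * `|K0| * y ^+ 2 = `|K0| * (4 * y) ^+ 2 by ring.
rewrite ler_wpM2l // (exprM _ 2 2); apply: lerXn2r; rewrite ?nnegrE ?exprn_ge0 //.
by rewrite mulr_ge0.
Qed.

End FormMean.

Lemma residue_count_gt0 D f : D < -1 -> forms D f -> coprimez (qa f) D ->
  (0 < residue_count `|D| (bqf_eval f))%N.
Proof.
move=> D1 ff ca; have M1 : (1 < `|D|)%N by lia.
have M0 : (0 < `|D|)%N by lia.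
rewrite /residue_count (bigD1 (Ordinal M1)) //= (bigD1 (Ordinal M0)) //=.
have -> : bqf_eval f 1 0 = qa f by rewrite /bqf_eval expr1n expr0n /= !mulr0 !addr0 mulr1.
by rewrite /cop coprimezE absz_nat -coprimezE ca.
Qed.

Lemma disc_density_gt0 D : D < 0 -> 0 < disc_density D.
Proof.
move=> D0; have p1 : 0 < mass sqr_pos by apply/RltP; exact: mass_pos profile_sqr.
have p2 : 0 < mass root5_pos by apply/RltP; exact: mass_pos profile_root5.
have M0 : (0 < `|D|)%N by rewrite absz_gt0 lt_eqF.
rewrite /disc_density divr_gt0 ?mulr_gt0 ?exprn_gt0 ?ltr0n //.
by apply/RltP/sqrt_lt_R0/RltP; rewrite divr_gt0 // (ltr_int _ 0) oppr_gt0.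
Qed.

(** * Every class represents arbitrarily large primes *)

Lemma disc_lt D : D < 0 -> (D = 0 %[mod 4])%Z \/ (D = 1 %[mod 4])%Z -> D < -1.
Proof.
move=> D0 D4; rewrite ltNge; apply/negP => h.
have := divz_eq D 4; have E : D = -1 by lia.
by case: D4 => ->; rewrite E; lia.
Qed.

(** Each class is taken with a form whose leading coefficient is prime to D, so
    that its number of residues is the common one. *)
Lemma class_mean D (G : class_group D) : D < 0 -> D < -1 ->
  exists kap K : R, 0 < kap /\ forall (C : G) (N : nat) (y : R), 1 <= y -> y <= N%:R ->
  `|\sum_(n < N) (coprime n `|D|)%:R * (cnum C n)%:R * kern n%:R y - kap * y ^+ 3|
    <= K * y ^+ 2.
Proof.
move=> D0 D1; have M0 : (0 < `|D|)%N by lia.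
have rep (C : G) : exists g, [/\ forms D g, coprimez (qa g) D & forall n, cnum C n = rnum g n].
  have fC := cg_repP C; have [prim _ _] := fC.
  have [g e cg] := proper_equiv_coprime_lead prim M0.
  have fg := forms_equiv e fC; exists g; split=> //.
  by move=> n; exact: rnum_equiv D0 fC e.
have [h hP] := choice rep.
pose rc := residue_count `|D| (bqf_eval (h 1%g)).
have rcE (C : G) : residue_count `|D| (bqf_eval (h C)) = rc.
  have [f1 c1 _] := hP C; have [f2 c2 _] := hP 1%g.
  by rewrite /rc !residue_count_form.
have mean (C : G) : exists K : R, forall (N : nat) (y : R), 1 <= y -> y <= N%:R ->
   `|\sum_(n < N) (coprime n `|D|)%:R * (cnum C n)%:R * kern n%:R y -
     disc_density D * rc%:R * y ^+ 3| <= K * y ^+ 2.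
  have [fC _ cE] := hP C; have [K hK] := form_mean D0 fC; exists K => N y y1 yN.
  rewrite -(rcE C); apply: le_trans (hK N y y1 yN).
  by under eq_bigr => n _ do rewrite cE.
have [K hK] := choice mean.
exists (disc_density D * rc%:R)%R, (\sum_C `|K C|); split.
  have [f1 c1 _] := hP 1%g.
  by rewrite mulr_gt0 ?disc_density_gt0 // ltr0n residue_count_gt0.
move=> C N y y1 yN; apply: le_trans (hK C N y y1 yN) _.
rewrite ler_wpM2r ?sqr_ge0 //; apply: le_trans (ler_norm _) _.
by rewrite (bigD1 C) //= lerDl sumr_ge0.
Qed.

(** Weber's theorem, for the class group of one discriminant. *)
Theorem class_represents_primes D (G : class_group D) : D < 0 ->
  (D = 0 %[mod 4])%Z \/ (D = 1 %[mod 4])%Z ->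
  forall (C : G) B, exists q : nat,
  [/\ prime q, (B < q)%N, ~~ (q%:Z %| D)%Z & (0 < cnum C q)%N].
Proof.
move=> D0 D4; have D1 := disc_lt D0 D4.
have [kap [K [kap0 mean]]] := class_mean G D0 D1.
pose rel (q : nat) (x : G) := forall (C : G) n,
  (cnum C (n * q) + (if (q %| n)%N then cnum C (n %/ q) else 0) =
   cnum (C * x)%g n + cnum (C * x^-1)%g n)%N.
have ndvd (q : nat) : prime q -> coprime q `|D| -> ~~ (q%:Z %| D)%Z.
  by move=> pq; rewrite prime_coprime // dvdzE absz_nat.
have exQ q : exists x : option G, forall (pq : prime q) (qM : coprime q `|D|),
    if x is Some y then rel q y else forall (C : G) n,
      cnum C (n * q) = if (q %| n)%N then cnum C (n %/ q) else 0%N.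
  have [[b [c dE]]|nd] := pselect (exists b c, disc (BQF q%:Z b c) = D).
    have [[pq qM]|no] := pselect (prime q /\ coprime q `|D|).
      have [x hx] := cnum_split G D0 pq (ndvd q pq qM) dE.
      by exists (Some x).
    by exists None => pq qM; case: no.
  exists None => pq qM; apply: cnum_inert => // b c dE.
  by apply: nd; exists b, c.
have [Q hQ] := choice exQ.
have ab : abelian [set: G]%SET.
  by apply/centsP => x _ y _; exact: cg_mulC.
have M1 : (1 < `|D|)%N by lia.
pose r (C : G) n : R := (cnum C n)%:R.
pose w : R := r 1%g 1%N.
have w0 : 0 < w by rewrite ltr0n cnum_eq1.
have r1 C : r C 1%N = if C == 1%g then w else 0.
  case: eqP => [->//|/eqP C1]; rewrite /r.
  by have := cnum_eq1 D0 D4 C; rewrite (negPf C1); case: (cnum C 1).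
have rM q : prime q -> coprime q `|D| -> forall C n,
  r C (n * q)%N + (if Q q is Some _ then 1 else -1) *
     (if (q %| n)%N then r C (n %/ q)%N else 0) =
  if Q q is Some x then r (C * x)%g n + r (C * x^-1)%g n else 0.
  move=> pq qM C n; have := hQ q pq qM; case: (Q q) => [x|] h.
    rewrite /r -natrD -h natrD mul1r; congr (_ + _).
    by case: ifP.
  rewrite /r h; case: ifP => _; first by rewrite mulN1r subrr.
  by rewrite mulr0 addr0.
move=> C B.
have [q [pq Bq qM rq]] := primes_in_classes ab M1 w0 kap0 (fun _ _ => ler0n _ _) r1 rM mean C B.
by exists q; split; rewrite ?ndvd //; move: rq; rewrite ltr0n.
Qed.

(** * Split primes and the criterion *)

(** A square root of D modulo an odd p can be given the parity of D, and then
    its square is D modulo 4 as well. *)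
Lemma split_disc D (p : nat) : (D = 0 %[mod 4])%Z \/ (D = 1 %[mod 4])%Z -> prime p ->
  kronecker_prime D p = 1 ->
  ~~ (p%:Z %| D)%Z /\ exists b c, disc (BQF p%:Z b c) = D.
Proof.
move=> D4 pp; rewrite /kronecker_prime; case: ifP => // /negbT pD.
case: eqP => [p2|p2].
  case: ifP => // h _; split=> //.
  have D8 : (D %% 8 = 1)%Z.
    case/orP: h => /eqP E; first exact: E.
    by case: D4 => E'; lia.
  exists 1, (- (D %/ 8)%Z); rewrite /disc /= p2.
  have := divz_eq D 8; rewrite D8 => E.
  by rewrite [RHS]E; ring.
case: ifP => // /existsP[x /eqP xE] _; split=> //.
have podd : odd p by case: (even_prime pp) => // /p2.
have [b bp b2] : exists2 b : int, (b ^+ 2 = D %[mod p])%Z & (2 %| b - D)%Z.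
  have [ev|od] := boolP (2 %| (x : nat)%:Z - D)%Z; first by exists x%:Z.
  exists ((x : nat)%:Z + p%:Z).
    rewrite -xE; apply/eqP; rewrite eqz_mod_dvd.
    have -> : ((x : nat)%:Z + p%:Z) ^+ 2 - (x : nat)%:Z ^+ 2 = (2 * (x : nat)%:Z + p%:Z) * p%:Z by ring.
    exact: dvdz_mull.
  by lia.
have d4 : (4 %| b ^+ 2 - D)%Z.
  have [k kE] : exists k, b = D + 2 * k.
    by move/dvdzP: b2 => [k kE]; exists k; rewrite mulrC -kE addrC subrK.
  have -> : b ^+ 2 - D = D * (D - 1) + 4 * (D * k + k ^+ 2) by rewrite kE; ring.
  apply: rpredD; last exact: dvdz_mulr.
  case: D4 => E; last by apply: dvdz_mull; rewrite -eqz_mod_dvd; apply/eqP.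
  by apply: dvdz_mulr; rewrite -[D]subr0 -eqz_mod_dvd; apply/eqP.
have dp : (p%:Z %| b ^+ 2 - D)%Z by rewrite -eqz_mod_dvd; apply/eqP.
have : (4 * p%:Z %| b ^+ 2 - D)%Z.
  rewrite Gauss_dvdz ?d4 //; rewrite coprimezE /= (@coprimeXl 2 2 p) //.
  by rewrite prime_coprime // dvdn2 negbK.
by move=> /dvdzP[c cE]; exists b, c; rewrite /disc /= -mulrA [_ * c]mulrC mulrCA -cE; ring.
Qed.

Theorem theorem4p2 (D : int) (p : nat)
    (D_lt0 : D < 0)
    (D_mod4 : (D = 0 %[mod 4])%Z \/ (D = 1 %[mod 4])%Z)
    (p_prime : prime p)
    (D_split : kronecker_prime D p = 1)
    (p2_notin : ~ Qstar p (class_one D) (p%:Z ^+ 2))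
    (A : set bqf) (A_class : classes D A) :
  completely_primitive p A <->
  (Qstar p (class_exp D A 2) (p%:Z ^+ 2) /\ has_order D A 4).
Proof.
have [G] := class_group_exists D_lt0 D_mod4.
have [pD [b [c dE]]] := split_disc D_mod4 p_prime D_split.
have [C AE] := cls_surj G A_class; rewrite AE cls_exp //.
have PT := class_represents_primes (G := G) D_lt0 D_mod4.
rewrite (cls_one G D_lt0 D_mod4) in p2_notin.
rewrite (completely_primitive_iff D_lt0 D_mod4 p_prime PT C pD dE p2_notin) //.
by rewrite has_order4.
Qed.
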